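(* Let $1<s\leqslant\infty$, $s'=s/(s-1)$, $k\in(1,2-1/s)$ and $\Phi_{k,s}:=\left\|\varphi_{k,s}''\right\|_{L_s(\mathbb{R}_+)}^{-1}\cdot\varphi_{k,s}$, where $\varphi_{k,s}$ is the function defined in the context. Then for every $f\in L^2_{\infty,s}(\mathbb{R}_+)$, there holds the sharp inequality $$\left\|D^k_-f\right\|_{L_\infty(\mathbb{R}_+)}\leqslant\frac{\left\|D^k_-\Phi_{k,s}\right\|_{L_\infty(\mathbb{R}_+)}}{\left\|\Phi_{k,s}\right\|_{L_\infty(\mathbb{R}_+)}^{1-\lambda}}\,\|f\|_{L_\infty(\mathbb{R}_+)}^{1-\lambda}\,\|f''\|_{L_s(\mathbb{R}_+)}^{\lambda},\qquad\lambda=\frac{k}{2-1/s}.$$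
   Context: $\mathbb{R}_+=[0,+\infty)$; $L^2_{\infty,s}(\mathbb{R}_+)$ is the space of $f\in L_\infty(\mathbb{R}_+)$ such that $f'$ is locally absolutely continuous on $\mathbb{R}_+$ and $f''\in L_s(\mathbb{R}_+)$. For $s=\infty$, $s'=1$ and $1/s=0$. Let $M=\{(a,b)\in(0,1)^2: a\leqslant b\}$. For $(a,b)\in M$ let $\omega(a,b;x)=0$ for $x=0$; $\omega(a,b;x)=a^{-1}(1-b)^{-1}\left(1-b-(1-b^{1-k})(1-a)\right)$ for $x\in(0,a]$; $\omega(a,b;x)=(1-b)^{-1}(1-b^{1-k})$ for $x\in(a,1)$; $\omega(a,b;x)=(1-k)x^{-k}$ for $x\geqslant1$. For $x>0$ let $\tau(a,b;x)=x^{1-k}-\int_0^x\omega(a,b;t)\,dt$. Write $g_{(s')}:=|g|^{s'-1}\mathrm{sign}\,g$, and put $$\varphi(a,b;x)=\int_0^a(-x+t/2)\,\tau_{(s')}(a,b;t)\,dt+\int_0^x(x-t)\,\tau_{(s')}(a,b;t)\,dt,\quad x\in\mathbb{R}_+.$$ The system $\int_a^1\tau_{(s')}(a,b;t)\,dt=0$, $\int_0^1t\,\tau_{(s')}(a,b;t)\,dt=0$ has a unique solution $(a_{k,s},b_{k,s})\in M$; set $\varphi_{k,s}:=\varphi(a_{k,s},b_{k,s};\cdot)$. Marchaud derivative: for $k>0$, $k\notin\mathbb{N}$, $f:\mathbb{R}_+\to\mathbb{R}$, $x\in\mathbb{R}_+$, $D^k_-f(x)=\frac{1}{\varkappa(k,n)}\int_0^{+\infty}\frac{(\Delta^n_{-t}f)(x)}{t^{1+k}}\,dt$,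 where $n\in\mathbb{N}$, $n>k$ (the definition does not depend on $n$), $(\Delta^n_{-t}f)(x)=\sum_{m=0}^n(-1)^m\binom{n}{m}f(x+mt)$ and $\varkappa(k,n)=\Gamma(-k)\sum_{m=0}^n(-1)^m\binom{n}{m}m^k$. ''Sharp'' means that the constant on the right-hand side cannot be replaced by a smaller one. *)

(* Defs.v *)
From HB Require Import structures.
From mathcomp Require Import all_boot all_order all_algebra.
From mathcomp Require Import all_classical all_reals all_analysis.
Set Implicit Arguments.
Unset Strict Implicit.
Unset Printing Implicit Defensive.
Import Order.TTheory GRing.Theory Num.Theory.
Import numFieldNormedType.Exports.
Local Open Scope classical_set_scope.
Local Open Scope ring_scope.

(* A function on the half-line [0, +oo[ is represented by a total function
   R -> R; no definition below depends on its values on ]-oo, 0[. *)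

Notation Rplus R := `[(0 : R), +oo[%classic.

Section HalfLine.
Context {R : realType}.
Implicit Types (f g : R -> R) (a b c k q x t : R) (s : \bar R) (n : nat).

Notation mu := (@lebesgue_measure R).

Definition normRp s f : \bar R :=
  Lnorm mu s ((EFin \o f) \_ (Rplus R)).

Definition in_L s f : Prop :=
  measurable_fun (Rplus R) f /\ (normRp s f < +oo)%E.

Definition right_quot f x : R -> R := fun h => h^-1 * (f (x + h) - f x).

(* One-sided derivative at the endpoint 0; where the limit does not exist the
   value is unspecified. *)
Definition dRp f x : R :=
  if 0 < x then derive1 f x else lim (right_quot f x @ 0^'+).

Definition derivable_Rp f : Prop :=
  (forall x, 0 < x -> derivable f x 1) /\ cvg (right_quot f 0 @ 0^'+).

Definition abs_cont a b g : Prop :=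
  forall e : R, 0 < e -> exists2 d : R, 0 < d &
    forall I : seq (R * R),
      all (fun p => [&& a <= p.1, p.1 < p.2 & p.2 <= b]) I ->
      pairwise (fun p r => (p.2 <= r.1) || (r.2 <= p.1)) I ->
      \sum_(p <- I) (p.2 - p.1) < d ->
      \sum_(p <- I) `|g p.2 - g p.1| < e.

Definition loc_abs_cont_Rp g : Prop := forall c, 0 < c -> abs_cont 0 c g.

Definition L2_infty s f : Prop :=
  [/\ in_L +oo%E f, derivable_Rp f, loc_abs_cont_Rp (dRp f) &
      in_L s (dRp (dRp f))].

Definition euler_Gamma x : R :=
  \int[mu]_(t in `]0, +oo[) (t `^ (x - 1) * expR (- t)).

(* Gamma on the whole line (minus the poles 0, -1, -2, ...), through
   Gamma(x) = Gamma(x + N) / (x (x + 1) ... (x + N - 1)) with N so large that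
   x + N > 0. *)
Definition Gamma x : R :=
  let N := (Num.truncn (- x)).+1 in
  euler_Gamma (x + N%:R) / \prod_(i < N) (x + i%:R).

Definition fdiff n t f x : R :=
  \sum_(m < n.+1) (-1) ^+ m * 'C(n, m)%:R * f (x + m%:R * t).

Definition varkappa k n : R :=
  Gamma (- k) * \sum_(m < n.+1) (-1) ^+ m * 'C(n, m)%:R * m%:R `^ k.

(* Meant for k > 0 not an integer and any n > k. *)
Definition marchaud n k f x : R :=
  (varkappa k n)^-1 * \int[mu]_(t in `]0, +oo[) (fdiff n t f x / t `^ (1 + k)).

Definition in_M a b : Prop := [/\ 0 < a < 1, 0 < b < 1 & a <= b].

Definition omega k a b x : R :=
  if x <= 0 then 0
  else if x <= a then
    a^-1 * (1 - b)^-1 * (1 - b - (1 - b `^ (1 - k)) * (1 - a))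
  else if x < 1 then (1 - b)^-1 * (1 - b `^ (1 - k))
  else (1 - k) * x `^ (- k).

Definition tau k a b x : R :=
  x `^ (1 - k) - \int[mu]_(t in `[0, x]) omega k a b t.

(* y_(q) = |y|^(q - 1) sign y; in particular 0_(1) = 0. *)
Definition sgn_pow q y : R := `|y| `^ (q - 1) * Num.sg y.

Definition conj_exp s : R := fine (hoelder_conjugate s).

Definition inv_exp s : R := fine (s^-1)%E.

Definition tau_s s k a b t : R := sgn_pow (conj_exp s) (tau k a b t).

Definition phi s k a b x : R :=
  \int[mu]_(t in `[0, a]) ((- x + t / 2) * tau_s s k a b t) +
  \int[mu]_(t in `[0, x]) ((x - t) * tau_s s k a b t).

Definition is_ab s k a b : Prop :=
  [/\ in_M a b,
      \int[mu]_(t in `[a, 1]) tau_s s k a b t = 0 &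
      \int[mu]_(t in `[0, 1]) (t * tau_s s k a b t) = 0].

Definition Phi s k a b x : R :=
  (fine (normRp s (dRp (dRp (phi s k a b)))))^-1 * phi s k a b x.

End HalfLine.

(* Main.v *)
(** A function [f] in the class has the Taylor expansion
    [f (x + t) = f x + t f'(x) + \int_0^t (t - u) f''(x + u) du], and since the
    differences of order [n >= 2] kill polynomials of degree one, [D^k f (x)] is a
    constant (whose value is irrelevant) times
      [I = \int_0^oo (f (x + t) - f x - t f'(x)) / t^(1 + k) dt].
    Integrating by parts against the function [tau] of the statement, which differs
    from the kernel of [I] by a piecewise linear function with a single knot at [a],
      [k (k - 1) I = \int_0^1 f''(x + u) tau u du + w1 f x + (w2 - w1) f (x + a)
         - (w2 + k - 1) f (x + 1) + k (k - 1) \int_1^oo f (x + t) / t^(1 + k) dt]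
    where [w1 > 0 > w2] and [w2 + k - 1 < 0]. Holder's inequality bounds [I] by
    the two norms; for [phi] at [x = 0] all the estimates are equalities, because
    [phi'' = tau_s], [phi] equals its maximum at 0 and on [[1, +oo[], and its
    minimum, of opposite value, at [a]. Applying this bound to [f (x + h t)] and
    optimising in [h] gives the inequality. Since [D^k phi] is right-continuous at
    0, its essential supremum is at least its value there, which makes the
    constant the stated one, and the inequality sharp. *)
Require Import Defs.
From HB Require Import structures.
From mathcomp Require Import all_boot all_order all_algebra.
From mathcomp Require Import all_classical all_reals all_analysis.
From mathcomp Require Import measurable_realfun ess_sup_inf.
From mathcomp Require Import ring lra.
Set Implicit Arguments.
Unset Strict Implicit.
Unset Printing Implicit Defensive.
Import Order.TTheory GRing.Theory Num.Theory.
Import numFieldNormedType.Exports.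
Local Open Scope classical_set_scope.
Local Open Scope ring_scope.

(** Sharpness is possible because the coefficients of the values of [f] at [x], [x + a], [x + 1] and
    beyond have the signs +, -, +, +, which are the signs of [phi] at 0, at [a], at 1 and further
    on, where its modulus is maximal. The two equations of [is_ab] are what this pattern requires of
    a function with second derivative [tau_s]: they say that its derivative vanishes at 1 and that
    its values at 0 and 1 agree. The point [b] is the only sign change of [tau] on []0, 1[], and
    this decides the monotonicity of [phi]. The condition k < 2 - 1/s is exactly what makes |tau|^s'
    integrable near 0, where [tau] grows like x^(1 - k). Under a dilation by [h] the left side
    scales like h^k, the term in the second derivative like h^(2 - 1/s), and the term in the sup
    norm not at all; balancing the last two produces the exponent lambda. The obstacle before
    Taylor's formula is that absolute continuity is an epsilon-delta condition and [dRp] has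
    unspecified values where no derivative exists. The second derivative is therefore first
    identified almost everywhere with a density, through Jordan decomposition, Radon-Nikodym and
    Lebesgue differentiation. *)

Section IntegrableReal.
Context {d} {T : measurableType d} {R : realType}.
Variable mu : {measure set T -> \bar R}.
Variables (A : set T) (f g : T -> R).
Hypotheses (mA : measurable A).
Hypothesis (intf : mu.-integrable A (EFin \o f)).

Lemma integrable_EFinD : mu.-integrable A (EFin \o g) ->
  mu.-integrable A (EFin \o (fun x => f x + g x)).
Proof. by move=> intg; have := integrableD mA intf intg; apply: eq_integrable. Qed.

Lemma integrable_EFinB : mu.-integrable A (EFin \o g) ->
  mu.-integrable A (EFin \o (fun x => f x - g x)).
Proof. by move=> intg; have := integrableB mA intf intg; apply: eq_integrable. Qed.

Lemma integrable_EFinZl r : mu.-integrable A (EFin \o (fun x => r * f x)).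
Proof. by have := integrableZl mA r intf; apply: eq_integrable. Qed.

Lemma integrable_EFin_le : measurable_fun A g ->
  (forall x, A x -> `|g x| <= f x) -> mu.-integrable A (EFin \o g).
Proof.
move=> mg gf; apply: le_integrable intf => //; first exact/measurable_EFinP.
by move=> x Ax /=; rewrite lee_fin (le_trans (gf _ Ax))// ler_norm.
Qed.

Lemma integrable_EFin_ae : measurable_fun A g ->
  {ae mu, forall x, A x -> f x = g x} -> mu.-integrable A (EFin \o g).
Proof.
move=> /measurable_EFinP mg fg; case/integrableP : intf => mf foo.
apply/integrableP; split => //; apply: le_lt_trans foo.
rewrite le_eqVlt; apply/orP; left; apply/eqP.
apply: ae_eq_integral => //; try exact: measurableT_comp.
by apply: filterS fg => t /[apply] /= ->.
Qed.

Lemma ae_eq_Rintegral : measurable_fun A g ->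
  {ae mu, forall x, A x -> f x = g x} ->
  \int[mu]_(x in A) f x = \int[mu]_(x in A) g x.
Proof.
move=> /measurable_EFinP mg fg; case/integrableP : intf => mf _.
rewrite /Rintegral; congr fine; apply: ae_eq_integral => //.
by apply: filterS fg => t /[apply] /= ->.
Qed.

End IntegrableReal.

Lemma integrable_setU_disj {d} {T : measurableType d} {R : realType}
    (mu : {measure set T -> \bar R}) (A B : set T) (f : T -> \bar R) :
  measurable A -> measurable B -> [disjoint A & B] ->
  mu.-integrable A f -> mu.-integrable B f -> mu.-integrable (A `|` B) f.
Proof.
move=> mA mB AB /integrableP[mfA fA] /integrableP[mfB fB].
have mf : measurable_fun (A `|` B) f by apply/measurable_funU.
apply/integrableP; split => //.
by rewrite ge0_integral_setU//; [exact: lte_add_pinfty|exact: measurableT_comp].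
Qed.

(** * Absolute continuity and the fundamental theorem of calculus *)

Section AbsCont.
Context {R : realType}.
Implicit Types (F g : R -> R) (c : R).

(** The projection of the line onto [[0, c]]. Composing with it extends a function on [[0, c]] by
    constants, as needed for a cumulative function on the whole line. *)
Definition clamp c x : R := Num.max 0 (Num.min x c).

Lemma clamp_id c x : 0 <= x <= c -> clamp c x = x.
Proof. by move=> /andP[x0 xc]; rewrite /clamp min_l// max_r. Qed.

Lemma clamp_homo c : {homo clamp c : x y / x <= y}.
Proof.
move=> x y xy; rewrite /clamp ge_max le_max lexx/= le_max; apply/orP; right.
by rewrite le_min !ge_min xy lexx/= orbT.
Qed.

Lemma clamp_itv c x : 0 < c -> 0 <= clamp c x <= c.
Proof. by move=> c0; rewrite /clamp le_max lexx/= ge_max ge_min lexx orbT ltW. Qed.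

Lemma clamp_lip c x y : 0 < c -> x <= y -> clamp c y - clamp c x <= y - x.
Proof.
move=> c0 xy; rewrite /clamp /Num.max /Num.min.
by repeat case: ifPn; rewrite -?leNgt; lra.
Qed.

Lemma clamp_disj c I : 0 < c ->
  pairwise (fun p r : R * R => (p.2 <= r.1) || (r.2 <= p.1)) I ->
  pairwise (fun p r : R * R => (p.2 <= r.1) || (r.2 <= p.1))
    [seq p <- [seq (clamp c p.1, clamp c p.2) | p <- I] | p.1 < p.2].
Proof.
move=> c0 pI; apply: subseq_pairwise (filter_subseq _ _) _.
rewrite pairwise_map; apply: sub_pairwise pI => p r /= /orP[] h;
  by rewrite (clamp_homo c h) ?orbT.
Qed.

(** Clamping does not increase lengths, so the [d] of [F] still works. It may collapse an interval
    to a point; such an interval is not admissible in [abs_cont], but it contributes 0 and is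
    filtered out. *)
Lemma abs_cont_clamp c F : 0 < c -> abs_cont 0 c F -> forall e : R, 0 < e ->
  exists2 d : R, 0 < d & forall I : seq (R * R),
    all (fun p => p.1 <= p.2) I ->
    pairwise (fun p r => (p.2 <= r.1) || (r.2 <= p.1)) I ->
    \sum_(p <- I) (p.2 - p.1) < d ->
    \sum_(p <- I) `|F (clamp c p.2) - F (clamp c p.1)| < e.
Proof.
move=> c0 acF e e0; have [d d0 h] := acF e e0; exists d => // I Ile Idisj Id.
have -> : \sum_(p <- I) `|F (clamp c p.2) - F (clamp c p.1)| =
  \sum_(p <- [seq p <- [seq (clamp c p.1, clamp c p.2) | p <- I] | p.1 < p.2])
     `|F p.2 - F p.1|.
  rewrite big_filter big_map [LHS]big_seq [RHS]big_seq_cond [RHS]big_mkcond/=.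
  rewrite [LHS]big_mkcond/=; apply: eq_bigr => p _ /=.
  have [pI|//] := boolP (p \in I).
  have := clamp_homo c (allP Ile p pI).
  by rewrite le_eqVlt => /predU1P[->|->//]; rewrite subrr normr0 ltxx.
apply: h; first 1 last.
- exact: clamp_disj.
- rewrite big_filter big_map; apply: le_lt_trans Id.
  rewrite big_mkcond/= big_seq [leRHS]big_seq; apply: ler_sum => p /(allP Ile) pI.
  by case: ifPn => _ /=; [exact: clamp_lip|rewrite subr_ge0].
- apply/allP => p; rewrite mem_filter => /andP[p12] /mapP[q _ pE].
  by rewrite p12 pE/=; have /andP[-> _] := clamp_itv q.1 c0;
    have /andP[_ ->] := clamp_itv q.2 c0.
Qed.

Lemma disjoint_intervals_ltP (I J : set R) x y : is_interval I -> is_interval J ->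
  I `&` J = set0 -> I x -> J y -> x < y -> forall u v, I u -> J v -> u <= v.
Proof.
move=> iI iJ IJ Ix Jy xy u v Iu Jv; rewrite leNgt; apply/negP => vu.
have [vx|xv] := leP v x.
  have : (I `&` J) x by split => //; apply: (iJ v y) => //; rewrite vx ltW.
  by rewrite IJ.
have : (I `&` J) v by split => //; apply: (iI x u) => //; rewrite (ltW xv) ltW.
by rewrite IJ.
Qed.

End AbsCont.

Section AbsCont2.
Context {R : realType}.
Notation mu := (@lebesgue_measure R).
Implicit Types (F g : R -> R) (c : R).

(** Finite measure excludes unbounded intervals. Openness makes the left inequality strict, so that
    [I] lies in the half-open interval []inf I, sup I]], on which a Stieltjes measure is an
    increment. *)
Lemma open_interval_bounded (I : set R) : open I -> is_interval I ->
  I !=set0 -> (mu I < +oo)%E ->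
  [/\ has_inf I, has_sup I, forall u, I u -> inf I < u <= sup I &
      mu I = (sup I - inf I)%:E].
Proof.
move=> oI iI [u0 Iu0] muI.
have IE := (is_intervalP I).1 iI.
have hI : has_lbound I /\ has_ubound I.
  move: muI; rewrite {1}IE lebesgue_measure_itv /Rhull/=.
  have [lI|nlI] := asboolP (has_lbound I);
    have [uI|nuI] := asboolP (has_ubound I) => //=.
  - by rewrite ltry.
  - by rewrite ltNyr.
case: hI => lI uI.
have si : has_inf I by split => //; exists u0.
have ss : has_sup I by split => //; exists u0.
have lt u : I u -> inf I < u <= sup I.
  move=> Iu; rewrite (ub_le_sup uI Iu) andbT lt_neqAle (ge_inf lI Iu) andbT.
  apply/negP => /eqP infE.
  have /nbhs_ballP[e/= e0 eI] := open_nbhs_nbhs (conj oI Iu).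
  have /(ge_inf lI) : I (u - e / 2).
    by apply: eI; rewrite /ball/= opprB addrC subrK ger0_norm; lra.
  by rewrite infE; lra.
split=> //.
rewrite IE lebesgue_measure_itv /Rhull/= -IE (asboolT lI) (asboolT uI)/=.
by have /andP[/lt_le_trans h /h] := lt _ Iu0; rewrite lte_fin => ->.
Qed.

Lemma lebesgue_stieltjes_itvoc (G : cumulative R R) p q : p <= q ->
  lebesgue_stieltjes_measure G `]p, q]%classic = (G q - G p)%:E.
Proof.
move=> pq; rewrite /lebesgue_stieltjes_measure /measure_extension.
by rewrite measurable_mu_extE/= ?wlength_itv_bnd//; exact: is_ocitv.
Qed.

Section monotone.
Variables (c : R) (F : R -> R).
Hypotheses (c0 : 0 < c) (acF : abs_cont 0 c F).
Hypothesis ndF : {in `[0, c] &, {homo F : x y / x <= y}}.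

Let G x := F (clamp c x).

Let ndG : {homo G : x y / x <= y}.
Proof.
move=> x y xy; apply: ndF; rewrite ?in_itv/= ?clamp_itv//.
exact: clamp_homo.
Qed.

Let rcG : right_continuous G.
Proof.
move=> x; apply/cvgrPdist_lt => e e0.
have [d d0 h] := abs_cont_clamp c0 acF e0.
near=> t.
have xt : x <= t by near: t; exact: nbhs_right_ge.
have := h [:: (x, t)]; rewrite /= !big_cons !big_nil !addr0/= xt distrC; apply => //.
rewrite ltrBlDl; near: t; apply: nbhs_right_lt; rewrite ltrDl//.
Unshelve. all: by end_near. Qed.

Let Gc : cumulative R R := HB.pack G (isCumulative.Build R _ R G ndG rcG).

Notation nu := (lebesgue_stieltjes_measure Gc).

(** An open set is a countable disjoint union of open intervals. Any finite number of them form a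
    family to which the hypothesis applies, and the measure of each is at most the increment of [G]
    across it; the bound passes to the limit. *)
Let nu_open_le (e d : R) (U : set R) : 0 < e ->
  (forall I : seq (R * R),
    all (fun p => p.1 <= p.2) I ->
    pairwise (fun p r => (p.2 <= r.1) || (r.2 <= p.1)) I ->
    \sum_(p <- I) (p.2 - p.1) < d ->
    \sum_(p <- I) `|G p.2 - G p.1| < e) ->
  open U -> (mu U < d%:E)%E -> (nu U <= e%:E)%E.
Proof.
move=> e0 h oU muU.
pose I := open_disjoint_itv oU.
have oI i : open (I i) by exact: open_disjoint_itv_open.
have iI i : is_interval (I i) by exact: open_disjoint_itv_is_interval.
have tI : trivIset setT I by exact: open_disjoint_itv_trivIset.
have mI i : measurable (I i) by exact: open_measurable.
have UE : U = \bigcup_i I i by exact: open_disjoint_itv_bigcup.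
have muIU (n : nat) : (\sum_(0 <= i < n) mu (I i) <= mu U)%E.
  rewrite UE measure_semi_bigcup//; last exact: bigcupT_measurable.
  by apply: nneseries_lim_ge => *.
have muI i : (mu (I i) < +oo)%E.
  apply: le_lt_trans (lt_trans muU (ltry _)).
  by apply: le_measure; rewrite ?inE; [exact: mI|exact: open_measurable|rewrite UE => x Ix; exists i].
rewrite UE measure_semi_bigcup//; last exact: bigcupT_measurable.
apply: lime_le; first by apply: is_cvg_nneseries => *; exact: measure_ge0.
apply: nearW => n.
(* The enumeration may contain empty sets, whose [inf] and [sup] are only default values; they are
   dropped. *)
pose s := [seq (inf (I i), sup (I i)) | i <- iota 0 n & `[< I i !=set0 >]].
have sP : (\sum_(p <- s) `|G p.2 - G p.1| < e).
  apply: h.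
  - apply/allP => p /mapP[i]; rewrite mem_filter => /andP[/asboolP Ii _] ->/=.
    have [u Iu] := Ii; have [_ _ /(_ _ Iu)/andP[]] :=
      open_interval_bounded (oI i) (iI i) Ii (muI i).
    by move=> /ltW ui us _; exact: le_trans ui us.
  - rewrite pairwise_map; apply/(pairwiseP 0%N) => i j.
    set t := [seq _ <- iota 0 n | _] => it jt ij.
    rewrite !inE in it jt.
    have it' := mem_nth 0%N it; have jt' := mem_nth 0%N jt.
    have {ij} : nth 0%N t i != nth 0%N t j.
      rewrite nth_uniq//; first by rewrite ltn_eqF.
      by rewrite filter_uniq// iota_uniq.
    move: (nth 0%N t i) (nth 0%N t j) it' jt' => {it jt} {}i {}j.
    rewrite !mem_filter => /andP[/asboolP Ii _] /andP[/asboolP Ij _] ij /=.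
    have dij : I i `&` I j = set0 by move/trivIsetP : tI; apply.
    have [hi hs _ _] := open_interval_bounded (oI i) (iI i) Ii (muI i).
    have [hi' hs' _ _] := open_interval_bounded (oI j) (iI j) Ij (muI j).
    have [x Ix] := Ii; have [y Iy] := Ij.
    have [xy|yx|xy] := ltgtP x y.
    + have H := disjoint_intervals_ltP (iI i) (iI j) dij Ix Iy xy.
      apply/orP; left; apply: lb_le_inf; first by exists y.
      move=> v Iv; apply: ge_sup; first by exists x.
      by move=> u Iu; apply: H.
    + have dji : I j `&` I i = set0 by rewrite setIC.
      have H := disjoint_intervals_ltP (iI j) (iI i) dji Iy Ix yx.
      apply/orP; right; apply: lb_le_inf; first by exists x.
      move=> v Iv; apply: ge_sup; first by exists y.
      by move=> u Iu; apply: H.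
    + have : (I i `&` I j) x by split => //; rewrite xy.
      by rewrite dij.
  - rewrite -lte_fin; apply: le_lt_trans muU; apply: le_trans (muIU n).
    rewrite /s big_map big_filter -sumEFin /index_iota subn0 big_mkcond/=.
    apply: lee_sum => i _; case: asboolP => //= Ii.
    by have [_ _ _ ->] := open_interval_bounded (oI i) (iI i) Ii (muI i).
apply: (@le_trans _ _ (\sum_(p <- s) `|G p.2 - G p.1|)%:E); last first.
  by rewrite lee_fin ltW.
rewrite -sumEFin /s big_map big_filter /index_iota subn0 [leRHS]big_mkcond/=.
apply: lee_sum => i _; case: asboolP => [Ii|nI]/=; last first.
  have -> : I i = set0 by apply/eqP; apply/negPn/negP => /set0P.
  by rewrite measure0.
have [[[u Iu] _] _ lt _] := open_interval_bounded (oI i) (iI i) Ii (muI i).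
have isle : inf (I i) <= sup (I i).
  by have /andP[/ltW a b] := lt _ Iu; exact: le_trans b.
apply: (@le_trans _ _ (nu `]inf (I i), sup (I i)]%classic)).
  by apply: le_measure; rewrite ?inE; [exact: mI|exact: measurable_itv|move=> v /lt /=; rewrite in_itv].
by rewrite lebesgue_stieltjes_itvoc// lee_fin ler_norm.
Qed.

Let D : set (measurableTypeR R) := `]0, c]%classic.
Let mD : measurable D. Proof. exact: measurable_itv. Qed.
Let nuD : (nu D < +oo)%E.
Proof. by rewrite lebesgue_stieltjes_itvoc ?ltry// ltW. Qed.

(** By outer regularity a Lebesgue null set lies in an open set of measure below any [d > 0], and
    [nu_open_le] bounds the Stieltjes measure of that open set by an arbitrary [e]. *)
Let nuDmu : mfrestr mD nuD `<< mu.
Proof.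
apply/null_content_dominatesP => A mA muA0.
apply/eqP; rewrite -measure_le0; apply/lee_addgt0Pr => e e0; rewrite add0e.
have [d d0 h] := abs_cont_clamp c0 acF e0.
have [|U [oU AU UA]] := @lebesgue_regularity_outer R A d mA _ d0.
  by rewrite muA0.
have mU : measurable U by exact: open_measurable.
apply: (@le_trans _ _ (nu U)).
  rewrite /mfrestr /mrestr; apply: le_measure; rewrite ?inE.
  - exact: measurableI.
  - exact: open_measurable.
  - by move=> x [] /AU.
apply: nu_open_le h oU _ => //.
have -> : U = (U `\` A) `|` A by rewrite setUC setDUK.
have muUA : mu A = 0%E := muA0.
apply: le_lt_trans (measureU2 _ _ mA) _; first exact: measurableD.
by rewrite [X in (_ + X)%E]muUA adde0.
Qed.

(* The density is the Radon-Nikodym derivative of the Lebesgue-Stieltjes measure of [G]. *)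
Lemma monotone_abs_cont_density : exists w : R -> R,
  mu.-integrable setT (EFin \o w) /\
  forall x, 0 <= x <= c -> F x - F 0 = \int[mu]_(t in `[0, x]) w t.
Proof.
have [f [f0 ffin intf fE]] := @radon_nikodym_sigma_finite _ _ _ mu (mfrestr mD nuD) nuDmu.
have fineE : f = EFin \o (fine \o f) by apply/funext => x /=; rewrite fineK.
exists (fine \o f); split; first by rewrite -fineE.
move=> x /andP[x0 xc].
have intx : mu.-integrable `]0, x]%classic (EFin \o (fine \o f)).
  by rewrite -fineE; apply: integrableS intf.
rewrite -Rintegral_itv_obnd_cbnd// /Rintegral.
have -> : (\int[mu]_(t in `]0%R, x]) ((fine \o f) t)%:E = \int[mu]_(t in `]0%R, x]) f t)%E.
  by apply: eq_integral => t _; rewrite /= fineK.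
have nx : mfrestr mD nuD `]0, x]%classic = (F x - F 0)%:E.
  transitivity (nu `]0, x]%classic).
    congr (nu _); apply: setIidl => t /=; rewrite in_itv/= => /andP[t0 tx].
    by rewrite /D/= in_itv/= t0 (le_trans tx xc).
  by rewrite lebesgue_stieltjes_itvoc//= /G !clamp_id ?lexx ?x0 ?xc// ltW.
rewrite -[LHS]/(fine (F x - F 0)%:E) -nx fE//.
Qed.

End monotone.
End AbsCont2.

(** * Total variation of absolutely continuous functions *)

Section TotalVariation.
Context {R : realType}.
Implicit Types (g : R -> R) (c : R).

Let valid c (p : R * R) := [&& 0 <= p.1, p.1 < p.2 & p.2 <= c].
Let disj (p r : R * R) := (p.2 <= r.1) || (r.2 <= p.1).

(** Translates the partitions that define [variation] into the lists of disjoint intervals that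
    [abs_cont] speaks of. *)
Fixpoint pieces (a : R) (s : seq R) : seq (R * R) :=
  if s is x :: s' then (a, x) :: pieces x s' else [::].

Lemma pieces_itv a s : path <%R a s ->
  all (fun q : R * R => [&& a <= q.1, q.1 < q.2 & q.2 <= last a s]) (pieces a s).
Proof.
elim: s a => //= x s IH a /andP[ax xs]; rewrite lexx ax/=.
have xl : x <= last x s.
  have := lt_path_min xs; case: (s) => // y t /allP h.
  by rewrite ltW// h//= mem_last.
rewrite xl/=; apply: sub_all (IH _ xs) => q /and3P[xq -> ->].
by rewrite !andbT (le_trans (ltW ax)).
Qed.

Lemma pieces_disj a s : path <%R a s ->
  pairwise (fun p r : R * R => (p.2 <= r.1) || (r.2 <= p.1)) (pieces a s).
Proof.
elim: s a => //= x s IH a /andP[ax xs]; rewrite IH// andbT.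
by apply: sub_all (pieces_itv xs) => q /and3P[-> _ _].
Qed.

Lemma pieces_length a s : \sum_(q <- pieces a s) (q.2 - q.1) = last a s - a.
Proof.
elim: s a => [a|x s IH a] /=; first by rewrite big_nil subrr.
by rewrite big_cons IH/=; ring.
Qed.

Lemma pieces_variation a b g s : last a s == b ->
  \sum_(q <- pieces a s) `|g q.2 - g q.1| = variation a b g s.
Proof.
elim: s a => [a _|x s IH a]; first by rewrite big_nil variation_nil.
move=> /= xb; rewrite big_cons IH// /variation/= big_nat_recl//=.
Qed.

Section small.
Variables (c : R) (g : R -> R) (e d : R).
Hypothesis h : forall I : seq (R * R), all (valid c) I -> pairwise disj I ->
  \sum_(p <- I) (p.2 - p.1) < d -> \sum_(p <- I) `|g p.2 - g p.1| < e.

(** The suprema are taken one interval at a time: [J] holds the intervals already cut into pieces,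
    [I] those still to be cut. An induction step cuts the head of [I] by an arbitrary partition,
    moves the pieces to [J], and then takes the supremum over the partition. *)
Let small_ind (I J : seq (R * R)) : all (valid c) (J ++ I) ->
  pairwise disj (J ++ I) -> \sum_(p <- J ++ I) (p.2 - p.1) < d ->
  ((\sum_(p <- J) `|g p.2 - g p.1|)%:E +
   \sum_(p <- I) total_variation p.1 p.2 g <= e%:E)%E.
Proof.
elim: I J => [|p I IH] J.
  by rewrite cats0 big_nil adde0 lee_fin => *; apply/ltW/h.
move=> vJ dJ sJ.
have := vJ; rewrite all_cat/= => /and3P[aJ pv aI].
have /and3P[p0 p12 pc] := pv.
have [P1 [P2 [P3 [P4 P5]]]] : pairwise disj J /\ pairwise disj I /\
    all (disj p) I /\ all (disj ^~ p) J /\ allrel disj J I.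
  move: dJ; rewrite pairwise_cat/= allrel_consr => /and3P[/andP[-> ->]] ->.
  by move=> /andP[-> ->].
have key (l : seq R) : itv_partition p.1 p.2 l ->
    ((variation p.1 p.2 g l)%:E + ((\sum_(p <- J) `|g p.2 - g p.1|)%:E +
     \sum_(p <- I) total_variation p.1 p.2 g) <= e%:E)%E.
  move=> [pl /[dup] lastl /eqP ll].
  rewrite addeA -EFinD (addrC (variation _ _ _ _)) -(pieces_variation g lastl) -big_cat/=.
  have itvl := pieces_itv pl; rewrite ll in itvl.
  apply: IH; rewrite -catA.
  - rewrite !all_cat aJ aI andbT/=; apply: sub_all itvl => q /and3P[q1 q12 q2].
    by rewrite /valid (le_trans p0 q1) q12 (le_trans q2 pc).
  - rewrite !pairwise_cat allrel_catr P1 P2 P5 pieces_disj// !andbT/=.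
    apply/andP; split; apply/allrelP => q r.
      move=> /(allP P4)/orP[] qr /(allP itvl) /and3P[r1 _ r2]; apply/orP.
        by left; exact: le_trans r1.
      by right; exact: le_trans qr.
    move=> /(allP itvl) /and3P[r1 _ r2] /(allP P3) /orP[] qr; apply/orP.
      by left; exact: le_trans qr.
    by right; exact: le_trans r1.
  - move: sJ; rewrite !big_cat/= big_cons pieces_length ll.
    by rewrite addrA.
set T := (_%:E + \sum_(p <- I) _)%E in key.
have T0 : (0 <= T)%E.
  rewrite /T adde_ge0// ?lee_fin ?sumr_ge0//.
  rewrite big_seq; apply: sume_ge0 => q /(allP aI) /and3P[_ q12 _].
  exact/total_variation_ge0/ltW.
(* Finiteness of the remaining terms allows them to be subtracted from [e], which isolates the
   supremum; it follows from [key] for the trivial partition. *)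
have Tfin : T \is a fin_num.
  rewrite ge0_fin_numE//; apply: le_lt_trans (ltry e).
  apply: le_trans (key _ (itv_partition1 p12)).
  by rewrite leeDr// lee_fin variation_ge0.
rewrite big_cons addeCA -/T -leeBrDr// /total_variation.
apply: ge_ereal_sup => _ [_ [l pl <-] <-].
by rewrite leeBrDr//; exact: key.
Qed.

Lemma total_variation_sum_le (I : seq (R * R)) : all (valid c) I ->
  pairwise disj I -> \sum_(p <- I) (p.2 - p.1) < d ->
  (\sum_(p <- I) total_variation p.1 p.2 g <= e%:E)%E.
Proof.
by move=> aI dI sI; have := @small_ind I [::] aI dI sI; rewrite big_nil add0e.
Qed.

End small.

(** Take [d] for the tolerance 1: each step of length at most [d / 2] adds at most 1 to the
    variation, and finitely many steps reach [x]. *)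
Lemma abs_cont_bounded_variation c g : abs_cont 0 c g ->
  forall x, 0 <= x <= c -> total_variation 0 x g \is a fin_num.
Proof.
move=> /(_ 1 ltr01)[d d0 h] x /andP[x0 xc].
have [n] : exists n : nat, x <= n%:R * (d / 2).
  exists (Num.truncn (x / (d / 2))).+1.
  by rewrite -ler_pdivrMr ?divr_gt0// ltW// truncnS_gt.
elim: n x x0 xc => [|n IH] x x0 xc xn.
  have -> : x = 0 by apply/eqP; rewrite eq_le x0 andbT (le_trans xn)// mul0r.
  by rewrite total_variationxx.
have [xd|dx] := leP x (n%:R * (d / 2)); first exact: IH.
have nd0 : 0 <= n%:R * (d / 2) by rewrite mulr_ge0// ltW// divr_gt0.
rewrite (total_variationD g nd0 (ltW dx)) fin_numD IH ?lexx//=; last first.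
  by rewrite (le_trans (ltW dx)).
rewrite ge0_fin_numE ?total_variation_ge0 1?ltW//.
have := total_variation_sum_le h (I := [:: (n%:R * (d / 2), x)]).
rewrite /= !big_cons !big_nil adde0 addr0 /valid/= nd0 dx xc => /(_ isT isT) H.
apply: le_lt_trans (H _) (ltry _).
by move: xn; rewrite -natr1 mulrDl mul1r; lra.
Qed.

Lemma abs_cont_total_variation c g : abs_cont 0 c g ->
  abs_cont 0 c (fun x => fine (total_variation 0 x g)).
Proof.
move=> acg e e0; have e20 : 0 < e / 2 by rewrite divr_gt0.
have [d d0 h] := acg _ e20; exists d => // I aI dI sI.
have fin x : 0 <= x <= c -> total_variation 0 x g \is a fin_num.
  exact: abs_cont_bounded_variation.
(* The suprema only give a large inequality, hence the choice of [e / 2] to recover a strict one. *)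
rewrite (@le_lt_trans _ _ (e / 2))//; last by lra.
rewrite -lee_fin; apply: le_trans (total_variation_sum_le h aI dI sI).
rewrite -sumEFin big_seq [leRHS]big_seq; apply: lee_sum => p /(allP aI).
case/and3P => p0 p12 pc.
have f1 : total_variation 0 p.1 g \is a fin_num.
  by apply: fin; rewrite p0 (le_trans (ltW p12)).
have f2 : total_variation 0 p.2 g \is a fin_num.
  by apply: fin; rewrite pc (le_trans p0 (ltW p12)).
have := total_variationD g p0 (ltW p12).
move: f2 => /[swap] ->; rewrite fin_numD => /andP[_ f3].
rewrite fineD// addrAC subrr add0r ger0_norm ?fineK//.
by rewrite fine_ge0// total_variation_ge0// ltW.
Qed.

Lemma abs_contB c f g : abs_cont 0 c f -> abs_cont 0 c g ->
  abs_cont 0 c (fun x => f x - g x).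
Proof.
move=> acf acg e e0; have e20 : 0 < e / 2 by rewrite divr_gt0.
have [d d0 h] := acf _ e20; have [d' d'0 h'] := acg _ e20.
exists (Num.min d d'); first by rewrite lt_min d0.
move=> I aI dI; rewrite lt_min => /andP[/(h _ aI dI) hI /(h' _ aI dI) hI'].
rewrite (@le_lt_trans _ _ (\sum_(p <- I) (`|f p.2 - f p.1| + `|g p.2 - g p.1|)))//.
  apply: ler_sum => p _.
  rewrite (_ : _ - _ - _ = (f p.2 - f p.1) - (g p.2 - g p.1)); last by ring.
  exact: ler_normB.
by rewrite big_split/=; lra.
Qed.

Lemma total_variationB_nondecreasing c g : abs_cont 0 c g ->
  {in `[0, c] &, {homo (fun x => fine (total_variation 0 x g) - g x) : x y / x <= y}}.
Proof.
move=> acg x y; rewrite !in_itv/= => /andP[x0 xc] /andP[y0 yc] xy.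
have fin z : 0 <= z <= c -> total_variation 0 z g \is a fin_num.
  exact: abs_cont_bounded_variation.
have fx := fin _ (introT andP (conj x0 xc)).
have := fin _ (introT andP (conj y0 yc)).
have -> := total_variationD g x0 xy; rewrite fin_numD => /andP[_ f3].
have : g y - g x <= fine (total_variation x y g).
  rewrite -lee_fin fineK//; apply: le_trans (total_variation_ge g xy).
  by rewrite lee_fin ler_norm.
by rewrite fineD//; lra.
Qed.

Lemma total_variation_nondecreasing_fine c g : abs_cont 0 c g ->
  {in `[0, c] &, {homo (fun x => fine (total_variation 0 x g)) : x y / x <= y}}.
Proof.
move=> acg x y; rewrite !in_itv/= => /andP[x0 xc] /andP[y0 yc] xy.
rewrite fine_le// ?(abs_cont_bounded_variation acg)// ?x0 ?y0//.
by apply: (@total_variation_nondecreasing _ 0 c); rewrite ?in_itv/= ?x0 ?y0.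
Qed.
End TotalVariation.

(** * The fundamental theorem of calculus for absolutely continuous functions *)

Section FTC_AC.
Context {R : realType}.
Notation mu := (@lebesgue_measure R).
Implicit Types (f g w : R -> R) (c : R).

(** Jordan decomposition: [g] is its variation function minus a nondecreasing function, both
    absolutely continuous, and each has a Radon-Nikodym density. *)
Lemma abs_cont_density c g : 0 < c -> abs_cont 0 c g -> exists w : R -> R,
  mu.-integrable setT (EFin \o w) /\
  forall x, 0 <= x <= c -> g x - g 0 = \int[mu]_(t in `[0, x]) w t.
Proof.
move=> c0 acg.
have [w1 [iw1 w1E]] := monotone_abs_cont_density c0
  (abs_cont_total_variation acg) (total_variation_nondecreasing_fine acg).
have [w2 [iw2 w2E]] := monotone_abs_cont_density c0
  (abs_contB (abs_cont_total_variation acg) acg)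
  (total_variationB_nondecreasing acg).
exists (fun x => w1 x - w2 x); split; first exact: integrable_EFinB.
move=> x x0c; rewrite RintegralB//; [|exact: integrableS iw1..|exact: integrableS iw2].
by rewrite -w1E// -w2E//; ring.
Qed.

(** Almost every point is a Lebesgue point of the density, and there the primitive is differentiable
    with the value of the density as derivative. *)
Lemma abs_cont_ae_derive c g : 0 < c -> abs_cont 0 c g -> exists w : R -> R,
  [/\ mu.-integrable setT (EFin \o w),
   forall x, 0 <= x <= c -> g x - g 0 = \int[mu]_(t in `[0, x]) w t &
   {ae mu, forall x, 0 < x < c -> derive1 g x = w x}].
Proof.
move=> c0 acg; have [w [iw wE]] := abs_cont_density c0 acg.
exists w; split => //.
have locw : locally_integrable setT w.
  by have := integrable_locally measurableT iw; rewrite patch_setT.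
move: (lebesgue_differentiation locw).
apply: filterS; first exact: (ae_filter_ringOfSetsType mu).
move=> x wx /andP[x0 xc].
have iwc : mu.-integrable [set` Interval (BLeft 0) (BRight c)] (EFin \o w).
  exact: integrableS iw.
have /= [dF <-] := @FTC1_lebesgue_pt _ _ (BLeft 0) _ _ xc iwc x0 wx.
rewrite !derive1E.
have -> : 'D_1 (fun y : R => \int[mu]_(t in `[0, y]) w t) x = 'D_1 (fun y : R => g y - g 0) x.
  apply: near_eq_derive; near=> y; rewrite wE//; apply/andP; split.
    by apply: ltW; near: y; exact: lt_nbhsr.
  by apply: ltW; near: y; exact: lt_nbhsl.
have E : (fun h : R => h^-1 *: ((g \o shift x) (h *: 1) - g x)) =
  (fun h => h^-1 *: (((fun y : R => g y - g 0) \o shift x) (h *: 1) - (g x - g 0))).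
  by apply/funext => h /=; rewrite opprB addrA subrK.
by rewrite /derive E.
Unshelve. all: by end_near. Qed.

(** The unspecified values of [dRp g] occur only on a null set, where they do not affect the
    integral. Measurability is nevertheless assumed of [dRp g] itself, which makes it
    interchangeable with the density. *)
Lemma loc_abs_cont_FTC g : loc_abs_cont_Rp g -> measurable_fun (Rplus R) (dRp g) ->
  forall x, 0 <= x ->
    mu.-integrable `[0, x] (EFin \o dRp g) /\
    g x - g 0 = \int[mu]_(t in `[0, x]) dRp g t.
Proof.
move=> acg mg x x0.
(* The larger interval makes every point of []0, x]] an interior one. *)
have x10 : 0 < x + 1 by rewrite ltr_wpDl.
have [w [iw wE aew]] := abs_cont_ae_derive x10 (acg _ x10).
have aew' : {ae mu, forall t, `[0, x]%classic t -> w t = dRp g t}.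
  have n0 : {ae mu, forall t : R, t != 0}.
    exists [set 0]; split => //; first exact: lebesgue_measure_set1.
    by move=> t /= /negP; rewrite negbK => /eqP.
  move: aew n0; apply: filterS2; first exact: (ae_filter_ringOfSetsType mu).
  move=> t tw t0 /=; rewrite in_itv/= => /andP[t0' tx].
  have t00 : 0 < t by rewrite lt_neqAle eq_sym t0.
  by rewrite /dRp t00 tw// t00 (le_lt_trans tx)// ltrDl.
have mg' : measurable_fun `[0, x] (dRp g).
  apply: measurable_funS mg => // t /=; rewrite !in_itv/= andbT.
  by case/andP.
have iw' : mu.-integrable `[0, x] (EFin \o w) by exact: integrableS iw.
split; first exact: integrable_EFin_ae iw' mg' aew'.
by rewrite wE ?x0 ?lerDl ?ler01// (ae_eq_Rintegral _ iw' mg' aew').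
Qed.

End FTC_AC.

(** * Primitives and Taylor's formula *)

Section Primitive.
Context {R : realType}.
Notation mu := (@lebesgue_measure R).
Variable w : R -> R.
Hypothesis iw : forall c, 0 <= c -> mu.-integrable `[0, c] (EFin \o w).

Definition prim1 x : R := \int[mu]_(t in `[0, x]) w t.
(** Cauchy's formula for the repeated integral: the second primitive of [w], vanishing at 0 together
    with its derivative. *)
Definition prim2 x : R := \int[mu]_(t in `[0, x]) ((x - t) * w t).

Lemma integrable_itvoc x y : 0 <= x -> mu.-integrable `]x, y] (EFin \o w).
Proof.
move=> x0; have [yx|xy] := leP y x.
  by rewrite set_itv_ge ?bnd_simp -?leNgt//; exact: integrable_set0.
have y0 : 0 <= y by rewrite (le_trans x0) ?ltW.
apply: integrableS (iw y0) => // t /=; rewrite !in_itv/= => /andP[xt ->].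
by rewrite andbT (le_trans x0) ?ltW.
Qed.

Lemma integrable_mul_itv (A : set R) x y (v : R -> R) : measurable A ->
  A `<=` `[x, y] -> mu.-integrable A (EFin \o w) -> continuous v ->
  mu.-integrable A (EFin \o (fun t => v t * w t)).
Proof.
move=> mA Axy iA cv.
have mw : measurable_fun A w by case/integrableP : iA => /measurable_EFinP.
have mv : measurable_fun A v.
  exact: measurable_funS (continuous_measurable_fun cv).
have [M Mv] : exists M, forall t, A t -> `|v t| <= M.
  have : compact (v @` `[x, y]).
    apply: continuous_compact; last exact: segment_compact.
    exact: continuous_subspaceT.
  move=> /compact_bounded[M [_ Mv]]; exists (M + 1) => t At.
  by apply: (Mv (M + 1)); [rewrite ltrDl|exists t => //; exact: Axy].
apply: (@integrable_EFin_le _ _ _ mu A (fun t => M * `|w t|)) => //.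
- apply: integrable_EFinZl => //; exact: integrable_norm.
- exact: measurable_funM.
- by move=> t At; rewrite normrM ler_wpM2r// Mv.
Qed.

Lemma prim1B x y : 0 <= x <= y ->
  prim1 y - prim1 x = \int[mu]_(t in `]x, y]) w t.
Proof.
move=> /andP[x0 xy]; rewrite /prim1 Rintegral_itvB ?bnd_simp//.
exact/iw/(le_trans x0).
Qed.

Let ilin c x : 0 <= c -> mu.-integrable `[0, c] (EFin \o (fun t => (x - t) * w t)).
Proof.
move=> c0; apply: (@integrable_mul_itv _ 0 c (fun t => x - t)) => //; first exact: iw.
move=> t; apply: cvgB; [exact: cvg_cst|exact: cvg_id].
Qed.

Lemma prim2_right x y : 0 <= x <= y ->
  prim2 y - prim2 x - (y - x) * prim1 x =
  \int[mu]_(t in `]x, y]) ((y - t) * w t).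
Proof.
move=> /andP[x0 xy]; have y0 := le_trans x0 xy.
rewrite -(@Rintegral_itvB _ _ (BLeft 0) (BRight y) x)//; last exact: ilin.
rewrite -addrA -opprD; congr (_ - _).
rewrite /prim2 /prim1 -RintegralZl//; last exact: iw.
rewrite -RintegralD//; [|exact: ilin|exact/integrable_EFinZl/iw].
by apply: eq_Rintegral => t _; ring.
Qed.

Lemma prim2_left x y : 0 <= x <= y ->
  prim2 x - prim2 y + (y - x) * prim1 y =
  - \int[mu]_(t in `]x, y]) ((x - t) * w t).
Proof.
move=> /andP[x0 xy]; have y0 := le_trans x0 xy.
rewrite -(@Rintegral_itvB _ _ (BLeft 0) (BRight y) x)//; last exact: ilin.
rewrite opprB -addrA; congr (_ + _).
rewrite /prim2 /prim1 -RintegralZl//; last exact: iw.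
rewrite -[RHS]mulN1r -RintegralZl//; last exact: ilin.
rewrite addrC -RintegralB//; [|exact/integrable_EFinZl/iw|exact: ilin].
by apply: eq_Rintegral => t _; ring.
Qed.

Lemma integral_normr_small c e : 0 <= c -> 0 < e ->
  exists2 d : R, 0 < d & forall A : set R, measurable A -> A `<=` `[0, c] ->
    (mu A < d%:E)%E -> \int[mu]_(t in A) `|w t| < e.
Proof.
move=> c0 e0.
have iwc : mu.-integrable setT (EFin \o (w \_ `[0, c])).
  by have := iw c0; rewrite integrable_mkcond//= restrict_EFin.
have [d [d0 h]] := integral_normr_continuous iwc e0.
exists d => // A mA A0c Ad; apply: le_lt_trans (h A mA Ad).
rewrite le_eqVlt; apply/predU1P; left; apply: eq_Rintegral => t /set_mem At.
by rewrite patchE mem_set//; exact: A0c.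
Qed.

Lemma integral_normr_itv_small c e : 0 <= c -> 0 < e ->
  exists2 d : R, 0 < d & forall x y, 0 <= x -> x <= y -> y <= c -> y - x < d ->
    \int[mu]_(t in `]x, y]) `|w t| < e.
Proof.
move=> c0 e0; have [d d0 h] := integral_normr_small c0 e0.
exists d => // x y x0 xy yc yxd; apply: h => //.
  move=> t /=; rewrite !in_itv/= => /andP[xt ty].
  by rewrite (le_trans x0 (ltW xt)) (le_trans ty).
rewrite lebesgue_measure_itv/=; case: ifPn => _; last by rewrite lte_fin.
by rewrite -EFinD lte_fin.
Qed.

(** Between [x] and [y] the factor [y - t] is at most [y - x] in modulus. As the integral of [|w|]
    over a short interval is small, [prim2] is differentiable at every point and not merely almost
    everywhere. *)
Lemma prim2_bound x y (e : R) : 0 <= x -> 0 <= y ->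
  \int[mu]_(t in `]Num.min x y, Num.max x y]) `|w t| <= e ->
  `|prim2 y - prim2 x - (y - x) * prim1 x| <= `|y - x| * e.
Proof.
move=> x0 y0.
have [xy|yx] := leP x y => he.
  rewrite prim2_right ?x0//.
  have iv := integrable_itvoc y x0.
  have iv' : mu.-integrable `]x, y] (EFin \o (fun t => (y - t) * w t)).
    apply: (@integrable_mul_itv _ x y (fun t => y - t)) => //.
      exact: subset_itv_oc_cc.
    by move=> t; apply: cvgB; [exact: cvg_cst|exact: cvg_id].
  apply: le_trans (le_normr_Rintegral _ iv') _ => //.
  apply: (@le_trans _ _ (`|y - x| * \int[mu]_(t in `]x, y]) `|w t|)); last first.
    by rewrite ler_wpM2l.
  rewrite -RintegralZl//; last exact: integrable_norm.
  apply: le_Rintegral => //; first exact: integrable_norm.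
    by apply: integrable_EFinZl => //; exact: integrable_norm.
  move=> t /=; rewrite in_itv/= => /andP[xt ty].
  have yt' : `|y - t| = y - t by rewrite ger0_norm// subr_ge0.
  have yx' : `|y - x| = y - x by rewrite ger0_norm// subr_ge0.
  by rewrite normrM ler_wpM2r// yt' yx' lerD2l lerN2 ltW.
have -> : prim2 y - prim2 x - (y - x) * prim1 x =
  prim2 y - prim2 x + (x - y) * prim1 x by ring.
rewrite prim2_left; last by rewrite y0 ltW.
rewrite normrN.
have iv := integrable_itvoc x y0.
have iv' : mu.-integrable `]y, x] (EFin \o (fun t => (y - t) * w t)).
  apply: (@integrable_mul_itv _ y x (fun t => y - t)) => //.
    exact: subset_itv_oc_cc.
  by move=> t; apply: cvgB; [exact: cvg_cst|exact: cvg_id].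
apply: le_trans (le_normr_Rintegral _ iv') _ => //.
apply: (@le_trans _ _ (`|y - x| * \int[mu]_(t in `]y, x]) `|w t|)); last first.
  by rewrite ler_wpM2l.
rewrite -RintegralZl//; last exact: integrable_norm.
apply: le_Rintegral => //; first exact: integrable_norm.
  by apply: integrable_EFinZl => //; exact: integrable_norm.
move=> t /=; rewrite in_itv/= => /andP[yt tx].
have yt' : `|y - t| = t - y by rewrite distrC ger0_norm// subr_ge0 ltW.
have yx' : `|y - x| = x - y by rewrite distrC ger0_norm// subr_ge0 ltW.
by rewrite normrM ler_wpM2r// yt' yx' lerD2r.
Qed.

Lemma prim2_quot_near x e : 0 <= x -> 0 < e ->
  exists2 d : R, 0 < d & forall h, h != 0 -> 0 <= x + h -> `|h| < d ->
    `|prim1 x - h^-1 * (prim2 (x + h) - prim2 x)| <= e.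
Proof.
move=> x0 e0; have x10 : 0 <= x + 1 by rewrite addr_ge0.
have [d d0 H] := integral_normr_itv_small x10 e0.
exists (Num.min d 1); first by rewrite lt_min d0 ltr01.
move=> h hn0 xh0; rewrite lt_min => /andP[hd h1].
have : `|prim2 (x + h) - prim2 x - ((x + h) - x) * prim1 x| <= `|(x + h) - x| * e.
  apply: prim2_bound => //; apply/ltW/H.
  - by rewrite le_min x0.
  - by rewrite ge_min le_max lexx.
  - move: h1; rewrite ltr_norml => /andP[_ h1].
    by rewrite ge_max lerDl ler01/= lerD2l ltW.
  - by case: (leP x (x + h)) => _; apply: le_lt_trans hd;
      rewrite ler_normr; apply/orP; [left|right]; rewrite le_eqVlt; apply/predU1P; left; ring.
have -> : x + h - x = h by ring.
move=> hb.
have h'0 : 0 < `|h| by rewrite normr_gt0.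
rewrite -(ler_pM2l h'0) -normrM mulrBr mulrA mulfV// mul1r -normrN.
by rewrite opprB.
Qed.

Lemma derivable_prim2 x : 0 < x -> derivable prim2 x 1 /\ derive1 prim2 x = prim1 x.
Proof.
move=> x0.
have cv : h^-1 *: (prim2 (h + x) - prim2 x) @[h --> 0^'] --> prim1 x.
  apply/cvgrPdist_le => e e0.
  have [d d0 H] := prim2_quot_near (ltW x0) e0.
  near=> h; rewrite (addrC h x); apply: H.
  - by near: h; exact: nbhs_dnbhs_neq.
  - suff : `|h| <= x by rewrite ler_norml => /andP[hx _]; rewrite -lerBlDl sub0r.
    by near: h; apply: dnbhs0_le.
  - by near: h; apply: dnbhs0_lt.
split; last by apply/cvg_lim.
apply/cvg_ex; exists (prim1 x); move: cv; apply: cvg_trans; apply: near_eq_cvg.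
near=> h => /=; have -> : h%:A = h :> R := mulr1 h.
by [].
Unshelve. all: by end_near. Qed.

Lemma right_quot_prim2 x : 0 <= x -> right_quot prim2 x @ 0^'+ --> prim1 x.
Proof.
move=> x0; apply/cvgrPdist_le => e e0.
have [d d0 H] := prim2_quot_near x0 e0.
near=> h; have h0 : 0 < h by near: h; exact: nbhs_right_gt.
apply: H; first exact: lt0r_neq0.
  by rewrite addr_ge0// ltW.
by rewrite gtr0_norm//; near: h; exact: nbhs_right_lt.
Unshelve. all: by end_near. Qed.

End Primitive.

Section Taylor.
Context {R : realType}.
Notation mu := (@lebesgue_measure R).

Section PrimAC.
Variable w : R -> R.
Hypothesis iw : forall c, 0 <= c -> mu.-integrable `[0, c] (EFin \o w).

(** The union of the intervals of the list. With it the sum of the increments of [prim1] is bounded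
    by one integral over a set of small measure, and absolute continuity of the integral applies. *)
Let cover (I : seq (R * R)) : set R :=
  foldr (fun p A => `]p.1, p.2]%classic `|` A) set0 I.

Let coverP (I : seq (R * R)) t : cover I t -> exists2 p, p \in I & p.1 < t <= p.2.
Proof.
elim: I => //= p I IH [/=|/IH[q qI tq]].
  by rewrite in_itv/= => tp; exists p => //; rewrite mem_head.
by exists q => //; rewrite inE qI orbT.
Qed.

Let mcover (I : seq (R * R)) : measurable (cover I).
Proof. by elim: I => [|p I IH] /=; [exact: measurable0|exact: measurableU]. Qed.

Let cover_integral c (I : seq (R * R)) : 0 <= c ->
  all (fun p => [&& 0 <= p.1, p.1 < p.2 & p.2 <= c]) I ->
  pairwise (fun p r => (p.2 <= r.1) || (r.2 <= p.1)) I ->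
  [/\ cover I `<=` `[0, c], (mu (cover I) <= (\sum_(p <- I) (p.2 - p.1))%:E)%E &
      \sum_(p <- I) `|prim1 w p.2 - prim1 w p.1| <= \int[mu]_(t in cover I) `|w t|].
Proof.
move=> c0; elim: I => [_ _|p I IH /= /andP[/and3P[p0 p12 pc] aI] /andP[pI dI]].
  by rewrite /= !big_nil measure0 Rintegral_set0; split.
have [Ic muI intI] := IH aI dI.
have pc' : `]p.1, p.2] `<=` `[0, c].
  move=> t /=; rewrite !in_itv/= => /andP[pt tp].
  by rewrite (le_trans p0 (ltW pt)) (le_trans tp).
have pIc : `]p.1, p.2]%classic `|` cover I `<=` `[0, c].
  by rewrite subUset.
split => //.
- rewrite big_cons EFinD; apply: le_trans (measureU2 _ _ _) _ => //.
    exact: mcover.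
  apply: leeD => //.
  have mp : mu `]p.1, p.2]%classic = (p.2 - p.1)%:E.
    by rewrite lebesgue_measure_itv/= lte_fin p12 -EFinD.
  by rewrite [leLHS]mp.
- have dpI : [disjoint `]p.1, p.2]%classic & cover I].
    apply/disj_setPS => t [/= + /coverP[q qI /andP[q1 q2]]].
    rewrite in_itv/= => /andP[pt tp].
    have /orP[pq|qp] := allP pI q qI.
      by have := le_lt_trans pq q1; rewrite ltNge tp.
    by have := le_lt_trans qp pt; rewrite ltNge q2.
  have iU : mu.-integrable (`]p.1, p.2]%classic `|` cover I) (EFin \o w).
    apply: integrableS (iw c0) => //; apply: measurableU => //; exact: mcover.
  rewrite big_cons Rintegral_setU//; [|exact: mcover|exact: integrable_norm].
  apply: lerD => //; rewrite prim1B//; last by rewrite p0 ltW.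
  apply: le_normr_Rintegral => //.
  by apply: integrable_itvoc.
Qed.

Lemma loc_abs_cont_prim1 (g : R -> R) (p : R) :
  (forall x, 0 <= x -> g x = p + prim1 w x) -> loc_abs_cont_Rp g.
Proof.
move=> gE c c0 e e0; have [d d0 h] := integral_normr_small iw (ltW c0) e0.
exists d => // I aI dI sI.
have [Ic muI intI] := cover_integral (ltW c0) aI dI.
apply: (@le_lt_trans _ _ (\int[mu]_(t in cover I) `|w t|)).
  apply: le_trans intI; rewrite big_seq [leRHS]big_seq; apply: ler_sum => q qI.
  have /and3P[q0 q12 _] := allP aI q qI.
  by rewrite !gE ?(le_trans q0 (ltW q12))// opprD addrACA subrr add0r.
apply: (h _ (mcover I) Ic); apply: le_lt_trans muI _.
by rewrite lte_fin.
Qed.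

End PrimAC.

Section L2Taylor.
Variable f : R -> R.
Hypotheses (df : derivable_Rp f) (acf : loc_abs_cont_Rp (dRp f)).
Hypothesis mf : measurable_fun (Rplus R) (dRp (dRp f)).

Let w := dRp (dRp f).

Lemma integrable_dRp2 c : 0 <= c -> mu.-integrable `[0, c] (EFin \o w).
Proof. by move=> c0; have [] := loc_abs_cont_FTC acf mf c0. Qed.

Lemma dRp_prim1 y : 0 <= y -> dRp f y = dRp f 0 + prim1 w y.
Proof.
by move=> y0; have [_] := loc_abs_cont_FTC acf mf y0; rewrite /prim1 => <-; rewrite addrC subrK.
Qed.

Lemma derivable_Rp_right_continuous (g : R -> R) : cvg (right_quot g 0 @ 0^'+) ->
  g @ 0^'+ --> g 0.
Proof.
move=> /cvg_ex[/= l cvl].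
have : (fun h => g 0 + h * right_quot g 0 h) @ 0^'+ --> g 0 + 0 * l.
  apply: cvgD; first exact: cvg_cst.
  apply: cvgM => //; apply: cvg_at_right_filter; exact: cvg_id.
rewrite mul0r addr0; apply: cvg_trans; apply: near_eq_cvg.
near=> h; have h0 : 0 < h by near: h; exact: nbhs_right_gt.
by rewrite /right_quot add0r mulrA mulfV ?gt_eqF// mul1r addrC subrK.
Unshelve. all: by end_near. Qed.

Lemma taylor_dRp y : 0 <= y -> f y = f 0 + y * dRp f 0 + prim2 w y.
Proof.
rewrite le_eqVlt => /predU1P[<-|y0].
  rewrite mul0r addr0 /prim2 set_itv1 Rintegral_set1 addr0//.
have [df0 df1] := df.
(* The derivative of [f] equals [dRp f 0 + prim1 w] everywhere, so [D] has zero derivative on []0,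
   +oo[]; being right-continuous at 0, it is constant. *)
pose D t := f t - t * dRp f 0 - prim2 w t.
have dD (t : R) : 0 < t -> is_derive t (1 : R) D 0.
  move=> t0.
  have [dG DG] := derivable_prim2 integrable_dRp2 t0.
  rewrite derive1E in DG.
  have iG : is_derive t 1 (prim2 w) (prim1 w t) by apply: DeriveDef.
  have iF : is_derive t 1 f (dRp f 0 + prim1 w t).
    apply: DeriveDef; first exact: df0.
    by rewrite -derive1E -dRp_prim1 ?ltW// /dRp t0.
  rewrite /D; apply: is_derive_eq.
  rewrite scaler0 add0r -[_ *: _]/(_ * _); ring.
have D0 : D 0 = f 0.
  by rewrite /D mul0r subr0 /prim2 set_itv1 Rintegral_set1 subr0.
have : {within `[0, y], continuous D}.
  apply/continuous_within_itvP => //; split.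
  - move=> t; rewrite in_itv/= => /andP[t0 _].
    apply: differentiable_continuous; apply/derivable1_diffP.
    by have [] := dD t t0.
  - rewrite D0 (_ : f 0 = f 0 - 0 * dRp f 0 - prim2 w 0); last first.
      by rewrite -[LHS]D0.
    apply: cvgB; last first.
      apply: derivable_Rp_right_continuous; apply/cvg_ex; exists (prim1 w 0).
      exact: right_quot_prim2 integrable_dRp2 _ (lexx _).
    apply: cvgB; first exact: derivable_Rp_right_continuous.
    by apply: cvgM; [apply: cvg_at_right_filter; exact: cvg_id|exact: cvg_cst].
  - apply: cvg_at_left_filter; apply: differentiable_continuous.
    by apply/derivable1_diffP; have [] := dD y y0.
move=> cD; have [t|c _] := MVT y0 _ cD (df := cst 0).
  by rewrite in_itv/= => /andP[t0 _]; exact: dD.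
by rewrite mul0r => /eqP; rewrite subr_eq0 D0 /D => /eqP <-; ring.
Qed.

End L2Taylor.
End Taylor.

(** * Affine changes of variable *)

Section Affine.
Context {R : realType}.
Notation mu := (@lebesgue_measure R).
Variables (x h : R).
Hypothesis h0 : 0 < h.

Let aff (t : measurableTypeR R) : measurableTypeR R := x + h * t.

Let maff : measurable_fun setT aff.
Proof.
by apply: measurable_funD => //; exact: measurable_funM.
Qed.

(** Uniqueness of Lebesgue measure: the scaled image measure gives half-open intervals their
    length. *)
Lemma lebesgue_measure_affine (A : set R) : measurable A ->
  mu A = (h%:E * mu ((fun t : R => (x + h * t)%R) @^-1` A))%E.
Proof.
move=> mA; pose hn : {nonneg R} := NngNum (ltW h0).
pose m1 : {measure set (measurableTypeR R) -> \bar R} :=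
  mscale hn (pushforward mu aff).
have -> : (h%:E * mu ((fun t : R => (x + h * t)%R) @^-1` A))%E = m1 maff A by [].
apply: lebesgue_measure_unique => // _ [[p q] /= _ <-].
rewrite /m1/= /mscale/= /pushforward/=.
have -> : aff @^-1` `]p, q]%classic = `](p - x) / h, (q - x) / h]%classic.
  apply/seteqP; split => t /=; rewrite /aff !in_itv/= ltr_pdivrMr// ler_pdivlMr//;
    by rewrite ltrBlDl lerBrDl (mulrC t).
rewrite !lebesgue_measure_itv/= !lte_fin ltr_pdivrMr// divfK ?gt_eqF// ltrD2r.
case: ifPn => pq; last by rewrite mule0.
rewrite -EFinD -EFinM; congr EFin; field; exact: lt0r_neq0.
Qed.

Lemma ge0_integral_affine (D : set R) (f : R -> \bar R) : measurable D ->
  measurable_fun D f -> (forall t, D t -> (0 <= f t)%E) ->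
  (\int[mu]_(t in D) f t =
   h%:E * \int[mu]_(t in (fun t : R => (x + h * t)%R) @^-1` D) f (x + h * t)%R)%E.
Proof.
move=> mD mf f0; pose hn : {nonneg R} := NngNum (ltW h0).
pose m0 : {measure set (measurableTypeR R) -> \bar R} := pushforward mu aff.
transitivity (\int[mscale hn (m0 maff)]_(t in D) f t)%E.
  by apply: eq_measure_integral => A mA _; exact: lebesgue_measure_affine.
rewrite ge0_integral_mscale//; congr (_ * _)%E.
by rewrite ge0_integral_pushforward// => y /set_mem; exact: f0.
Qed.

Lemma measurable_affine_preimage (D : set R) : measurable D ->
  measurable ((fun t : R => (x + h * t)%R) @^-1` D).
Proof. by move=> mD; rewrite -[X in measurable X]setTI; exact: maff. Qed.

Lemma measurable_fun_affine d' (T' : measurableType d') (D : set R) (f : R -> T') :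
  measurable D -> measurable_fun D f ->
  measurable_fun ((fun t : R => (x + h * t)%R) @^-1` D) (fun t => f (x + h * t)).
Proof.
move=> mD mf _ B mB.
have -> : ((fun t : R => (x + h * t)%R) @^-1` D) `&` ((fun t => f (x + h * t)) @^-1` B) =
  (fun t : R => (x + h * t)%R) @^-1` (D `&` f @^-1` B) by [].
by apply: measurable_affine_preimage; exact: mf.
Qed.

Lemma integrable_affine (D : set R) (f : R -> R) : measurable D ->
  mu.-integrable D (EFin \o f) ->
  mu.-integrable ((fun t : R => (x + h * t)%R) @^-1` D) (EFin \o (fun t => f (x + h * t))).
Proof.
move=> mD /integrableP[mf foo]; apply/integrableP; split.
  exact: measurable_fun_affine mD mf.
have mabs : measurable_fun D (fun t => `|(f t)%:E|%E) by exact: measurableT_comp.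
have := ge0_integral_affine mD mabs (fun t _ => abse_ge0 _) => fE.
rewrite ltey; apply/negP => /eqP X.
by move: foo; rewrite /= fE X gt0_muley ?lte_fin// ltxx.
Qed.

Lemma Rintegral_affine (D : set R) (f : R -> R) : measurable D ->
  mu.-integrable D (EFin \o f) ->
  \int[mu]_(t in D) f t =
  h * \int[mu]_(t in (fun t : R => (x + h * t)%R) @^-1` D) f (x + h * t).
Proof.
move=> mD intf; have intf' := integrable_affine mD intf.
have mD' := measurable_affine_preimage mD.
have ifin : (\int[mu]_(t in (fun t : R => (x + h * t)%R) @^-1` D)
  (EFin \o (fun t : R => f (x + h * t)%R)) t)%E \is a fin_num.
  exact: integrable_fin_num.
rewrite /Rintegral -[RHS]/(fine h%:E * _) -fineM//.
congr fine; rewrite integralE [X in (_ * X)%E]integralE.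
have mf : measurable_fun D (EFin \o f) by case/integrableP : intf.
rewrite (ge0_integral_affine mD (measurable_funepos mf))//.
rewrite (ge0_integral_affine mD (measurable_funeneg mf))//.
rewrite [RHS]muleBr//; last exact: integrable_add_def intf'.
congr (_ * _ - _ * _)%E; apply: eq_integral => t _.
  by rewrite !funeposE.
by rewrite !funenegE.
Qed.

End Affine.

Section AffineItv.
Context {R : realType}.
Variables (x h : R).
Hypothesis h0 : 0 < h.

Lemma affine_preimage_itvcc t : (fun t : R => (x + h * t)%R) @^-1` `[x, x + h * t]%classic = `[0, t]%classic.
Proof.
apply/seteqP; split => u /=; rewrite !in_itv/= lerDl lerD2l ler_pM2l//.
  by rewrite pmulr_rge0.
by rewrite pmulr_rge0.
Qed.

Lemma affine_preimage_itvcy : (fun t : R => (x + h * t)%R) @^-1` `[x, +oo[%classic = `[0, +oo[%classic.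
Proof.
by apply/seteqP; split => u /=; rewrite !in_itv/= !andbT lerDl pmulr_rge0.
Qed.

Lemma affine_preimage_itvoy : (fun t : R => (x + h * t)%R) @^-1` `]x, +oo[%classic = `]0, +oo[%classic.
Proof.
by apply/seteqP; split => u /=; rewrite !in_itv/= !andbT ltrDl pmulr_rgt0.
Qed.

Lemma affine_preimage_itvoc c d :
  (fun t : R => (x + h * t)%R) @^-1` `]x + h * c, x + h * d]%classic = `]c, d]%classic.
Proof.
by apply/seteqP; split => t /=; rewrite !in_itv/= ltrD2l lerD2l ltr_pM2l// ler_pM2l.
Qed.

End AffineItv.

(** * Holder's inequality on the half-line *)

Section ConjugateExponent.
Context {R : realType}.
Variable s : \bar R.
Hypothesis s1 : (1 < s)%E.

Lemma inv_exp_itv : 0 <= inv_exp s < 1.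
Proof.
move: s1; rewrite /inv_exp; case: s => [r||]//=; last by rewrite ?invey/= lexx ltr01.
rewrite lte_fin => r1; have r0 : 0 < r by rewrite (lt_trans ltr01).
by rewrite inver gt_eqF//= invr_ge0 ltW//= invf_lt1.
Qed.

(** A form common to finite and infinite [s]: for [s = +oo] one has [inv_exp s = 0] and conjugate
    exponent 1. It spares later computations with exponents a case distinction. *)
Lemma conj_expE : conj_exp s = (1 - inv_exp s)^-1.
Proof.
move: s1; rewrite /conj_exp /inv_exp /hoelder_conjugate; case: s => [r||]//=.
  rewrite lte_fin => r1; have r0 : 0 < r by rewrite (lt_trans ltr01).
  have r10 : r - 1 != 0 by rewrite subr_eq0 gt_eqF.
  rewrite eqe (gt_eqF r0) -EFinB !inver (gt_eqF r0) (negbTE r10)/=.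
  by field; rewrite r10 gt_eqF.
by move=> _; rewrite ?eqxx/= ?invey/= subr0 invr1.
Qed.

Lemma conj_exp_ge1 : 1 <= conj_exp s.
Proof.
have /andP[i0 i1] := inv_exp_itv; rewrite conj_expE -[leLHS]invr1 lef_pV2 ?posrE//.
  by rewrite gerBl.
by rewrite subr_gt0.
Qed.

Lemma conj_exp_gt0 : 0 < conj_exp s.
Proof. exact: lt_le_trans conj_exp_ge1. Qed.

End ConjugateExponent.

Section Hoelder.
Context {R : realType}.
Notation mu := (@lebesgue_measure R).
Variables (s : \bar R) (w : R -> R).
Hypotheses (s1 : (1 < s)%E) (mw : measurable_fun (Rplus R) w).
Hypothesis Nw : (normRp s w < +oo)%E.

Let q := conj_exp s.
Let sg := inv_exp s.
Let N := fine (normRp s w).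

Lemma normRp_ge0 p f : (0 <= normRp p f :> \bar R)%E.
Proof. exact: Lnorm_ge0. Qed.

Lemma fine_normRp : normRp s w = N%:E.
Proof. by rewrite /N fineK// ge0_fin_numE// normRp_ge0. Qed.

Lemma normRpoo_ae f : {ae mu, forall t : R, 0 <= t -> (`|f t|%:E <= normRp +oo f)%E}.
Proof.
have muT : (0 < mu [set: R])%E.
  by rewrite -set_itvNyy lebesgue_measure_itv/= ?ltNyy ?ltry.
have := ess_sup_ge mu (abse \o (EFin \o f) \_ (Rplus R)).
apply: filterS => t + t0; rewrite /normRp unlock muT; apply: le_trans.
by rewrite /= patchE mem_set//= in_itv/= t0.
Qed.

Section onset.
Variables (D : set R) (v : R -> R).
Hypotheses (mD : measurable D) (D0 : D `<=` Rplus R).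
Hypotheses (mv : measurable_fun D v).
Hypothesis iv : mu.-integrable D (EFin \o (fun t => `|v t| `^ q)).

Let mwD : measurable_fun D w. Proof. exact: measurable_funS mw. Qed.

Let intvq : (\int[mu]_(t in D) (`|v t| `^ q)%:E =
  (\int[mu]_(t in D) `|v t| `^ q)%:E)%E.
Proof. by rewrite /Rintegral fineK//; apply: integrable_fin_num iv. Qed.

Let integral_le_fin r : s = r%:E -> (\int[mu]_(t in D) `|(w t * v t)%:E| <=
  (N * (\int[mu]_(t in D) `|v t| `^ q) `^ (1 - sg))%:E)%E.
Proof.
move=> sr; have r1 : 1 < r by rewrite -lte_fin -sr.
have r0 : 0 < r by rewrite (lt_trans ltr01).
have q0 : 0 < q := conj_exp_gt0 s1.
have sgE : sg = r^-1 by rewrite /sg /inv_exp sr inver gt_eqF.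
have qE : q^-1 = 1 - sg by rewrite /q conj_expE// invrK.
have mf : measurable_fun setT (w \_ (Rplus R)).
  by apply/(measurable_restrictT _ _).1.
have mg : measurable_fun setT (v \_ D) by apply/(measurable_restrictT _ _).1.
have pq1 : r^-1 + q^-1 = 1 by rewrite qE sgE addrC subrK.
have := hoelder mu mf mg r0 q0 pq1.
have -> : Lnorm mu r%:E (EFin \o w \_ (Rplus R)) = N%:E.
  by rewrite -fine_normRp /normRp sr restrict_EFin.
have -> : Lnorm mu q%:E (EFin \o v \_ D) =
    ((\int[mu]_(t in D) `|v t| `^ q) `^ (1 - sg))%:E.
  rewrite unlock qE -poweR_EFin -intvq [in RHS]integral_mkcond; congr (_ `^ _)%E.
  apply: eq_integral => t _; rewrite /= !patchE; case: ifPn => // _.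
  by rewrite /point/= normr0 powR0// gt_eqF.
rewrite Lnorm1 -EFinM; apply: le_trans.
rewrite le_eqVlt; apply/predU1P; left; rewrite [LHS]integral_mkcond.
apply: eq_integral => t _; rewrite /= !patchE; case: ifPn => [tD|_].
  by rewrite mem_set//; apply: D0; exact/set_mem.
by rewrite /point/= mulr0 normr0.
Qed.

(** At this endpoint the conjugate exponent is 1, and Holder's inequality is the almost everywhere
    bound of [|w|] by its norm, integrated against [|v|]. *)
Let integral_le_oo : s = +oo%E -> (\int[mu]_(t in D) `|(w t * v t)%:E| <=
  (N * (\int[mu]_(t in D) `|v t| `^ q) `^ (1 - sg))%:E)%E.
Proof.
move=> soo; have sg0 : sg = 0 by rewrite /sg /inv_exp soo invey.
have q1 : q = 1 by rewrite /q conj_expE// -/sg sg0 subr0 invr1.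
have N0 : 0 <= N by rewrite fine_ge0// normRp_ge0.
rewrite sg0 subr0 powRr1; last by apply: Rintegral_ge0 => t _; exact: powR_ge0.
rewrite EFinM -intvq -ge0_integralZl//; last by case/integrableP : iv.
apply: ae_ge0_le_integral => //.
- by apply: measurableT_comp => //; exact/measurable_EFinP/measurable_funM.
- by move=> t _; rewrite -EFinM lee_fin mulr_ge0// powR_ge0.
- by apply: measurable_funeM; case/integrableP : iv.
have := normRpoo_ae w; apply: filterS.
  exact: (ae_filter_ringOfSetsType mu).
move=> t + Dt; have := D0 Dt; rewrite /= in_itv/= andbT => t0 /(_ t0).
rewrite -soo fine_normRp lee_fin => wN.
by rewrite -EFinM lee_fin normrM q1 powRr1// ler_wpM2r.
Qed.

Let integral_le : (\int[mu]_(t in D) `|(w t * v t)%:E| <=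
  (N * (\int[mu]_(t in D) `|v t| `^ q) `^ (1 - sg))%:E)%E.
Proof.
case: (s) (s1) (@integral_le_fin) (@integral_le_oo) => [r _ + _|_ _|//]; exact.
Qed.

Lemma hoelder_integrable : mu.-integrable D (EFin \o (fun t => w t * v t)).
Proof.
apply/integrableP; split; first exact/measurable_EFinP/measurable_funM.
exact: le_lt_trans integral_le (ltry _).
Qed.

Lemma hoelder_le :
  `|\int[mu]_(t in D) (w t * v t)| <= N * (\int[mu]_(t in D) `|v t| `^ q) `^ (1 - sg).
Proof.
have i := hoelder_integrable; apply: le_trans (le_normr_Rintegral _ i) _ => //.
rewrite -lee_fin; apply: le_trans integral_le; rewrite /Rintegral fineK//.
by apply: integrable_fin_num (integrable_norm i).
Qed.

End onset.

End Hoelder.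

(** * Integrals of powers *)

Section PowerIntegrals.
Context {R : realType}.
Notation mu := (@lebesgue_measure R).

Lemma continuous_at_within (f : R -> R) (A : set R) :
  (forall x, A x -> {for x, continuous f}) -> {within A, continuous f}.
Proof.
by move=> cf; apply: continuous_in_subspaceT => x /set_mem; exact: cf.
Qed.

Lemma is_derive_continuous (f : R -> R) (x df : R) :
  is_derive x 1 f df -> {for x, continuous f}.
Proof.
by case=> d _; apply: differentiable_continuous; exact/derivable1_diffP.
Qed.

Lemma Rintegral_derive (F f : R -> R) (a b : R) : a <= b ->
  (forall x : R, a <= x <= b -> is_derive x 1 F (f x)) ->
  (forall x, a <= x <= b -> {for x, continuous f}) ->
  mu.-integrable `[a, b] (EFin \o f) /\
  \int[mu]_(t in `[a, b]) f t = F b - F a.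
Proof.
move=> ab dF cf.
have wf : {within `[a, b], continuous f}.
  by apply: continuous_at_within => x /=; rewrite in_itv/=; exact: cf.
split; first by apply: continuous_compact_integrable => //; exact: segment_compact.
move: ab; rewrite le_eqVlt => /predU1P[<-|ab].
  by rewrite set_itv1 Rintegral_set1 subrr.
have cF x : a <= x <= b -> {for x, continuous F}.
  by move=> /dF; exact: is_derive_continuous.
rewrite /Rintegral (continuous_FTC2 ab wf (F := F))//.
- split.
  + move=> x; rewrite in_itv/= => /andP[ax xb]; have : a <= x <= b by rewrite !ltW.
    by move=> /dF[].
  + by apply: cvg_at_right_filter; apply: cF; rewrite lexx ltW.
  + by apply: cvg_at_left_filter; apply: cF; rewrite lexx ltW.
- move=> x; rewrite in_itv/= => /andP[ax xb]; have : a <= x <= b by rewrite !ltW.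
  by move=> /dF[_ <-]; rewrite derive1E.
Qed.

Lemma is_derive_powR (r x : R) : 0 < x ->
  is_derive x 1 (fun y => y `^ r) (r * x `^ (r - 1)).
Proof.
move=> x0; have x0' : x \in `]0, +oo[ by rewrite in_itv/= x0.
by apply: DeriveDef; [exact: derivable_powR|rewrite -derive1E powR_derive1].
Qed.

Lemma is_derive_cstM (c x df : R) (f : R -> R) :
  is_derive x 1 f df -> is_derive x 1 (fun y => c * f y) (c * df).
Proof. exact: is_deriveZ. Qed.

Lemma continuous_powR (r x : R) : 0 < x -> {for x, continuous (fun y : R => y `^ r)}.
Proof. by move=> /(is_derive_powR r); exact: is_derive_continuous. Qed.

Lemma measurable_powR_on (D : set R) r : measurable_fun D (fun t : R => t `^ r).
Proof. exact: measurable_funS (measurable_powR r). Qed.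

Lemma Rintegral_powR (r a b : R) : r + 1 != 0 -> 0 < a -> a <= b ->
  mu.-integrable `[a, b] (EFin \o (fun t => t `^ r)) /\
  \int[mu]_(t in `[a, b]) t `^ r = (b `^ (r + 1) - a `^ (r + 1)) / (r + 1).
Proof.
move=> r1 a0 ab.
have pos x : a <= x <= b -> 0 < x by move=> /andP[ax _]; exact: lt_le_trans ax.
have [|x /pos|i ->] := @Rintegral_derive (fun t => (r + 1)^-1 * t `^ (r + 1))
  (fun t => t `^ r) a b ab.
- move=> x /pos x0; have d := is_derive_powR (r + 1) x0.
  have := is_derive_cstM (r + 1)^-1 d.
  by rewrite addrK mulrA mulVf// mul1r.
- exact: continuous_powR.
- by split => //; rewrite -mulrBr mulrC.
Qed.

Lemma integrable_powR01 (r : R) : -1 < r ->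
  mu.-integrable `]0, 1] (EFin \o (fun t => t `^ r)).
Proof.
move=> r1; have r10 : 0 < r + 1 by rewrite -ltrBlDr sub0r.
apply/integrableP; split; first by apply/measurable_EFinP; apply: measurable_powR_on.
(* Exhaustion by intervals away from the singularity, on which the integrals stay below
   [(r + 1)^-1]; monotone convergence does the rest. *)
pose F n : set (measurableTypeR R) := `[n.+1%:R^-1, 1]%classic.
have n10 n : 0 < n.+1%:R^-1 :> R by rewrite invr_gt0.
have n11 n : n.+1%:R^-1 <= 1 :> R by rewrite invf_le1// ler1n.
have FE : `]0, 1]%classic = \bigcup_n F n.
  apply/seteqP; split => x /=.
    rewrite in_itv/= => /andP[x0 x1]; exists (Num.truncn x^-1) => //=.
    rewrite /F/= in_itv/= x1 andbT -[leRHS]invrK lef_pV2 ?posrE ?invr_gt0//.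
    exact/ltW/truncnS_gt.
  by move=> [n _]; rewrite /F/= !in_itv/= => /andP[nx ->]; rewrite (lt_le_trans _ nx).
under eq_integral => t _ do rewrite gee0_abs ?lee_fin ?powR_ge0//.
rewrite FE.
have ndF : nondecreasing_seq F.
  move=> m n mn; rewrite subsetEset => x; rewrite /F/= !in_itv/= => /andP[nx ->].
  by rewrite andbT (le_trans _ nx)// lef_pV2 ?posrE// ler_nat.
have mF n : measurable (F n) by exact: measurable_itv.
have mf n : measurable_fun (F n) (EFin \o (fun t : R => t `^ r)).
  by apply/measurable_EFinP; apply: measurable_powR_on.
have f0 n x : F n x -> (0 <= (EFin \o (fun t : R => (t `^ r)%R)) x)%E.
  by rewrite lee_fin powR_ge0.
have := @ge0_nondecreasing_set_cvg_integral _ (measurableTypeR R) _ F _ mu ndF mF mf f0.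
move=> /cvg_lim <- //; apply: (@le_lt_trans _ _ (r + 1)^-1%:E); last exact: ltry.
apply: lime_le.
  apply: ereal_nondecreasing_is_cvgn.
  exact: (@ge0_nondecreasing_set_nondecreasing_integral _ (measurableTypeR R) _ F _ mu ndF mF mf f0).
apply: nearW => n.
have [i iE] := Rintegral_powR (lt0r_neq0 r10) (n10 n) (n11 n).
rewrite -[leLHS]fineK; last exact: integrable_fin_num.
rewrite lee_fin -[leLHS]/(\int[mu]_(t in F n) t `^ r) iE powR1.
by rewrite -[leRHS]mul1r ler_wpM2r ?invr_ge0 ?ltW// gerBl powR_ge0.
Qed.

Lemma powR_cvgy0 (r : R) : r < 0 -> t `^ r @[t --> +oo] --> (0 : R).
Proof.
move=> r0; apply/cvgrPdist_le => e e0.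
near=> t; rewrite sub0r normrN ger0_norm ?powR_ge0//.
have t0 : 0 < t by near: t; exact: nbhs_pinfty_gt.
have te : e `^ r^-1 <= t by near: t; apply: nbhs_pinfty_ge; exact: num_real.
have ee : (e `^ r^-1) `^ r = e.
  by rewrite -powRrM mulVf ?lt_eqF// powRr1// ltW.
rewrite -[leRHS]ee -[r]opprK !(powRN _ (- r)) lef_pV2 ?posrE ?powR_gt0//.
by apply: ge0_ler_powR => //; rewrite ?nnegrE ?powR_ge0 ?oppr_ge0 ?ltW.
Unshelve. all: by end_near. Qed.

Lemma Rintegral_powRy (r : R) : r < -1 ->
  mu.-integrable `[1, +oo[ (EFin \o (fun t => t `^ r)) /\
  \int[mu]_(t in `[1, +oo[) t `^ r = - (r + 1)^-1.
Proof.
move=> r1; have r10 : r + 1 < 0 by rewrite -ltrBrDr sub0r.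
have E : (\int[mu]_(t in `[1%R, +oo[) (t `^ r)%:E = 0%:E - ((r + 1)^-1 * 1 `^ (r + 1))%:E)%E.
  have d (x : R) : 1 <= x -> is_derive x 1 (fun t => (r + 1)^-1 * t `^ (r + 1)) (x `^ r).
    move=> x1; have x0 : 0 < x by exact: lt_le_trans x1.
    have d := is_derive_powR (r + 1) x0.
    have := is_derive_cstM (r + 1)^-1 d.
    by rewrite addrK mulrA mulVf ?lt_eqF// mul1r.
  apply: (@ge0_continuous_FTC2y _ _ (fun t => (r + 1)^-1 * t `^ (r + 1))).
  - by move=> x _; exact: powR_ge0.
  - apply: continuous_at_within => x /=; rewrite in_itv/= andbT => x1.
    by apply: continuous_powR; exact: lt_le_trans x1.
  - rewrite -[X in _ --> X](mulr0 (r + 1)^-1); apply: cvgM; first exact: cvg_cst.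
    exact: powR_cvgy0.
  - by move=> x /ltW/d[].
  - by apply: cvg_at_right_filter; exact: is_derive_continuous (d 1 (lexx _)).
  - move=> x; rewrite in_itv/= andbT => /ltW/d[_ <-].
    by rewrite derive1E.
split.
  apply/integrableP; split; first by apply/measurable_EFinP; apply: measurable_powR_on.
  under eq_integral => t _ do rewrite gee0_abs ?lee_fin ?powR_ge0//.
  by rewrite E -EFinB ltry.
by rewrite /Rintegral E -EFinB/= powR1 mulr1 sub0r.
Qed.

End PowerIntegrals.

(** * The integral of the Taylor remainder *)

Section Kernel.
Context {R : realType}.
Notation mu := (@lebesgue_measure R).
Variable k : R.
Hypothesis k1 : 1 < k.

Let k0 : 0 < k. Proof. exact: lt_trans k1. Qed.

(** The integral of (t - u) / t^(1 + k) over [[u, 1]]: the weight that [w u] receives when the order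
    of integration is exchanged. *)
Definition kern u : R := (k * (k - 1))^-1 * (u `^ (1 - k) - k + (k - 1) * u).

Lemma powR_ker (t : R) : 0 < t -> (t `^ (1 + k))^-1 = t `^ (- (1 + k)).
Proof. by move=> t0; rewrite powRN. Qed.

Lemma mul_powR_ker (t : R) : 0 < t -> t * (t `^ (1 + k))^-1 = t `^ (- k).
Proof.
move=> t0; rewrite powR_ker// -{1}(powRr1 (ltW t0)) -powRD; last by rewrite (gt_eqF t0) implybT.
by congr (_ `^ _); ring.
Qed.

Lemma kernE (u : R) : 0 < u <= 1 ->
  mu.-integrable `[u, 1] (EFin \o (fun t => (t - u) / t `^ (1 + k))) /\
  \int[mu]_(t in `[u, 1]) ((t - u) / t `^ (1 + k)) = kern u.
Proof.
move=> /andP[u0 u1].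
have nk1 : - k + 1 != 0 by rewrite lt_eqF// addrC subr_lt0.
have nk : - (1 + k) + 1 != 0 by rewrite opprD addrAC addNr add0r oppr_eq0 gt_eqF.
have [i1 E1] := Rintegral_powR nk1 u0 u1.
have [i2 E2] := Rintegral_powR nk u0 u1.
have E t : `[u, 1]%classic t -> t `^ (- k) - u * t `^ (- (1 + k)) = (t - u) / t `^ (1 + k).
  rewrite /= in_itv/= => /andP[ut _]; have t0 := lt_le_trans u0 ut.
  by rewrite mulrBl mul_powR_ker// powR_ker.
have i2' : mu.-integrable `[u, 1] (EFin \o (fun t => u * t `^ (- (1 + k)))).
  exact: integrable_EFinZl.
have i3 : mu.-integrable `[u, 1] (EFin \o (fun t => t `^ (- k) - u * t `^ (- (1 + k)))).
  exact: integrable_EFinB.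
split.
  by apply: eq_integrable i3 => // t /set_mem/E/= ->.
rewrite -(@eq_Rintegral _ _ _ mu _ (fun t => (t - u) / t `^ (1 + k))
  (fun t => t `^ (- k) - u * t `^ (- (1 + k)))); last first.
  by move=> t /set_mem/E.
rewrite RintegralB// RintegralZl// E1 E2 !powR1 /kern.
have -> : - (1 + k) + 1 = - k by ring.
have -> : - k + 1 = 1 - k by ring.
have uE : u * u `^ (- k) = u `^ (1 - k).
  by rewrite -{1}(powRr1 (ltW u0)) -powRD// (gt_eqF u0) implybT.
have k10 : k - 1 != 0 by rewrite subr_eq0 gt_eqF.
have k00 : k != 0 by rewrite gt_eqF.
have k10' : 1 - k != 0 by rewrite subr_eq0 eq_sym -subr_eq0.
rewrite mulrA mulrBr uE mulr1; field.
by rewrite k10 k00 k10'.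
Qed.

Section FubiniKernel.
Variable w : R -> R.
Hypothesis mw : measurable_fun (Rplus R) w.
Hypothesis iw : forall c, 0 <= c -> mu.-integrable `[0, c] (EFin \o w).
Hypothesis iwk : mu.-integrable `]0, 1] (EFin \o (fun u => w u * kern u)).

Let w0 := w \_ (Rplus R).

Let mw0 : measurable_fun setT w0.
Proof. by apply/(measurable_restrictT _ _).1. Qed.

(** The integrand on the triangle 0 < u <= t <= 1, with z = (t, u). The extension [w0] of [w] by
    zero makes it measurable on the whole plane. *)
Let F (z : measurableTypeR R * measurableTypeR R) : R := if [&& 0 < z.2, z.2 <= z.1 & z.1 <= 1]
  then (z.1 - z.2) * w0 z.2 / z.1 `^ (1 + k) else 0.

Let mF : measurable_fun setT F.
Proof.
apply: measurable_fun_ifT => //.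
  apply: measurable_and; last apply: measurable_and.
  - by apply: measurable_fun_ltr.
  - by apply: measurable_fun_ler.
  - by apply: measurable_fun_ler.
apply: measurable_funM; first apply: measurable_funM.
- by apply: measurable_funB.
- by apply: measurableT_comp.
- have -> : (fun z : measurableTypeR R * measurableTypeR R => (z.1 `^ (1 + k))^-1) =
     (fun z => ((z.1 : R) `^ (- (1 + k)))).
    by apply/funext => z; rewrite powRN.
  exact: measurableT_comp (measurable_powR _) _.
Qed.

Let f z := (F z)%:E.

Let mf : measurable_fun setT f. Proof. exact/measurable_EFinP. Qed.

Let F_u (u : R) : 0 < u <= 1 ->
  (fun t => F (t, u)) = (fun t => w u * ((t - u) / t `^ (1 + k))) \_ `[u, 1].
Proof.
move=> /andP[u0 u1]; apply/funext => t; rewrite /F/= patchE u0/=.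
have -> : (t \in `[u, 1]%classic) = (u <= t) && (t <= 1).
  by apply/idP/idP; rewrite inE/= in_itv.
case: ifPn => // _; rewrite /w0 patchE mem_set/= ?in_itv/= ?andbT ?ltW//.
by ring.
Qed.

Let int_t (u : R) : (\int[mu]_t f (t, u) = ((fun u => (w u * kern u)%:E) \_ `]0%R, 1%R]) u)%E.
Proof.
rewrite patchE; case: ifPn => [|].
  rewrite inE/= in_itv/= => u01; have [i E] := kernE u01.
  rewrite -E -RintegralZl// /Rintegral fineK//; last first.
    by apply: integrable_fin_num => //; exact: integrable_EFinZl.
  rewrite [RHS]integral_mkcond; apply: eq_integral => t _.
  by rewrite /f -[F (t, u)]/((fun t => F (t, u)) t) F_u// restrict_EFin.
rewrite notin_setE/= in_itv/= => /negP nu.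
apply: integral0_eq => t _; rewrite /f /F/=; case: ifPn => // /and3P[u0 ut t1].
by move: nu; rewrite u0 (le_trans ut).
Qed.

Lemma kern_ge0 (u : R) : 0 < u <= 1 -> 0 <= kern u.
Proof.
move=> /[dup] /andP[u0 u1] u01; have [_ <-] := kernE u01.
apply: Rintegral_ge0 => t /=; rewrite in_itv/= => /andP[ut _].
by rewrite mulr_ge0 ?subr_ge0// invr_ge0 powR_ge0.
Qed.

Let int_abs_t (u : R) :
  (\int[mu]_t `|f (t, u)| = ((fun u => `|(w u * kern u)%:E|) \_ `]0%R, 1%R]) u)%E.
Proof.
rewrite patchE; case: ifPn => [|].
  rewrite inE/= in_itv/= => u01; have [i E] := kernE u01.
  rewrite normrM (ger0_norm (kern_ge0 u01)).
  rewrite -E -RintegralZl// /Rintegral fineK//; last first.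
    by apply: integrable_fin_num => //; exact: integrable_EFinZl.
  rewrite [RHS]integral_mkcond; apply: eq_integral => t _.
  rewrite /f -[F (t, u)]/((fun t => F (t, u)) t) F_u//= !patchE.
  case: ifPn => [|_]; last by rewrite /point/= normr0.
  rewrite inE/= in_itv/= => /andP[ut t1]; congr EFin.
  by rewrite normrM; congr (_ * _); rewrite ger0_norm// mulr_ge0 ?subr_ge0// invr_ge0 powR_ge0.
rewrite notin_setE/= in_itv/= => /negP nu.
apply: integral0_eq => t _; rewrite /f /F/=; case: ifPn => [/and3P[u0 ut t1]|_].
  by move: nu; rewrite u0 (le_trans ut).
by rewrite normr0.
Qed.

(** Tonelli: the kernel is nonnegative, so integrating the modulus in [t] first leaves
    [|w u * kern u|], integrable by assumption. *)
Let intf : (mu \x mu)%E.-integrable setT f.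
Proof.
apply/integrable21ltyP => //.
under eq_integral => u _ do rewrite int_abs_t.
rewrite -integral_mkcond; by case/integrableP : iwk.
Qed.

Let int_u (t : R) : (\int[mu]_u f (t, u) =
  ((fun t => (prim2 w t / t `^ (1 + k))%:E) \_ `]0%R, 1%R]) t)%E.
Proof.
rewrite patchE; case: ifPn => [|].
  rewrite inE/= in_itv/= => /andP[t0 t1].
  have il : mu.-integrable `[0, t] (EFin \o (fun u => (t - u) * w u)).
    apply: (@integrable_mul_itv _ _ _ 0 t (fun u => t - u)) => //; first exact/iw/ltW.
    by move=> u; apply: cvgB; [exact: cvg_cst|exact: cvg_id].
  have il' : mu.-integrable `]0, t] (EFin \o (fun u => (t - u) * w u)).
    by apply: integrableS il => //; exact: subset_itv_oc_cc.
  rewrite /prim2 -Rintegral_itv_obnd_cbnd// -RintegralZr// /Rintegral fineK//; last first.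
    have i : mu.-integrable `]0, t] (EFin \o (fun u => (t `^ (1 + k))^-1 * ((t - u) * w u))).
      exact: integrable_EFinZl.
    apply: integrable_fin_num => //; apply: eq_integrable i => // u _.
    by rewrite /= mulrC.
  rewrite [RHS]integral_mkcond; apply: eq_integral => u _.
  rewrite /f /F/= patchE t1 andbT.
  have -> : (u \in `]0, t]%classic) = (0 < u) && (u <= t).
    by apply/idP/idP; rewrite inE/= in_itv.
  case: ifPn => // /andP[u0 _]; rewrite /w0 patchE mem_set//= in_itv/= andbT ltW//.
rewrite notin_setE/= in_itv/= => /negP nu.
apply: integral0_eq => u _; rewrite /f /F/=; case: ifPn => // /and3P[u0 ut t1].
by move: nu; rewrite t1 (lt_le_trans u0 ut).
Qed.

Lemma prim2_kern : mu.-integrable `]0, 1] (EFin \o (fun t => prim2 w t / t `^ (1 + k))) /\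
  \int[mu]_(t in `]0, 1]) (prim2 w t / t `^ (1 + k)) =
  \int[mu]_(u in `]0, 1]) (w u * kern u).
Proof.
split.
  have := integrable_fubini_F intf; rewrite /fubini_F.
  have -> : (fun t => \int[mu]_u f (t, u))%E =
    (EFin \o (fun t => prim2 w t / t `^ (1 + k))) \_ `]0%R, 1%R].
    by apply/funext => t; rewrite int_u.
  by rewrite -integrable_mkcond.
rewrite /Rintegral; congr fine; rewrite [LHS]integral_mkcond [RHS]integral_mkcond.
transitivity (\int[mu]_t \int[mu]_u f (t, u))%E.
  by apply: eq_integral => t _; rewrite int_u.
rewrite (Fubini intf).
by apply: eq_integral => u _; rewrite int_t.
Qed.

End FubiniKernel.
End Kernel.

Section RemainderIntegral.
Context {R : realType}.
Notation mu := (@lebesgue_measure R).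
Variable k : R.
Hypothesis k1 : 1 < k.

Let k0 : 0 < k. Proof. exact: lt_trans k1. Qed.

Section bounded.
Variables (g : R -> R) (M : R).
Hypotheses (mg : measurable_fun (Rplus R) g) (gM : forall t, 0 <= t -> `|g t| <= M).

Lemma tail_weight : mu.-integrable `[1, +oo[ (EFin \o (fun t => (t `^ (1 + k))^-1)) /\
  \int[mu]_(t in `[1, +oo[) (t `^ (1 + k))^-1 = k^-1.
Proof.
have E : (fun t : R => (t `^ (1 + k))^-1) = (fun t => t `^ (- (1 + k))).
  by apply/funext => t; rewrite powRN.
have r1 : - (1 + k) < -1 by rewrite ltrN2 ltrDl.
have [i e] := Rintegral_powRy r1; rewrite E; split => //; rewrite e.
by rewrite opprD addrAC addNr add0r invrN opprK.
Qed.

Lemma bounded_tail : mu.-integrable `[1, +oo[ (EFin \o (fun t => g t / t `^ (1 + k))) /\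
  `|\int[mu]_(t in `[1, +oo[) (g t / t `^ (1 + k))| <= M / k.
Proof.
have [i e] := tail_weight.
have sub1 : `[1, +oo[%classic `<=` Rplus R.
  by move=> t /=; rewrite !in_itv/= !andbT; exact: le_trans.
have iM : mu.-integrable `[1, +oo[ (EFin \o (fun t => M * (t `^ (1 + k))^-1)).
  exact: integrable_EFinZl.
have le t : `[1, +oo[%classic t -> `|g t / t `^ (1 + k)| <= M * (t `^ (1 + k))^-1.
  move=> /sub1; rewrite /= in_itv/= andbT => t0.
  by rewrite normrM ler_pM ?gM// ger0_norm// invr_ge0 powR_ge0.
have ig : mu.-integrable `[1, +oo[ (EFin \o (fun t => g t / t `^ (1 + k))).
  apply: integrable_EFin_le iM _ le => //.
  apply: measurable_funM; first exact: measurable_funS mg.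
  by case/integrableP : i => /measurable_EFinP.
split => //; apply: le_trans (le_normr_Rintegral _ ig) _ => //.
by rewrite -e -RintegralZl//; apply: le_Rintegral => //; exact: integrable_norm.
Qed.

End bounded.

Section identity.
Variables (g w : R -> R) (p M : R).
Hypotheses (mg : measurable_fun (Rplus R) g) (gM : forall t, 0 <= t -> `|g t| <= M).
Hypothesis mw : measurable_fun (Rplus R) w.
Hypothesis iw : forall c, 0 <= c -> mu.-integrable `[0, c] (EFin \o w).
Hypothesis gT : forall t, 0 <= t -> g t = g 0 + t * p + prim2 w t.

Definition remainder (f : R -> R) (q t : R) : R := (f t - f 0 - t * q) / t `^ (1 + k).

(** Up to 1 the numerator is [prim2 w], to which the exchange of integrals applies. Past 1 its three
    terms are separately integrable because k > 1, and the last two are integrated explicitly. *)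
Lemma remainder_integral :
  mu.-integrable `]0, 1] (EFin \o (fun u => w u * kern k u)) ->
  mu.-integrable `]0, +oo[ (EFin \o remainder g p) /\
  \int[mu]_(t in `]0, +oo[) remainder g p t =
  \int[mu]_(u in `]0, 1]) (w u * kern k u) +
  \int[mu]_(t in `[1, +oo[) (g t / t `^ (1 + k)) - g 0 / k - p / (k - 1).
Proof.
move=> iwk; have [i1 e1] := prim2_kern k1 mw iw iwk.
have E1 t : `]0, 1]%classic t -> remainder g p t = prim2 w t / t `^ (1 + k).
  rewrite /= in_itv/= => /andP[t0 _]; rewrite /remainder gT ?ltW//.
  by congr (_ / _); ring.
have [it et] := tail_weight.
have [ig _] := bounded_tail mg gM.
have [it' et'] : mu.-integrable `[1, +oo[ (EFin \o (fun t => t `^ (- k))) /\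
    \int[mu]_(t in `[1, +oo[) t `^ (- k) = (k - 1)^-1.
  have [|i ->] := @Rintegral_powRy R (- k); first by rewrite ltrN2.
  by split => //; rewrite -invrN opprD opprK.
have E2 t : `[1, +oo[%classic t -> remainder g p t =
    g t / t `^ (1 + k) - (g 0 * (t `^ (1 + k))^-1 + p * t `^ (- k)).
  rewrite /= in_itv/= andbT => t1; have t0 := lt_le_trans ltr01 t1.
  by rewrite /remainder -(mul_powR_ker k t0); ring.
have i2 : mu.-integrable `[1, +oo[ (EFin \o (fun t =>
    g t / t `^ (1 + k) - (g 0 * (t `^ (1 + k))^-1 + p * t `^ (- k)))).
  apply: integrable_EFinB => //; apply: integrable_EFinD => //;
    exact: integrable_EFinZl.
have i1' : mu.-integrable `]0, 1] (EFin \o remainder g p).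
  by apply: eq_integrable i1 => // t /set_mem/E1/= ->.
have i2' : mu.-integrable `[1, +oo[ (EFin \o remainder g p).
  by apply: eq_integrable i2 => // t /set_mem/E2/= ->.
have i2'' : mu.-integrable `]1, +oo[ (EFin \o remainder g p).
  apply: integrableS i2' => // t /=; rewrite !in_itv/= !andbT; exact: ltW.
have U : `]0, +oo[%classic = `]0, 1]%classic `|` `]1, +oo[%classic :> set R.
  by rewrite -itv_bndbnd_setU// bnd_simp.
have dU : [disjoint `]0, 1]%classic & `]1, +oo[%classic : set R].
  apply/disj_setPS => t [/=]; rewrite !in_itv/= andbT => /andP[_ t1].
  by rewrite ltNge t1.
have iU : mu.-integrable (`]0, 1]%classic `|` `]1, +oo[%classic) (EFin \o remainder g p).
  exact: integrable_setU_disj.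
rewrite U; split => //.
rewrite Rintegral_setU//.
rewrite [X in _ + X = _]Rintegral_itv_obnd_cbnd//.
rewrite (@eq_Rintegral _ _ _ mu _ (fun t => prim2 w t / t `^ (1 + k))); last first.
  by move=> t /set_mem/E1.
rewrite e1 -!addrA; congr (_ + _).
rewrite (@eq_Rintegral _ _ _ mu _ (fun t =>
    g t / t `^ (1 + k) - (g 0 * (t `^ (1 + k))^-1 + p * t `^ (- k)))); last first.
  by move=> t /set_mem/E2.
rewrite RintegralB//; last first.
  by apply: integrable_EFinD => //; exact: integrable_EFinZl.
rewrite RintegralD//; [|exact: integrable_EFinZl|exact: integrable_EFinZl].
by rewrite !RintegralZl// et et'; ring.
Qed.

(* [tau] vanishes at 1 and differs from [k * (k - 1) * kern] by a piecewise linear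
   function with a single knot at [a], so that integrating [w] against the difference
   only involves the values of [g] at 0, [a] and 1. *)
Lemma remainder_integral_tau (tau : R -> R) (a w1 w2 : R) : 0 < a < 1 ->
  a * w1 + (1 - a) * w2 = 1 ->
  (forall u, 0 < u <= 1 -> tau u = u `^ (1 - k) -
    (if u <= a then w1 * u else 1 - w2 * (1 - u))) ->
  mu.-integrable `]0, 1] (EFin \o (fun u => w u * tau u)) ->
  mu.-integrable `]0, +oo[ (EFin \o remainder g p) /\
  k * (k - 1) * \int[mu]_(t in `]0, +oo[) remainder g p t =
  \int[mu]_(u in `]0, 1]) (w u * tau u) + w1 * g 0 + (w2 - w1) * g a
  - (w2 + (k - 1)) * g 1 + k * (k - 1) * \int[mu]_(t in `[1, +oo[) (g t / t `^ (1 + k)).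
Proof.
move=> /andP[a0 a1] aw tauE iwt.
have k10 : k - 1 != 0 by rewrite subr_eq0 gt_eqF.
have k00 : k != 0 by rewrite gt_eqF.
have ilin c y : 0 <= c -> mu.-integrable `]0, c] (EFin \o (fun u => (y - u) * w u)).
  move=> c0; apply: (@integrable_mul_itv _ _ _ 0 c (fun u => y - u)) => //.
  - exact: subset_itv_oc_cc.
  - by apply: integrableS (iw c0) => //; exact: subset_itv_oc_cc.
  - by move=> u; apply: cvgB; [exact: cvg_cst|exact: cvg_id].
have p2 c : 0 <= c -> prim2 w c = \int[mu]_(u in `]0, c]) ((c - u) * w u).
  by move=> c0; rewrite /prim2 Rintegral_itv_obnd_cbnd//; exact: ilin.
pose h u := (if u <= a then (a - u) * w u else 0).
have hE : h \_ `]0, 1] = (fun u => (a - u) * w u) \_ `]0, a].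
  apply/funext => u; rewrite !patchE /h.
  have [ua|ua] := leP u a.
    have -> : (u \in `]0, 1]%classic) = (u \in `]0, a]%classic).
      by apply/idP/idP; rewrite !inE/= !in_itv/= => /andP[->]; rewrite ?ua ?(le_trans ua (ltW a1)).
    by [].
  rewrite [u \in `]0, a]%classic]memNset//; first by case: ifP.
  by rewrite /= in_itv/= => /andP[_]; rewrite leNgt ua.
have ih : mu.-integrable `]0, 1] (EFin \o h).
  rewrite integrable_mkcond// restrict_EFin hE -restrict_EFin -integrable_mkcond//.
  exact/ilin/ltW.
have eh : \int[mu]_(u in `]0, 1]) h u = prim2 w a.
  by rewrite Rintegral_mkcond hE -Rintegral_mkcond p2// ltW.
have il1 : mu.-integrable `]0, 1] (EFin \o (fun u => (1 - u) * w u)).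
  exact: ilin.
pose c1 := - (w2 + (k - 1)); pose c2 := w2 - w1.
pose kk := (k * (k - 1))^-1.
have E u : `]0, 1]%classic u -> w u * kern k u =
    kk * (w u * tau u + (c1 * ((1 - u) * w u) + c2 * h u)).
  rewrite /= in_itv/= => u01; rewrite /kern -/kk (tauE _ u01) /h /c1 /c2.
  have aw' : a * w1 = 1 - (1 - a) * w2 by lra.
  case: ifP => _; last by ring.
  rewrite [RHS](_ : _ = kk * w u * (u `^ (1 - k) + (k - 1) * u - (k - 1)
    - w2 * (1 - u) + w2 * (a - u) - (a * w1))); last by ring.
  by rewrite aw'; ring.
have i' : mu.-integrable `]0, 1] (EFin \o (fun u =>
    w u * tau u + (c1 * ((1 - u) * w u) + c2 * h u))).
  by apply: integrable_EFinD => //; apply: integrable_EFinD => //; exact: integrable_EFinZl.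
have iwk : mu.-integrable `]0, 1] (EFin \o (fun u => w u * kern k u)).
  have i'' : mu.-integrable `]0, 1] (EFin \o (fun u =>
      kk * (w u * tau u + (c1 * ((1 - u) * w u) + c2 * h u)))).
    exact: integrable_EFinZl.
  by apply: eq_integrable i'' => // u /set_mem/E/= ->.
have [i e] := remainder_integral iwk; split => //; rewrite e.
rewrite (@eq_Rintegral _ _ _ mu _ (fun u =>
  kk * (w u * tau u + (c1 * ((1 - u) * w u) + c2 * h u)))); last first.
  by move=> u /set_mem/E.
rewrite RintegralZl// RintegralD//; last first.
  by apply: integrable_EFinD => //; exact: integrable_EFinZl.
rewrite RintegralD//; [|exact: integrable_EFinZl|exact: integrable_EFinZl].
rewrite !RintegralZl// eh -(p2 1)//.
have g1 := gT ler01; have ga := gT (ltW a0); rewrite mul1r in g1.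
have -> : prim2 w 1 = g 1 - g 0 - p by rewrite g1; ring.
have -> : prim2 w a = g a - g 0 - a * p by rewrite ga; ring.
have aw' : a * w1 = 1 - (1 - a) * w2 by lra.
set I1 := \int[mu]_(u in _) _; set I2 := \int[mu]_(t in _) _.
have kkE : k * (k - 1) * kk = 1 by rewrite /kk mulfV// mulf_neq0.
set Y := _ + (_ + _).
rewrite [LHS](_ : _ = k * (k - 1) * kk * Y + k * (k - 1) * I2 - (k - 1) * g 0 - k * p);
  last by field; apply/andP.
rewrite kkE mul1r /Y /c1 /c2.
(* The balance [a * w1 + (1 - a) * w2 = 1] makes the coefficient of [p] vanish, so no value of the
   first derivative is left in the formula. *)
rewrite [LHS](_ : _ = I1 + k * (k - 1) * I2 + w1 * g 0 + (w2 - w1) * g a - (w2 + (k - 1)) * g 1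
  + p * (w2 + (k - 1) - a * w2 + a * w1 - k)); last by ring.
by rewrite aw'; ring.
Qed.

End identity.
End RemainderIntegral.

(** * Norms on the half-line *)

Section NormRp.
Context {R : realType}.
Notation mu := (@lebesgue_measure R).
Implicit Types (f g : R -> R) (s : \bar R).

Let muT : (0 < mu [set: R])%E.
Proof. by rewrite -set_itvNyy lebesgue_measure_itv/= ?ltNyy ?ltry. Qed.

Lemma normRp_fin (r : R) f : 0 < r ->
  normRp r%:E f = ((\int[mu]_(t in Rplus R) (`|f t| `^ r)%:E) `^ r^-1)%E.
Proof.
move=> r0; rewrite /normRp restrict_EFin unlock; congr (_ `^ _)%E.
rewrite [RHS]integral_mkcond; apply: eq_integral => t _.
rewrite /= !patchE; case: ifPn => // _.
by rewrite /point/= normr0 powR0// gt_eqF.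
Qed.

Let measurable_norm_powR (r : R) f : measurable_fun (Rplus R) f ->
  measurable_fun (Rplus R) (fun t => (`|f t| `^ r)%:E).
Proof.
move=> mf; apply/measurable_EFinP.
by apply: (measurableT_comp (measurable_powR r)); exact: measurableT_comp.
Qed.

Lemma normRpoo_le f (M : R) : 0 <= M ->
  {ae mu, forall t : R, 0 <= t -> `|f t| <= M} -> (normRp +oo f <= M%:E)%E.
Proof.
move=> M0 fM; rewrite /normRp unlock muT; apply/ess_supP.
rewrite restrict_EFin; move: fM; apply: filterS; first exact: (ae_filter_ringOfSetsType mu).
move=> t ft; rewrite /= patchE; case: ifPn => [|_].
  by rewrite inE/= in_itv/= andbT lee_fin => /ft.
by rewrite /point/= normr0 lee_fin.
Qed.

Lemma ae_eq_normRp s f g : (0 < s)%E -> measurable_fun (Rplus R) f ->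
  measurable_fun (Rplus R) g -> {ae mu, forall t : R, 0 <= t -> f t = g t} ->
  normRp s f = normRp s g.
Proof.
move=> s0 mf mg fg; case: s s0 => [r r0||//].
- rewrite !normRp_fin//; congr (_ `^ _)%E.
  apply: ae_eq_integral => //; [exact: measurable_norm_powR|exact: measurable_norm_powR|].
  move: fg; apply: filterS; first exact: (ae_filter_ringOfSetsType mu).
  move=> t ft /=; rewrite in_itv/= andbT => /ft ->//.
- rewrite /normRp unlock muT => _; apply: eq_ess_sup.
  move: fg; apply: filterS; first exact: (ae_filter_ringOfSetsType mu).
  move=> t ft; rewrite /= !patchE; case: ifPn => //.
  by rewrite inE/= in_itv/= andbT => /ft ->.
Qed.

Lemma normRpZ s (c : R) f : (0 < s)%E -> measurable_fun (Rplus R) f -> 0 <= c ->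
  normRp s (fun t => c * f t) = (c%:E * normRp s f)%E.
Proof.
move=> s0 mf c0; case: s s0 => [r r0||//].
- rewrite !normRp_fin//.
  have mp := measurable_norm_powR r mf.
  under eq_integral do rewrite normrM powRM// EFinM.
  rewrite ge0_integralZl//.
  rewrite poweRM ?lee_fin ?powR_ge0//; last first.
    by apply: integral_ge0 => t _; rewrite lee_fin powR_ge0.
  by rewrite poweR_EFin -powRrM divff ?gt_eqF// powRr1// ger0_norm.
- rewrite /normRp !restrict_EFin unlock muT => _; rewrite -ess_supZl//; apply: eq_ess_sup.
  apply/nearW => t; rewrite /= !patchE; case: ifPn => _ /=.
    by rewrite normrM EFinM ger0_norm.
  by rewrite /point/= normr0 mule0.
Qed.

(** If [|f x|] exceeded the essential supremum, so would [|f|] on an interval to the right of [x],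
    which has positive measure. Essential suprema thereby control values at points, 0 included. *)
Lemma right_continuous_normRpoo f x : 0 <= x -> f @ x^'+ --> f x ->
  (`|f x|%:E <= normRp +oo f)%E.
Proof.
move=> x0 fx; rewrite leNgt; apply/negP => lt.
have N0 : (0 <= normRp +oo f)%E := normRp_ge0 _ _.
have Nf : normRp +oo f = (fine (normRp +oo f))%:E.
  by rewrite fineK// ge0_fin_numE// (lt_trans lt)// ltry.
move: lt; rewrite Nf lte_fin; set N := fine _ => lt.
have fx' : `|f t| @[t --> x^'+] --> `|f x| by exact: cvg_norm.
have : \forall t \near x^'+, N < `|f t| by exact: cvgr_gt fx' _ lt.
move=> /nbhs_ballP[d /= d0 fd].
have [A [mA A0 sub]] := normRpoo_ae f.
have sA : `]x, (x + d)[%classic `<=` A.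
  move=> t /=; rewrite in_itv/= => /andP[xt txd]; apply: sub => /= ft.
  have t0 : 0 <= t by rewrite (le_trans x0)// ltW.
  move: (ft t0); rewrite Nf lee_fin leNgt; apply/negP/negPn; apply: fd => //=.
  by rewrite /ball/= distrC ger0_norm ?subr_ge0 ?ltrBlDl// ltW.
have : (mu `]x, (x + d)%R[ <= 0)%E by rewrite -A0; apply: le_measure; rewrite ?inE.
by rewrite lebesgue_measure_itv/= lte_fin ltrDl d0 -EFinD addrAC subrr add0r lee_fin leNgt d0.
Qed.

End NormRp.

(** * The function tau *)

Section PowerConvexity.
Context {R : realType}.
Implicit Types (r x y z : R).

(** As r < 0 and ln z <= z - 1, the left side is at most 1 + r ln z, which is strictly below exp(r
    ln z). *)
Lemma powR_tangent_lt r z : r < 0 -> 0 < z -> z != 1 -> 1 + r * (z - 1) < z `^ r.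
Proof.
move=> r0 z0 z1; rewrite /powR gt_eqF//.
apply: le_lt_trans (expR_gt1Dx _); last first.
  by apply: mulf_neq0; [rewrite lt_eqF|rewrite ln_eq0].
rewrite lerD2l ler_nM2l// -[X in ln X](subrK 1) addrC.
by apply: le_ln1Dx; rewrite ltrBrDr addNr.
Qed.

(** Strict convexity of the power, free of divisions: the tangent at [y] lies below the graph at [x]
    and at [z], and its slope cancels with the weights [z - y] and [y - x]. *)
Lemma powR_chord_lt r x y z : r < 0 -> 0 < x -> x < y -> y < z ->
  (z - x) * y `^ r < (z - y) * x `^ r + (y - x) * z `^ r.
Proof.
move=> r0 x0 xy yz; have y0 := lt_trans x0 xy; have z0 := lt_trans y0 yz.
have yn0 : y != 0 by rewrite gt_eqF.
have tangent t : 0 < t -> t != y -> y `^ r * (1 + r * (t / y - 1)) < t `^ r.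
  move=> t0 ty; have <- : (t / y) `^ r * y `^ r = t `^ r.
    by rewrite -powRM ?divr_ge0 ?ltW// divfK.
  rewrite mulrC ltr_pM2r ?powR_gt0//.
  apply: powR_tangent_lt => //; first by rewrite divr_gt0.
  by rewrite -(inj_eq (mulIf yn0)) divfK// mul1r.
have tx := tangent x x0 (negbT (lt_eqF xy)).
have tz := tangent z z0 (negbT (gt_eqF yz)).
have zy0 : 0 < z - y by rewrite subr_gt0.
have yx0 : 0 < y - x by rewrite subr_gt0.
rewrite -(ltr_pM2l zy0) in tx; rewrite -(ltr_pM2l yx0) in tz.
have := ltrD tx tz.
apply: le_lt_trans; rewrite le_eqVlt; apply/orP; left; apply/eqP.
by field.
Qed.

End PowerConvexity.

Section Extend.
Context {R : realType}.
Notation mu := (@lebesgue_measure R).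

Lemma integrable_eq_itv (f g : R -> R) c d : c <= d -> measurable_fun setT g ->
  mu.-integrable `[c, d] (EFin \o f) -> (forall t, c < t < d -> f t = g t) ->
  mu.-integrable `[c, d] (EFin \o g) /\
  \int[mu]_(t in `[c, d]) g t = \int[mu]_(t in `[c, d]) f t.
Proof.
move=> cd mg intf fg.
have mg' : measurable_fun `[c, d] g by exact: measurable_funTS.
have ae : {ae mu, forall t, `[c, d]%classic t -> f t = g t}.
  exists [set c; d]; split => //.
  - apply: measurableU; exact: measurable_set1.
  - apply/eqP; rewrite eq_le measure_ge0 andbT.
    apply: le_trans (measureU2 _ _ _) _; try exact: measurable_set1.
    rewrite [X in (X + _)%E]lebesgue_measure_set1 add0e.
    by rewrite [leLHS]lebesgue_measure_set1.
  - move=> t /=; apply: contra_notP => /not_orP[/eqP tc /eqP td].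
    rewrite in_itv/= => /andP[ct dt]; apply: fg.
    by rewrite !lt_neqAle ct dt td eq_sym tc.
split; first exact: integrable_EFin_ae intf mg' ae.
by apply/esym; exact: ae_eq_Rintegral intf mg' ae.
Qed.

Lemma integrable_itv_cat (f : R -> R) c d e : c <= d <= e ->
  mu.-integrable `[c, d] (EFin \o f) -> mu.-integrable `[d, e] (EFin \o f) ->
  mu.-integrable `[c, e] (EFin \o f) /\
  \int[mu]_(t in `[c, e]) f t = \int[mu]_(t in `[c, d]) f t + \int[mu]_(t in `[d, e]) f t.
Proof.
move=> /andP[cd de] i1 i2.
have i2' : mu.-integrable `]d, e] (EFin \o f).
  by apply: integrableS i2 => //; exact: subset_itv_oc_cc.
have U : `[c, e]%classic = `[c, d]%classic `|` `]d, e]%classic :> set R.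
  by rewrite -itv_bndbnd_setU// bnd_simp.
have dU : [disjoint `[c, d]%classic & `]d, e]%classic : set R].
  apply/disj_setPS => t [/=]; rewrite !in_itv/= => /andP[_ td] /andP[dt _].
  by move: dt; rewrite ltNge td.
have i : mu.-integrable (`[c, d]%classic `|` `]d, e]%classic) (EFin \o f).
  exact: integrable_setU_disj.
rewrite U; split => //.
by rewrite Rintegral_setU// [X in _ + X = _]Rintegral_itv_obnd_cbnd.
Qed.

End Extend.

Section Tau.
Context {R : realType}.
Notation mu := (@lebesgue_measure R).
Variables (k a b : R).
Hypotheses (k1 : 1 < k) (abM : in_M a b).

(** The constant values of [omega] on []0, a]] and, for [slope2], on []a, 1[]. They are the w1 and
    w2 of the overview. *)
Definition slope1 : R := a^-1 * (1 - b)^-1 * (1 - b - (1 - b `^ (1 - k)) * (1 - a)).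
Definition slope2 : R := (1 - b)^-1 * (1 - b `^ (1 - k)).

Let a0 : 0 < a. Proof. by case: abM => /andP[]. Qed.
Let a1 : a < 1. Proof. by case: abM => /andP[]. Qed.
Let b0 : 0 < b. Proof. by case: abM => _ /andP[]. Qed.
Let b1 : b < 1. Proof. by case: abM => _ /andP[]. Qed.
Let ab : a <= b. Proof. by case: abM. Qed.
Let k10 : 1 - k < 0. Proof. by rewrite subr_lt0. Qed.

(** The integral of [omega] over [[0, 1]] is 1, whence [tau] vanishes at 1; past 1 it stays zero
    since there [omega] is the derivative of the power. *)
Lemma slope_balance : a * slope1 + (1 - a) * slope2 = 1.
Proof. by rewrite /slope1 /slope2; field; rewrite subr_eq0 !gt_eqF. Qed.

(** [slope2] is the slope of the chord of the convex function x^(1 - k) between [b] and 1, so it is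
    smaller than the derivative 1 - k at 1. *)
Lemma slope2_lt : slope2 + (k - 1) < 0.
Proof.
have := powR_tangent_lt k10 b0 (negbT (lt_eqF b1)).
have b10 : 0 < 1 - b by rewrite subr_gt0.
rewrite /slope2 => h; rewrite -(pmulr_llt0 _ b10) mulrDl mulrAC mulVf ?gt_eqF// mul1r.
by lra.
Qed.

Lemma slope2_lt0 : slope2 < 0.
Proof. by apply: lt_trans slope2_lt; rewrite ltrDl subr_gt0. Qed.

Lemma slope1_gt0 : 0 < slope1.
Proof.
rewrite -(pmulr_rgt0 _ a0) (_ : a * slope1 = 1 - (1 - a) * slope2).
  by rewrite subr_gt0 (lt_trans _ ltr01)// pmulr_rlt0 ?slope2_lt0// subr_gt0.
by have := slope_balance; lra.
Qed.

Lemma measurable_omega : measurable_fun setT (omega k a b).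
Proof.
have mleT (r : R) : measurable_fun setT (fun x : R => x <= r).
  exact: measurable_fun_ler.
rewrite /omega; apply: measurable_fun_ifT => //.
apply: measurable_fun_ifT => //.
apply: measurable_fun_ifT => //; first exact: measurable_fun_ltr.
by apply: measurable_funM => //; exact: measurable_powR_on.
Qed.

Let omega1 x : 0 <= x <= a -> mu.-integrable `[0, x] (EFin \o omega k a b) /\
  \int[mu]_(t in `[0, x]) omega k a b t = slope1 * x.
Proof.
move=> /andP[x0 xa].
have [|t /andP[t0 tx]|i e] := integrable_eq_itv x0 measurable_omega (f := cst slope1).
- by apply: continuous_compact_integrable; [exact: segment_compact|exact: cst_continuous].
- by rewrite /omega leNgt t0/= (le_trans (ltW tx) xa).
split => //; rewrite e Rintegral_cst//= lebesgue_measure_itv/= lte_fin.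
by case: ltP => [_|]; rewrite -?EFinB ?subr0//= => xx; rewrite (le_anti (_ : 0 <= x <= 0))// x0.
Qed.

Let omega2 x : a <= x <= 1 -> mu.-integrable `[a, x] (EFin \o omega k a b) /\
  \int[mu]_(t in `[a, x]) omega k a b t = slope2 * (x - a).
Proof.
move=> /andP[ax x1].
have [|t /andP[ta tx]|i e] := integrable_eq_itv ax measurable_omega (f := cst slope2).
- by apply: continuous_compact_integrable; [exact: segment_compact|exact: cst_continuous].
- by rewrite /omega leNgt (lt_trans a0 ta)/= leNgt ta/= (lt_le_trans tx x1).
split => //; rewrite e Rintegral_cst//= lebesgue_measure_itv/= lte_fin.
by case: ltP => [_|]; rewrite -?EFinB//= => xx; rewrite (le_anti (_ : a <= x <= a)) ?subrr// ax.
Qed.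

Let omega3 x : 1 <= x -> mu.-integrable `[1, x] (EFin \o omega k a b) /\
  \int[mu]_(t in `[1, x]) omega k a b t = x `^ (1 - k) - 1.
Proof.
move=> x1; have kn0 : - k + 1 != 0 by rewrite addrC lt_eqF.
have [i e] := Rintegral_powR kn0 ltr01 x1.
have i' : mu.-integrable `[1, x] (EFin \o (fun t => (1 - k) * t `^ (- k))).
  exact: integrable_EFinZl.
have [t /andP[t1 tx]|i2 e2] := integrable_eq_itv x1 measurable_omega i'.
  by rewrite /omega leNgt (lt_trans ltr01 t1)/= leNgt (lt_trans a1 t1)/= ltNge (ltW t1).
split => //; rewrite e2 RintegralZl// e powR1 [- k + 1]addrC mulrCA mulfV ?mulr1//.
by rewrite lt_eqF.
Qed.

Lemma tauE x : 0 <= x -> tau k a b x =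
  if x <= a then x `^ (1 - k) - slope1 * x
  else if x <= 1 then x `^ (1 - k) - (1 - slope2 * (1 - x)) else 0.
Proof.
move=> x0; rewrite /tau; have [xa|xa] := leP x a; first by rewrite (omega1 _).2// x0.
have aa : 0 <= a <= a by rewrite lexx ltW.
have [i1 e1] := omega1 aa; have e1' := slope_balance.
have [x1|x1] := leP x 1.
  have ax1 : a <= x <= 1 by rewrite x1 ltW.
  have ax : 0 <= a <= x by rewrite !ltW.
  have [i2 e2] := omega2 ax1; have [_ ->] := integrable_itv_cat ax i1 i2.
  by rewrite e1 e2; lra.
have a11 : a <= (1 : R) <= 1 by apply/andP; split => //; exact: ltW.
have a01 : 0 <= a <= 1 by rewrite !ltW.
have x01 : 0 <= (1 : R) <= x by rewrite ler01 ltW.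
have [i2 e2] := omega2 a11; have [i3 e3] := omega3 (ltW x1).
have [i4 e4] := integrable_itv_cat a01 i1 i2.
have [_ ->] := integrable_itv_cat x01 i4 i3.
by rewrite e4 e1 e2 e3; lra.
Qed.

Lemma tau_ge1 x : 1 <= x -> tau k a b x = 0.
Proof.
rewrite le_eqVlt => /predU1P[<-|x1]; rewrite tauE ?ler01 ?(le_trans ler01 (ltW _))//.
  by rewrite leNgt a1/= lexx powR1 subrr mulr0 subr0 subrr.
by rewrite leNgt (lt_trans a1 x1)/= leNgt x1.
Qed.

(* On [[a, 1]] the function is the power minus its chord between [b] and 1. *)
Let tau_mid x : a <= x <= 1 -> (1 - b) * tau k a b x =
  (1 - b) * x `^ (1 - k) - ((1 - x) * b `^ (1 - k) + (x - b)).
Proof.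
move=> /andP[ax x1]; have e1' := slope_balance.
have x0 : 0 <= x := le_trans (ltW a0) ax.
have -> : tau k a b x = x `^ (1 - k) - (1 - slope2 * (1 - x)).
  rewrite tauE// x1; case: ifP => // xa.
  have -> : x = a by apply: le_anti; rewrite xa.
  by congr (_ - _); lra.
by rewrite /slope2; field; rewrite subr_eq0 gt_eqF.
Qed.

(** A strictly convex function lies below its chord between the points [b] and 1 and above the line
    through them to the left of [b]. *)
Let tau_chord x : a <= x <= 1 -> [/\ x < b -> 0 < tau k a b x,
  b <= x -> tau k a b x <= 0 & b < x < 1 -> tau k a b x < 0].
Proof.
move=> /andP[ax x1]; have x0 : 0 < x := lt_le_trans a0 ax.
have b10 : 0 < 1 - b by rewrite subr_gt0.
have tm : (1 - b) * tau k a b x = _ := tau_mid (introT andP (conj ax x1)).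
have neg : b < x < 1 -> tau k a b x < 0.
  move=> /andP[bx x1']; rewrite -(pmulr_rlt0 _ b10) tm subr_lt0.
  by have := powR_chord_lt k10 b0 bx x1'; rewrite powR1 mulr1.
split => //.
- move=> xb; rewrite -(pmulr_rgt0 _ b10) tm.
  by have := powR_chord_lt k10 x0 xb b1; rewrite powR1 mulr1; lra.
- move: x1; rewrite le_eqVlt => /predU1P[-> _|x1' ]; first by rewrite tau_ge1.
  rewrite le_eqVlt => /predU1P[bx|bx]; last by rewrite ltW// neg// bx.
  rewrite -(pmulr_rle0 _ b10) tm bx; lra.
Qed.

Lemma tau_b : tau k a b b = 0.
Proof.
have h : a <= b <= 1 by rewrite ab ltW.
have : (1 - b) * tau k a b b = 0 by rewrite (tau_mid h); ring.
by move=> /eqP; rewrite mulf_eq0 subr_eq0 gt_eqF//= => /eqP.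
Qed.

Let tau_a_ge0 : 0 <= tau k a b a.
Proof.
have [ab'|ba] := ltP a b; last first.
  have aE : a = b by apply: le_anti; rewrite ab.
  by rewrite [X in tau _ _ _ X]aE tau_b.
by apply/ltW; have [|+ _ _] := @tau_chord a; [rewrite lexx ltW|exact].
Qed.

(** To the left of [a] the power and the term [- slope1 * x] both decrease strictly, so [tau]
    exceeds its nonnegative value at [a]; to the right of [a] convexity decides. *)
Lemma tau_gt0 x : 0 < x < b -> x != a -> 0 < tau k a b x.
Proof.
move=> /andP[x0 xb]; rewrite neq_lt => /orP[xa|ax]; last first.
  by have [|+ _ _] := @tau_chord x; [rewrite !ltW// (lt_trans xb)|exact].
apply: le_lt_trans tau_a_ge0 _; rewrite (tauE (ltW a0)) (tauE (ltW x0)) lexx (ltW xa).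
apply: ler_ltB; last by rewrite ltr_pM2l// slope1_gt0.
rewrite -opprB !powRN lef_pV2 ?posrE ?powR_gt0//.
by apply: ge0_ler_powR; rewrite ?nnegrE ?subr_ge0 ?ltW.
Qed.

Lemma tau_le0 x : b <= x -> tau k a b x <= 0.
Proof.
move=> bx; have [x1|/ltW/tau_ge1->//] := leP x 1.
by have [|_ + _] := @tau_chord x; [rewrite x1 (le_trans ab)|exact].
Qed.

Lemma tau_lt0 x : b < x < 1 -> tau k a b x < 0.
Proof.
move=> /[dup] /andP[bx x1] bx1; have [|_ _ +] := @tau_chord x; last exact.
by rewrite (ltW x1) (le_trans ab)// ltW.
Qed.

Lemma tau_ge0 x : 0 <= x <= b -> 0 <= tau k a b x.
Proof.
move=> /andP[]; rewrite le_eqVlt => /predU1P[<- _|x0].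
  by rewrite (tauE (lexx 0)) (ltW a0) mulr0 subr0 powR_ge0.
rewrite le_eqVlt => /predU1P[->|xb]; first by rewrite tau_b.
have [->|xa] := eqVneq x a; last by rewrite ltW// tau_gt0// x0.
exact: tau_a_ge0.
Qed.

End Tau.

(** * Signed powers, and integrability of [tau] *)

Section SgnPow.
Context {R : realType}.
Implicit Types (q y : R).

Lemma sgn_pow_gt0 q y : 0 < y -> 0 < sgn_pow q y.
Proof. by move=> y0; rewrite /sgn_pow gtr0_sg// mulr1 powR_gt0// normr_gt0 gt_eqF. Qed.

Lemma sgn_powN q y : sgn_pow q (- y) = - sgn_pow q y.
Proof. by rewrite /sgn_pow normrN sgrN mulrN. Qed.

Lemma sgn_pow0 q : sgn_pow q 0 = 0.
Proof. by rewrite /sgn_pow sgr0 mulr0. Qed.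

Lemma sgn_pow_ge0 q y : 0 <= y -> 0 <= sgn_pow q y.
Proof. by rewrite le_eqVlt => /predU1P[<-|/sgn_pow_gt0/ltW//]; rewrite sgn_pow0. Qed.

Lemma sgn_pow_le0 q y : y <= 0 -> sgn_pow q y <= 0.
Proof. by move=> y0; rewrite -oppr_ge0 -sgn_powN sgn_pow_ge0// oppr_ge0. Qed.

Lemma mul_sgn_pow q y : 0 < q -> sgn_pow q y * y = `|y| `^ q.
Proof.
by move=> q0; rewrite /sgn_pow -mulrA -normrEsg mulrC mulr_powRB1.
Qed.

Lemma norm_sgn_pow q y : y != 0 -> `|sgn_pow q y| = `|y| `^ (q - 1).
Proof.
by move=> y0; rewrite /sgn_pow normrM normr_sg y0 mulr1 ger0_norm// powR_ge0.
Qed.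

Lemma norm_sgn_pow_le q y : 1 <= q -> `|sgn_pow q y| <= 1 + `|y| `^ q.
Proof.
move=> q1; have [->|y0] := eqVneq y 0.
  by rewrite sgn_pow0 normr0 addr_ge0// powR_ge0.
rewrite norm_sgn_pow//; have y0' : 0 < `|y| by rewrite normr_gt0.
have [y1|/ltW-y1] := leP `|y| 1.
  apply: (@le_trans _ _ (1 `^ (q - 1))); last by rewrite powR1 lerDl powR_ge0.
  apply: ge0_ler_powR; rewrite ?nnegrE//.
  by rewrite subr_ge0.
apply: (@le_trans _ _ (`|y| `^ q)); last by rewrite lerDr.
by apply: ler_powR => //; rewrite gerBl.
Qed.

(** The point 0 is excluded because for [q = 1], that is [s = +oo], the function is the sign. *)
Lemma sgn_pow_continuous q y : y != 0 -> {for y, continuous (@sgn_pow R q)}.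
Proof.
have pos z : 0 < z -> {for z, continuous (@sgn_pow R q)}.
  have E t : 0 < t -> sgn_pow q t = t `^ (q - 1).
    by move=> t0; rewrite /sgn_pow gtr0_sg// gtr0_norm// mulr1.
  move=> z0; have c : {for z, continuous (fun t : R => t `^ (q - 1))}.
    exact: continuous_powR.
  rewrite /prop_for /continuous_at E//.
  apply: cvg_trans c; apply: near_eq_cvg; near=> t.
  by rewrite E//; near: t; exact: lt_nbhsr.
rewrite neq_lt => /orP[y0|]; last exact: pos.
have := pos (- y); rewrite oppr_gt0 => /(_ y0) c.
rewrite (_ : sgn_pow q = (fun t => - sgn_pow q (- t))); last first.
  by apply/funext => t; rewrite sgn_powN opprK.
apply: cvgN; apply: (continuous_comp (f := -%R)) => //; exact: opp_continuous.
Unshelve. all: by end_near. Qed.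

Lemma measurable_sgn_pow q : measurable_fun setT (@sgn_pow R q).
Proof.
have msg : measurable_fun setT (@Num.sg R).
  rewrite (_ : @Num.sg R = fun y => if y == 0 then 0 else if y < 0 then -1 else 1).
    apply: measurable_fun_ifT => //; first exact: measurable_fun_eqr.
    by apply: measurable_fun_ifT => //; exact: measurable_fun_ltr.
  apply/funext => y; case: ifPn => [/eqP->|]; first by rewrite sgr0.
  by rewrite neq_lt; case: ltP => /= [/ltr0_sg|_ /gtr0_sg].
apply: measurable_funM => //.
have := measurableT_comp (@measurable_powR_on R setT (q - 1))
  (@normr_measurable R setT).
exact.
Qed.

End SgnPow.

Section TauIntegrable.
Context {R : realType}.
Notation mu := (@lebesgue_measure R).
Variables (s : \bar R) (k a b : R).
Hypotheses (s1 : (1 < s)%E) (k1 : 1 < k) (k2 : k < 2 - inv_exp s) (abM : in_M a b).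

Let a0 : 0 < a. Proof. by case: abM => /andP[]. Qed.
Let ab : a <= b. Proof. by case: abM. Qed.
Let q := conj_exp s.
Let q0 : 0 < q. Proof. exact: conj_exp_gt0. Qed.
Let q1 : 1 <= q. Proof. exact: conj_exp_ge1. Qed.

Lemma measurable_tau : measurable_fun (Rplus R) (tau k a b).
Proof.
apply: (eq_measurable_fun (fun x : R => if x <= a then x `^ (1 - k) - slope1 k a b * x
  else if x <= 1 then x `^ (1 - k) - (1 - slope2 k b * (1 - x)) else 0)).
  by move=> x /set_mem/=; rewrite in_itv/= andbT => x0; rewrite tauE.
apply: measurable_funTS; have mp := @measurable_powR_on R setT (1 - k).
apply: measurable_fun_ifT; first exact: measurable_fun_ler.
  by apply: measurable_funB => //; exact: measurable_funM.
apply: measurable_fun_ifT => //; first exact: measurable_fun_ler.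
apply: measurable_funB => //; apply: measurable_funB => //.
by apply: measurable_funM => //; exact: measurable_funB.
Qed.

Lemma measurable_tau_s : measurable_fun (Rplus R) (tau_s s k a b).
Proof. exact: measurableT_comp (@measurable_sgn_pow R q) measurable_tau. Qed.

Lemma norm_tau_le x : 0 < x <= 1 ->
  `|tau k a b x| <= (1 - slope2 k b) * x `^ (1 - k).
Proof.
move=> /andP[x0 x1]; have s20 := slope2_lt0 k1 abM; have s10 := slope1_gt0 k1 abM.
have xk1 : 1 <= x `^ (1 - k).
  rewrite -opprB powRN -[leLHS]invr1 lef_pV2 ?posrE ?powR_gt0//.
  rewrite [leRHS](_ : 1 = 1 `^ (k - 1)); last by rewrite powR1.
  by apply: ge0_ler_powR; rewrite ?nnegrE ?subr_ge0 ?ler01// ltW.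
have s21 : 0 <= - slope2 k b by rewrite oppr_ge0 ltW.
have px : 0 <= - slope2 k b * x `^ (1 - k) by rewrite mulr_ge0 ?powR_ge0.
rewrite ler_norml; have [xb|bx] := leP x b.
  have t0 : 0 <= tau k a b x by rewrite (tau_ge0 k1 abM)// ltW.
  apply/andP; split; first by rewrite (le_trans _ t0)// oppr_le0; lra.
  rewrite (tauE k1 abM (ltW x0)) x1; case: ifP => _.
    have : 0 <= slope1 k a b * x by rewrite mulr_ge0 ?ltW.
    by lra.
  have : 0 <= - slope2 k b * (1 - x) by rewrite mulr_ge0// subr_ge0.
  by lra.
have t0 := tau_le0 k1 abM (ltW bx).
apply/andP; split; last by apply: le_trans t0 _; lra.
rewrite (tauE k1 abM (ltW x0)) x1 (lt_geF (le_lt_trans ab bx)).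
have : - slope2 k b * (1 - x) <= - slope2 k b * x `^ (1 - k).
  by rewrite ler_wpM2l//; lra.
lra.
Qed.

Lemma measurable_tau_pow : measurable_fun (`]0, 1] : set R) (fun t => `|tau k a b t| `^ q).
Proof.
have := measurableT_comp (@measurable_powR_on R setT q)
  (measurableT_comp (@normr_measurable R setT) measurable_tau).
by apply: measurable_funS => // t /=; rewrite !in_itv/= andbT => /andP[/ltW].
Qed.

(** Near 0 the integrand is of order x^((1 - k) q). Since 1 / q = 1 - 1/s, the requirement (1 - k) q
    > -1 is the hypothesis [k2]. *)
Lemma integrable_tau_pow : mu.-integrable `]0, 1] (EFin \o (fun t => `|tau k a b t| `^ q)).
Proof.
have s20 := slope2_lt0 k1 abM; have /andP[sg0 sg1] := inv_exp_itv s1.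
have r1 : -1 < (1 - k) * q.
  rewrite -subr_gt0 opprK -(pmulr_lgt0 _ (_ : 0 < 1 - inv_exp s)) ?subr_gt0//.
  have qE : q * (1 - inv_exp s) = 1.
    by rewrite /q conj_expE// mulVf// subr_eq0 gt_eqF.
  by have := k2; rewrite mulrDl -mulrA qE; lra.
have i : mu.-integrable `]0, 1] (EFin \o (fun t => (1 - slope2 k b) `^ q * t `^ ((1 - k) * q))).
  by apply: integrable_EFinZl => //; exact: integrable_powR01.
apply: integrable_EFin_le i _ _ => //; first exact: measurable_tau_pow.
move=> t /=; rewrite in_itv/= => t01; rewrite ger0_norm ?powR_ge0//.
rewrite powRrM -powRM ?powR_ge0//; last by lra.
apply: ge0_ler_powR; rewrite ?nnegrE ?norm_tau_le//; first exact: ltW.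
by rewrite mulr_ge0 ?powR_ge0//; lra.
Qed.

Lemma tau_s_ge1 t : 1 <= t -> tau_s s k a b t = 0.
Proof. by move=> t1; rewrite /tau_s tau_ge1// sgn_pow0. Qed.

(** A default value: the power of 0 with a nonzero exponent is 0 by convention, although [tau] blows
    up on approaching 0. *)
Lemma tau0 : tau k a b 0 = 0.
Proof. by rewrite (tauE k1 abM (lexx 0)) (ltW a0) mulr0 subr0 powR0// lt_eqF// subr_lt0. Qed.

Lemma tau_s0 : tau_s s k a b 0 = 0.
Proof. by rewrite /tau_s tau0 sgn_pow0. Qed.

Lemma tau_s_restrict : tau_s s k a b \_ (Rplus R) = tau_s s k a b \_ `]0, 1].
Proof.
apply/funext => t; rewrite !patchE; case: ifPn; case: ifPn => //.
- rewrite notin_setE inE/= !in_itv/= andbT => /negP + t0.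
  rewrite lt_neqAle t0 andbT negb_and negbK -ltNge.
  by move=> /orP[/eqP<-|/ltW]; [rewrite tau_s0|move=> /tau_s_ge1->].
- by rewrite notin_setE inE/= !in_itv/= andbT => /andP[/ltW->].
Qed.

Lemma integrable_tau_s : mu.-integrable (Rplus R) (EFin \o tau_s s k a b).
Proof.
suff i : mu.-integrable `]0, 1] (EFin \o tau_s s k a b).
  by rewrite integrable_mkcond// restrict_EFin tau_s_restrict -restrict_EFin -integrable_mkcond.
have i : mu.-integrable `]0, 1] (EFin \o (fun t => 1 + `|tau k a b t| `^ q)).
  apply: integrable_EFinD => //; last exact: integrable_tau_pow.
  apply: (@integrableS _ _ _ mu `[0, 1]) => //; first exact: subset_itv_oc_cc.
  by apply: continuous_compact_integrable; [exact: segment_compact|exact: cst_continuous].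
apply: integrable_EFin_le i _ _ => //.
- apply: measurable_funS measurable_tau_s => // t /=.
  by rewrite !in_itv/= andbT => /andP[/ltW].
- by move=> t _; exact: norm_sgn_pow_le.
Qed.

Lemma mul_tau_s t : tau_s s k a b t * tau k a b t = `|tau k a b t| `^ q.
Proof. exact: mul_sgn_pow. Qed.

Let tau_continuous x : 0 < x -> x != a -> x != 1 -> {for x, continuous (tau k a b)}.
Proof.
move=> x0 xa x1.
have cp : {for x, continuous (fun t : R => t `^ (1 - k))} by exact: continuous_powR.
have near_itv (f : R -> R) (P : set R) : nbhs x P -> P x ->
    (forall t, P t -> tau k a b t = f t) -> {for x, continuous f} ->
    {for x, continuous (tau k a b)}.
  move=> nP Px Pf cf; rewrite /prop_for /continuous_at Pf//.
  by apply: cvg_trans cf; apply: near_eq_cvg; apply: filterS nP => t /Pf.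
have pos : \forall t \near x, 0 < t by exact: lt_nbhsr.
case: (ltgtP x a) xa => // xa _.
  apply: (near_itv (fun t => t `^ (1 - k) - slope1 k a b * t) [set t | 0 < t < a]).
  - by near=> t; apply/andP; split; near: t; [exact: lt_nbhsr|exact: lt_nbhsl].
  - by rewrite /= x0 xa.
  - by move=> t /= /andP[t0 ta]; rewrite (tauE k1 abM (ltW t0)) (ltW ta).
  - by apply: cvgB => //; apply: cvgM; [exact: cvg_cst|exact: cvg_id].
case: (ltgtP x 1) x1 => // x1 _.
  apply: (near_itv (fun t => t `^ (1 - k) - (1 - slope2 k b * (1 - t))) [set t | a < t < 1]).
  - by near=> t; apply/andP; split; near: t; [exact: lt_nbhsr|exact: lt_nbhsl].
  - by rewrite /= x1 xa.
  - move=> t /= /andP[ta t1].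
    by rewrite (tauE k1 abM (ltW (lt_trans a0 ta))) (lt_geF ta) (ltW t1).
  - apply: cvgB => //; apply: cvgB; first exact: cvg_cst.
    by apply: cvgM; [exact: cvg_cst|apply: cvgB; [exact: cvg_cst|exact: cvg_id]].
apply: (near_itv (cst 0) [set t | 1 < t]) => //.
- by near=> t; near: t; exact: lt_nbhsr.
- by move=> t /= /ltW/(tau_ge1 k1 abM).
- exact: cvg_cst.
Unshelve. all: by end_near. Qed.

(** The formula for [tau] changes at [a] and 1, and [tau] vanishes at [b], where the signed power
    may jump. *)
Lemma tau_s_continuous x : 0 < x -> x != a -> x != b -> x != 1 ->
  {for x, continuous (tau_s s k a b)}.
Proof.
move=> x0 xa xb x1; have ct := tau_continuous x0 xa x1.
have [x1'|x1'] := ltP 1 x.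
  rewrite /prop_for /continuous_at tau_s_ge1 ?ltW//.
  apply: cvg_near_cst; near=> t; apply/eqP.
  by rewrite tau_s_ge1// ltW//; near: t; exact: lt_nbhsr.
apply: continuous_comp => //; apply: sgn_pow_continuous.
case: (ltgtP x b) xb => // xb _; first by rewrite gt_eqF// (tau_gt0 k1 abM)// x0.
by rewrite lt_eqF// (tau_lt0 k1 abM)// xb lt_neqAle x1.
Unshelve. all: by end_near. Qed.

End TauIntegrable.

Section PositiveIntegral.
Context {R : realType}.
Notation mu := (@lebesgue_measure R).

Lemma Rintegral_gt0 (D : set R) (f : R -> R) c d : measurable D -> c < d ->
  mu.-integrable D (EFin \o f) -> (forall t, D t -> 0 <= f t) ->
  `]c, d[ `<=` D -> (forall t, c < t < d -> 0 < f t) ->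
  0 < \int[mu]_(t in D) f t.
Proof.
move=> mD cd intf f0 sub fpos.
rewrite lt_neqAle Rintegral_ge0// andbT; apply/eqP => I0.
have mf : measurable_fun D (EFin \o f) by case/integrableP : (intf).
have : (\int[mu]_(t in D) `|(EFin \o f) t| = 0)%E.
  transitivity (\int[mu]_(t in D) (f t)%:E)%E.
    by apply: eq_integral => t /set_mem Dt /=; rewrite ger0_norm// f0.
  rewrite -[LHS]fineK; first by rewrite -[fine _]/(Rintegral _ _ _) -I0.
  exact: integrable_fin_num.
move=> /(ae_eq_integral_abs mu mD mf)[A [mA A0 subA]].
have sA : `]c, d[%classic `<=` A.
  move=> t tcd; apply: subA => /= /(_ (sub _ tcd)) /= [] f0'.
  by move: tcd => /=; rewrite in_itv/= => /fpos; rewrite f0' ltxx.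
have : (mu `]c, d[ <= 0)%E by rewrite -A0; apply: le_measure; rewrite ?inE.
by rewrite lebesgue_measure_itv/= lte_fin cd -EFinD lee_fin leNgt subr_gt0 cd.
Qed.

End PositiveIntegral.

Section TauNorm.
Context {R : realType}.
Notation mu := (@lebesgue_measure R).
Variables (s : \bar R) (k a b : R).
Hypotheses (s1 : (1 < s)%E) (k1 : 1 < k) (k2 : k < 2 - inv_exp s) (abM : in_M a b).

Let q := conj_exp s.
Let q0 : 0 < q. Proof. exact: conj_exp_gt0. Qed.

(** With T for this number, [tau] has norm T^(1 - 1/s) in the conjugate space and [tau_s] has norm
    T^(1/s); their product T is the integral of [tau_s * tau], the equality case of Holder's
    inequality. *)
Definition tau_pow_int : R := \int[mu]_(t in `]0, 1]) (`|tau k a b t| `^ conj_exp s).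

Lemma tau_pow_int_gt0 : 0 < tau_pow_int.
Proof.
have [/andP[a0 a1] /andP[b0 b1] ab] := abM.
apply: (@Rintegral_gt0 _ _ _ 0 a) => //.
- exact: integrable_tau_pow.
- by move=> t /=; rewrite !in_itv/= => /andP[-> ta]; rewrite (ltW (lt_trans ta a1)).
- move=> t /andP[t0 ta]; rewrite powR_gt0// normr_gt0 gt_eqF// (tau_gt0 k1 abM) ?lt_eqF//.
  by rewrite t0 (lt_le_trans ta).
Qed.

(** For finite [s] it rests on (q - 1) s = q; for [s = +oo] the right side is 1 and [tau_s] is a
    sign. The converse inequality is left to [normRp_tau_sE]. *)
Lemma normRp_tau_s : (normRp s (tau_s s k a b) <= (tau_pow_int `^ inv_exp s)%:E)%E.
Proof.
have [[r sE]|sE] : (exists r, s = r%:E) \/ s = +oo%E.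
    by move: s1; case: (s) => [r||]// _; [left; exists r|right].
  have r1 : 1 < r by rewrite -lte_fin -sE.
  have r0 : 0 < r by rewrite (lt_trans ltr01).
  have qr : (q - 1) * r = q.
    rewrite /q conj_expE// sE /inv_exp inver gt_eqF//=; field.
    by rewrite gt_eqF//= subr_eq0 gt_eqF.
  have E t : `|tau_s s k a b t| `^ r = `|tau k a b t| `^ q.
    rewrite /tau_s; have [->|t0] := eqVneq (tau k a b t) 0.
      by rewrite sgn_pow0 !normr0 !powR0 ?gt_eqF.
    by rewrite norm_sgn_pow// -powRrM qr.
  have -> : inv_exp s = r^-1 by rewrite sE /inv_exp inver gt_eqF.
  rewrite [X in normRp X _]sE normRp_fin// le_eqVlt; apply/orP; left; apply/eqP.
  rewrite -poweR_EFin; congr (_ `^ _)%E.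
  transitivity (\int[mu]_(t in `]0%R, 1%R]) (`|tau k a b t| `^ q)%:E)%E; last first.
    by rewrite /tau_pow_int/Rintegral fineK//; apply: integrable_fin_num => //; exact: integrable_tau_pow.
  rewrite [LHS]integral_mkcond [RHS]integral_mkcond; apply: eq_integral => t _.
  have := congr1 (fun f => f t) (tau_s_restrict s k1 abM); rewrite !patchE.
  case: ifPn => _; case: ifPn => _ // wE; first by rewrite E.
    by rewrite wE /point/= normr0 powR0// gt_eqF.
  by rewrite -E -wE /point/= normr0 powR0// gt_eqF.
have sg0 : inv_exp s = 0 by rewrite /inv_exp sE invey.
rewrite sg0 powRr0 [X in normRp X _]sE; apply: normRpoo_le => //.
apply: aeW => t _; rewrite /tau_s; have [->|t0] := eqVneq (tau k a b t) 0.
  by rewrite sgn_pow0 normr0.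
by rewrite norm_sgn_pow// -/q /q conj_expE// sg0 subr0 invr1 subrr powRr0.
Qed.

End TauNorm.

(** * The sharp bound at a point *)

Lemma norm_sum5_le {R : realDomainType} (y1 y2 y3 y4 y5 c1 c2 c3 c4 c5 : R) :
  `|y1| <= c1 -> `|y2| <= c2 -> `|y3| <= c3 -> `|y4| <= c4 -> `|y5| <= c5 ->
  `|y1 + y2 - y3 + y4 + y5| <= c1 + c2 + c3 + c4 + c5.
Proof.
move=> h1 h2 h3 h4 h5; do 2!apply: le_trans (ler_normD _ _) (lerD _ _) => //.
by apply: le_trans (ler_normB _ _) (lerD _ _) => //; apply: le_trans (ler_normD _ _) (lerD _ _).
Qed.

Definition taylor_integral {R : realType} (k : R) (f : R -> R) (x : R) : R :=
  \int[@lebesgue_measure R]_(t in `]0, +oo[) ((f (x + t) - f x - t * dRp f x) / t `^ (1 + k)).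

Section Remainder.
Context {R : realType}.
Notation mu := (@lebesgue_measure R).
Variables (s : \bar R) (k : R) (f : R -> R).
Hypotheses (s1 : (1 < s)%E) (k1 : 1 < k) (k2 : k < 2 - inv_exp s).
Hypothesis Lf : L2_infty s f.

Let df : derivable_Rp f. Proof. by case: Lf. Qed.
Let acf : loc_abs_cont_Rp (dRp f). Proof. by case: Lf. Qed.
Let mW : measurable_fun (Rplus R) (dRp (dRp f)). Proof. by case: Lf => _ _ _ []. Qed.
Let NW : (normRp s (dRp (dRp f)) < +oo)%E. Proof. by case: Lf => _ _ _ []. Qed.
Let mf : measurable_fun (Rplus R) f. Proof. by case: Lf => -[]. Qed.
Let Nf : (normRp +oo f < +oo)%E. Proof. by case: Lf => -[]. Qed.
Notation W := (dRp (dRp f)).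
Let iW c : 0 <= c -> mu.-integrable `[0, c] (EFin \o W).
Proof. exact: integrable_dRp2. Qed.

Lemma L2_infty_right_continuous x : 0 <= x -> f @ x^'+ --> f x.
Proof.
rewrite le_eqVlt => /predU1P[<-|x0].
  by apply: derivable_Rp_right_continuous; case: df.
apply: cvg_at_right_filter; apply: differentiable_continuous.
by apply/derivable1_diffP; exact: df.1.
Qed.

Lemma norm_le_normRpoo x : 0 <= x -> `|f x| <= fine (normRp +oo f).
Proof.
move=> x0; rewrite -lee_fin fineK; last by rewrite ge0_fin_numE// normRp_ge0.
exact: right_continuous_normRpoo (L2_infty_right_continuous x0).
Qed.

Lemma taylor_rest x y : 0 <= x -> x <= y ->
  f y - f x - (y - x) * dRp f x = \int[mu]_(t in `]x, y]) ((y - t) * W t).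
Proof.
move=> x0 xy; have y0 := le_trans x0 xy.
have xy' : 0 <= x <= y by rewrite x0.
rewrite -(prim2_right iW xy') (taylor_dRp df acf mW y0) (taylor_dRp df acf mW x0).
by rewrite (dRp_prim1 acf mW x0); ring.
Qed.

Section dilated.
Variables (x h : R).
Hypotheses (x0 : 0 <= x) (h0 : 0 < h).
Let w u := h ^+ 2 * W (x + h * u).

Let mw : measurable_fun (Rplus R) w.
Proof.
have mx : measurable_fun `[x, +oo[ W.
  by apply: measurable_funS mW => // t /=; rewrite !in_itv/= !andbT; exact: le_trans.
have := measurable_fun_affine (x := x) (h := h) _ mx.
by rewrite (affine_preimage_itvcy x h0) => m; exact: measurable_funM (measurable_cst _) (m _).
Qed.

Let iw c : 0 <= c -> mu.-integrable `[0, c] (EFin \o w).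
Proof.
move=> c0; apply: integrable_EFinZl => //.
have i : mu.-integrable `[x, x + h * c] (EFin \o W).
  have : 0 <= x + h * c by rewrite addr_ge0// mulr_ge0// ltW.
  move=> /iW; apply: integrableS => // t /=; rewrite !in_itv/= => /andP[xt ->].
  by rewrite (le_trans x0).
have := integrable_affine x h0 _ i.
by rewrite (affine_preimage_itvcc x h0 c) => i'; exact: i'.
Qed.

Lemma taylor_dilated u : 0 <= u ->
  f (x + h * u) = f (x + h * 0) + u * (h * dRp f x) + prim2 w u.
Proof.
move=> u0; have xu : x <= x + h * u by rewrite lerDl mulr_ge0// ltW.
have := taylor_rest x0 xu.
have xu0 : 0 <= x + h * u := le_trans x0 xu.
have i : mu.-integrable `[x, x + h * u] (EFin \o (fun t => (x + h * u - t) * W t)).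
  apply: (@integrable_mul_itv _ _ _ x (x + h * u) (fun t => x + h * u - t)) => //.
    apply: integrableS (iW xu0) => // t /=.
    by rewrite !in_itv/= => /andP[xt ->]; rewrite (le_trans x0).
  by move=> t; apply: cvgB; [exact: cvg_cst|exact: cvg_id].
rewrite Rintegral_itv_obnd_cbnd//; last first.
  by apply: integrableS i => //; exact: subset_itv_oc_cc.
rewrite (Rintegral_affine x h0 _ i)// (affine_preimage_itvcc x h0 u) => E.
rewrite mulr0 addr0 /prim2.
have E2 t : (u - t) * w t = h * ((x + h * u - (x + h * t)) * W (x + h * t)).
  by rewrite /w; ring.
under [in RHS]eq_Rintegral do rewrite E2.
have i1 := integrable_affine x h0 _ i.
rewrite (affine_preimage_itvcc x h0 u) in i1.
rewrite RintegralZl; [by rewrite -E; ring|exact: measurable_itv|exact: i1].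
Qed.

Let normf_le t : 0 <= t -> `|f (x + h * t)| <= fine (normRp +oo f).
Proof. by move=> t0; rewrite norm_le_normRpoo// addr_ge0// mulr_ge0// ltW. Qed.

Let mg : measurable_fun (Rplus R) (fun t => f (x + h * t)).
Proof.
have mx : measurable_fun `[x, +oo[ f.
  by apply: measurable_funS mf => // t /=; rewrite !in_itv/= !andbT; exact: le_trans.
have := measurable_fun_affine (x := x) (h := h) _ mx.
by rewrite (affine_preimage_itvcy x h0) => m; exact: m.
Qed.

Variables (a b : R).
Hypothesis abM : in_M a b.
Notation q := (conj_exp s).
Notation T := (tau_pow_int s k a b).
Notation N := (fine (normRp s W)).

(** Holder's inequality is applied on []x, x + h]] to [W] and to [v], the function [tau] carried
    there. Of the factor [h ^+ 2] one power is absorbed by the change of variable, and the integral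
    [h * T] of |v|^q contributes h^(1 - 1/s), in total h^(2 - 1/s). *)
Let hoelder_dilated : mu.-integrable `]0, 1] (EFin \o (fun u => w u * tau k a b u)) /\
  `|\int[mu]_(u in `]0, 1]) (w u * tau k a b u)| <=
  h `^ (2 - inv_exp s) * (N * T `^ (1 - inv_exp s)).
Proof.
have hn0 : h != 0 by rewrite gt_eqF.
have hV0 : 0 < h^-1 by rewrite invr_gt0.
pose v y := tau k a b (- x / h + h^-1 * y).
have vE u : v (x + h * u) = tau k a b u by rewrite /v; congr tau; field.
have pre : (fun t : R => (- x / h + h^-1 * t)%R) @^-1` `]0, 1]%classic = `]x, x + h]%classic.
  have e0 : - x / h + h^-1 * x = 0 by field.
  have e1 : - x / h + h^-1 * (x + h) = 1 by field.
  by rewrite -(affine_preimage_itvoc (- x / h) hV0 x (x + h)) e0 e1.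
have pre' : (fun t : R => (x + h * t)%R) @^-1` `]x, x + h]%classic = `]0, 1]%classic.
  by rewrite -(affine_preimage_itvoc x h0 0 1) mulr0 mulr1 addr0.
have mtau : measurable_fun (`]0, 1] : set R) (tau k a b).
  apply: measurable_funS (measurable_tau k1 abM) => // t /=.
  by rewrite !in_itv/= andbT => /andP[/ltW].
have mv : measurable_fun `]x, x + h] v.
  have := measurable_fun_affine (x := - x / h) (h := h^-1) _ mtau.
  by rewrite pre => m; exact: m.
have iT := integrable_tau_pow s1 k1 k2 abM.
have iv : mu.-integrable `]x, x + h] (EFin \o (fun y => `|v y| `^ q)).
  have := integrable_affine (- x / h) hV0 _ iT.
  by rewrite pre => i; exact: i.
have ivE : \int[mu]_(y in `]x, x + h]) `|v y| `^ q = h * T.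
  have := Rintegral_affine (- x / h) hV0 _ iT; rewrite pre => /(_ _)e.
  by rewrite /tau_pow_int e// mulrA mulfV// mul1r.
have sub : `]x, x + h]%classic `<=` Rplus R.
  by move=> t /=; rewrite !in_itv/= andbT => /andP[/ltW/(le_trans x0)].
have iWv := hoelder_integrable s1 mW NW _ sub mv iv.
have hWv := hoelder_le s1 mW NW _ sub mv iv.
have E u : w u * tau k a b u = h ^+ 2 * (W (x + h * u) * v (x + h * u)).
  by rewrite vE mulrA.
have i1 : mu.-integrable `]0, 1] (EFin \o (fun u => W (x + h * u) * v (x + h * u))).
  have := integrable_affine x h0 _ (iWv _); rewrite pre' => i; exact: i.
split.
  have i2 : mu.-integrable `]0, 1] (EFin \o (fun u => h ^+ 2 * (W (x + h * u) * v (x + h * u)))).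
    exact: integrable_EFinZl.
  by apply: eq_integrable i2 => // t _ /=; rewrite E.
under eq_Rintegral do rewrite E.
rewrite RintegralZl//.
have e2 := Rintegral_affine x h0 _ (iWv _); rewrite pre' in e2.
have -> : h ^+ 2 * \int[mu]_(u in `]0, 1]) (W (x + h * u) * v (x + h * u)) =
    h * \int[mu]_(y in `]x, x + h]) (W y * v y).
  by rewrite e2// mulrA -expr2.
rewrite normrM (gtr0_norm h0).
have T0 : 0 < T by exact: tau_pow_int_gt0.
have -> : h `^ (2 - inv_exp s) = h * h `^ (1 - inv_exp s).
  rewrite (_ : 2 - inv_exp s = 1 + (1 - inv_exp s)); last by ring.
  by rewrite powRD ?powRr1 ?(ltW h0)//; apply/implyP => _.
rewrite -mulrA ler_pM2l// mulrCA -powRM ?(ltW h0) ?(ltW T0)// -ivE.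
exact: hWv.
Qed.

Let g u := f (x + h * u).

(** By the signs of the slopes the moduli of the coefficients of [f] add up to slope1 + (slope1 -
    slope2) - (slope2 + k - 1) + (k - 1), that is, to 2 (slope1 - slope2). *)
Lemma remainder_integral_dilated :
  mu.-integrable `]0, +oo[ (EFin \o remainder k g (h * dRp f x)) /\
  `|k * (k - 1) * \int[mu]_(t in `]0, +oo[) remainder k g (h * dRp f x) t| <=
  h `^ (2 - inv_exp s) * (N * T `^ (1 - inv_exp s)) +
  2 * (slope1 k a b - slope2 k b) * fine (normRp +oo f).
Proof.
have [iwt hwt] := hoelder_dilated.
have [/andP[a0 a1] _ _] := abM; have a01 : 0 < a < 1 by rewrite a0.
have tE u : 0 < u <= 1 -> tau k a b u = u `^ (1 - k) -
    (if u <= a then slope1 k a b * u else 1 - slope2 k b * (1 - u)).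
  by move=> /andP[u0 u1]; rewrite (tauE k1 abM (ltW u0)) u1; case: ifP.
have [i e] := remainder_integral_tau k1 mg normf_le mw iw taylor_dilated a01
  (slope_balance k abM) tE iwt.
split => //; rewrite e.
have [_ ht] := bounded_tail k1 mg normf_le.
set M := fine (normRp +oo f) in ht *.
have g0 : `|g 0| <= M by exact: normf_le.
have ga : `|g a| <= M by exact/normf_le/ltW.
have g1 : `|g 1| <= M by exact: normf_le.
have s10 := slope1_gt0 k1 abM; have s2k := slope2_lt k1 abM; have s20 := slope2_lt0 k1 abM.
have k0 : 0 < k by exact: lt_trans k1.
have kk : 0 < k * (k - 1) by rewrite mulr_gt0// subr_gt0.
rewrite -(ler_pM2l kk) in ht.
have : k * (k - 1) * (M / k) = (k - 1) * M by field; rewrite gt_eqF.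
move: ht; set I := \int[mu]_(t in `[1, +oo[) _ => ht kE; rewrite kE in ht.
have step c y : 0 <= c -> `|y| <= M -> `|c * y| <= c * M.
  by move=> c0 yM; rewrite normrM ger0_norm// ler_wpM2l.
have h1 := step _ _ (ltW s10) g0.
have h2 : `|(slope1 k a b - slope2 k b) * g a| <= (slope1 k a b - slope2 k b) * M.
  by apply: step ga; rewrite subr_ge0 (le_trans (ltW s20))// ltW.
have h3 : `|- (slope2 k b + (k - 1)) * g 1| <= - (slope2 k b + (k - 1)) * M.
  by apply: step g1; rewrite oppr_ge0 ltW.
have h4 : `|k * (k - 1) * I| <= (k - 1) * M by rewrite normrM gtr0_norm.
move: hwt; set J := \int[mu]_(u in `]0, 1]) _ => hwt.
rewrite [X in `|X|](_ : _ = J + (slope1 k a b * g 0) - ((slope1 k a b - slope2 k b) * g a)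
  + (- (slope2 k b + (k - 1)) * g 1) + k * (k - 1) * I); last by rewrite /g; ring.
apply: le_trans (norm_sum5_le hwt h1 h2 h3 h4) _.
by rewrite le_eqVlt; apply/orP; left; apply/eqP; ring.
Qed.

End dilated.

Section taylor_integral.
Variables (a b x : R).
Hypotheses (abM : in_M a b) (x0 : 0 <= x).

Lemma integrable_taylor : mu.-integrable `]0, +oo[
  (EFin \o (fun t => (f (x + t) - f x - t * dRp f x) / t `^ (1 + k))).
Proof.
have [i _] := remainder_integral_dilated x0 ltr01 abM.
by apply: eq_integrable i => // t _ /=; rewrite /remainder mulr0 addr0 !mul1r.
Qed.

Lemma taylor_integral_dilated h : 0 < h ->
  \int[mu]_(t in `]0, +oo[) ((f (x + h * t) - f x - t * (h * dRp f x)) / t `^ (1 + k)) =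
  h `^ k * taylor_integral k f x.
Proof.
move=> h0; have e := Rintegral_affine 0 h0 _ integrable_taylor.
have pre := @affine_preimage_itvoy _ 0 h h0; rewrite pre in e.
have E t : 0 < t -> (f (x + h * t) - f x - t * (h * dRp f x)) / t `^ (1 + k) =
    h `^ (1 + k) * ((f (x + (0 + h * t)) - f x - (0 + h * t) * dRp f x) / (0 + h * t) `^ (1 + k)).
  move=> t0; rewrite add0r powRM ?(ltW t0) ?(ltW h0)//; field.
  by rewrite !gt_eqF// powR_gt0.
rewrite (@eq_Rintegral _ _ _ mu _ (fun t => h `^ (1 + k) *
    ((f (x + (0 + h * t)) - f x - (0 + h * t) * dRp f x) / (0 + h * t) `^ (1 + k)))); last first.
  by move=> t /set_mem/=; rewrite in_itv/= andbT => /E.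
have i := integrable_affine 0 h0 _ integrable_taylor; rewrite pre in i.
rewrite RintegralZl; [|exact: measurable_itv|exact: i].
rewrite /taylor_integral e// mulrA powRD; last by apply/implyP => _; rewrite gt_eqF.
by rewrite powRr1 ?(ltW h0)//; ring.
Qed.

Lemma taylor_integral_le h : 0 < h ->
  k * (k - 1) * (h `^ k * `|taylor_integral k f x|) <=
  h `^ (2 - inv_exp s) * (fine (normRp s W) * tau_pow_int s k a b `^ (1 - inv_exp s)) +
  2 * (slope1 k a b - slope2 k b) * fine (normRp +oo f).
Proof.
move=> h0; have [_] := remainder_integral_dilated x0 h0 abM.
apply: le_trans; rewrite /remainder mulr0 addr0 taylor_integral_dilated//.
have kk : 0 < k * (k - 1) by rewrite mulr_gt0 ?subr_gt0// (lt_trans ltr01).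
by rewrite !normrM -normrM (gtr0_norm kk) (gtr0_norm (powR_gt0 _ h0)).
Qed.

End taylor_integral.
(** Holder's inequality with the crude bound [t] for the factor [x + t - y]; it yields (t^q t)^(1 -
    1/s) = t^(2 - 1/s), uniformly in [x]. *)
Lemma taylor_rest_le x t : 0 <= x -> 0 < t ->
  `|f (x + t) - f x - t * dRp f x| <= fine (normRp s W) * t `^ (2 - inv_exp s).
Proof.
move=> x0 t0; have xt : x <= x + t by rewrite lerDl ltW.
have xt0 : 0 <= x + t := le_trans x0 xt.
have sub : `]x, x + t]%classic `<=` Rplus R.
  by move=> u /=; rewrite !in_itv/= andbT => /andP[/ltW/(le_trans x0)].
set q := conj_exp s; have q0 : 0 < q by exact: conj_exp_gt0.
have ic : mu.-integrable `]x, x + t] (EFin \o cst (t `^ q)).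
  have j : mu.-integrable `[x, x + t] (EFin \o cst (t `^ q)).
    by apply: continuous_compact_integrable; [exact: segment_compact|exact: cst_continuous].
  by apply: integrableS j => //; exact: subset_itv_oc_cc.
pose v y := x + t - y.
have mv : measurable_fun (`]x, x + t] : set R) v by exact: measurable_funB.
have vt y : `]x, x + t]%classic y -> `|v y| `^ q <= t `^ q.
  rewrite /= in_itv/= => /andP[xy yt].
  have vy : `|v y| <= t.
    by rewrite /v ger0_norm ?subr_ge0// lerBlDr [t + y]addrC lerD2r ltW.
  by apply: ge0_ler_powR; rewrite ?nnegrE ?(ltW q0) ?(ltW t0).
have iv : mu.-integrable `]x, x + t] (EFin \o (fun y => `|v y| `^ q)).
  apply: integrable_EFin_le ic _ _ => //.
    by apply: (measurableT_comp (measurable_powR q)); exact: measurableT_comp.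
  by move=> y yx; rewrite [leLHS]ger0_norm ?powR_ge0//; exact: vt.
have vle : \int[mu]_(y in `]x, x + t]) `|v y| `^ q <= t `^ q * t.
  apply: (@le_trans _ _ (\int[mu]_(y in `]x, x + t]) cst (t `^ q) y)).
    exact: le_Rintegral.
  rewrite Rintegral_cst//= lebesgue_measure_itv/= lte_fin ltrDl t0 -EFinD/=.
  by rewrite addrAC subrr add0r.
have h := hoelder_le s1 mW NW _ sub mv iv.
have := taylor_rest x0 xt; rewrite [x + t - x]addrAC subrr add0r => ->.
under eq_Rintegral do rewrite mulrC.
apply: (le_trans (h _)) => //.
rewrite ler_wpM2l ?fine_ge0 ?normRp_ge0//.
have /andP[_ sg1] := inv_exp_itv s1.
have sg10 : 0 <= 1 - inv_exp s by rewrite subr_ge0 ltW.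
apply: (@le_trans _ _ ((t `^ q * t) `^ (1 - inv_exp s))).
  by apply: ge0_ler_powR; rewrite ?nnegrE ?mulr_ge0 ?powR_ge0 ?(ltW t0) ?Rintegral_ge0.
have qE : q * (1 - inv_exp s) = 1.
  by rewrite /q conj_expE// mulVf// subr_eq0 gt_eqF.
rewrite powRM ?powR_ge0 ?(ltW t0)// -powRrM qE -powRD; last by apply/implyP => _; rewrite gt_eqF.
by rewrite addrA.
Qed.

(** A Landau inequality with unit step: the derivative is an increment of [f] minus a Taylor
    remainder. It controls the linear term of the remainder for large [t]. *)
Lemma norm_dRp_le x : 0 <= x ->
  `|dRp f x| <= 2 * fine (normRp +oo f) + fine (normRp s W).
Proof.
move=> x0; have := taylor_rest_le x0 ltr01; rewrite powR1 mulr1 mul1r => h.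
have x10 : 0 <= x + 1 by rewrite addr_ge0.
have h1 := norm_le_normRpoo x10; have h0 := norm_le_normRpoo x0.
rewrite (_ : dRp f x = (f (x + 1) - f x) - (f (x + 1) - f x - dRp f x)); last by ring.
apply: le_trans (ler_normB _ _) (lerD _ h).
by apply: le_trans (ler_normB _ _) _; rewrite [2 * _]mulr_natl mulr2n lerD.
Qed.

Let dRp_right_continuous0 : dRp f @ 0^'+ --> dRp f 0.
Proof.
apply/cvgrPdist_lt => e e0; have [d d0 H] := acf ltr01 e0.
near=> t; have t0 : 0 < t by near: t; exact: nbhs_right_gt.
have t1 : t <= 1 by near: t; exact: nbhs_right_le.
have td : t < d by near: t; exact: nbhs_right_lt.
have := H [:: (0, t)]; rewrite /= !big_cons !big_nil/= !addr0 subr0 distrC.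
by move=> H'; apply: H' => //; rewrite lexx t0 t1.
Unshelve. all: by end_near. Qed.

(** A bound independent of [x]. Near 0 the exponent is (2 - 1/s) - (1 + k), above -1 by [k2]; past 1
    the terms of the remainder are bounded separately, with exponents below -1. *)
Let dominator t := if t <= 1 then fine (normRp s W) * t `^ (1 - inv_exp s - k)
  else 2 * fine (normRp +oo f) * t `^ (- (1 + k)) +
    (2 * fine (normRp +oo f) + fine (normRp s W)) * t `^ (- k).

Let integrable_dominator : mu.-integrable `]0, +oo[ (EFin \o dominator).
Proof.
have i1 : mu.-integrable `]0, 1] (EFin \o dominator).
  have i : mu.-integrable `]0, 1] (EFin \o (fun t => fine (normRp s W) * t `^ (1 - inv_exp s - k))).
    by apply: integrable_EFinZl => //; apply: integrable_powR01; have := k2; lra.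
  apply: eq_integrable i => // t /set_mem/=.
  by rewrite in_itv/= /dominator => /andP[_ ->].
have i2 : mu.-integrable `]1, +oo[ (EFin \o dominator).
  have i : mu.-integrable `[1, +oo[ (EFin \o (fun t => 2 * fine (normRp +oo f) * t `^ (- (1 + k)) +
      (2 * fine (normRp +oo f) + fine (normRp s W)) * t `^ (- k))).
    apply: integrable_EFinD => //; apply: integrable_EFinZl => //.
      by apply: (Rintegral_powRy _).1; have := k1; lra.
    by apply: (Rintegral_powRy _).1; have := k1; lra.
  have i' : mu.-integrable `]1, +oo[ (EFin \o (fun t => 2 * fine (normRp +oo f) * t `^ (- (1 + k)) +
      (2 * fine (normRp +oo f) + fine (normRp s W)) * t `^ (- k))).
    apply: integrableS i => // t /=; rewrite !in_itv/= !andbT; exact: ltW.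
  apply: eq_integrable i' => // t /set_mem/=.
  by rewrite in_itv/= andbT /dominator => /lt_geF ->.
have U : `]0, +oo[%classic = `]0, 1]%classic `|` `]1, +oo[%classic :> set R.
  by rewrite -itv_bndbnd_setU// bnd_simp.
have dU : [disjoint `]0, 1]%classic & `]1, +oo[%classic : set R].
  apply/disj_setPS => t [/=]; rewrite !in_itv/= andbT => /andP[_ t1].
  by rewrite ltNge t1.
by rewrite U; exact: integrable_setU_disj.
Qed.

Let dominated x t : 0 <= x -> 0 < t ->
  `|(f (x + t) - f x - t * dRp f x) / t `^ (1 + k)| <= dominator t.
Proof.
move=> x0 t0; have tk : 0 < t `^ (1 + k) by exact: powR_gt0.
rewrite normrM [`|_^-1|]ger0_norm ?invr_ge0 ?(ltW tk)// /dominator.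
case: ifPn => [_|_].
  rewrite ler_pdivrMr// -mulrA -powRD; last by apply/implyP => _; rewrite gt_eqF.
  rewrite (_ : 1 - _ - k + (1 + k) = 2 - inv_exp s); last by ring.
  exact: taylor_rest_le.
rewrite ler_pdivrMr// mulrDl -!mulrA -!powRD; try by apply/implyP => _; rewrite gt_eqF.
rewrite addNr powRr0 mulr1 (_ : - k + (1 + k) = 1); last by ring.
rewrite powRr1 ?(ltW t0)//.
apply: le_trans (ler_normB _ _) _; apply: lerD.
  apply: le_trans (ler_normB _ _) _; rewrite [2 * _]mulr_natl mulr2n.
  by rewrite lerD ?norm_le_normRpoo// addr_ge0// ltW.
by rewrite normrM (gtr0_norm t0) mulrC ler_wpM2r ?(ltW t0)// norm_dRp_le.
Qed.

Lemma taylor_integral_right_continuous0 (a b : R) : in_M a b ->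
  taylor_integral k f @ 0^'+ --> taylor_integral k f 0.
Proof.
move=> abM; apply/cvg_at_rightP => u [u0 cu].
pose F x t := (f (x + t) - f x - t * dRp f x) / t `^ (1 + k).
have iF x : 0 <= x -> mu.-integrable `]0, +oo[ (EFin \o F x).
  by move=> x0; exact: integrable_taylor abM x0.
have cF t : 0 < t -> F (u n) t @[n --> \oo] --> F 0 t.
  move=> t0; apply: cvgM; last exact: cvg_cst.
  have seq0 (g : R -> R) : g @ 0^'+ --> g 0 -> g (u n) @[n --> \oo] --> g 0.
    by move=> /cvg_at_rightP; apply.
  apply: cvgB; last by apply: cvgM; [exact: cvg_cst|exact: seq0 dRp_right_continuous0].
  apply: cvgB; last by apply: seq0; exact: L2_infty_right_continuous.
  have /cvg_at_rightP := L2_infty_right_continuous (ltW t0).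
  move=> /(_ (fun n => u n + t)); rewrite add0r; apply; split.
    by move=> n; rewrite ltrDr.
  by rewrite -[X in _ --> X](add0r t); apply: cvgD => //; exact: cvg_cst.
have u0' n : 0 <= u n by exact: ltW.
have mF n : measurable_fun (`]0, +oo[ : set R) (EFin \o F (u n)) by case/integrableP : (iF _ (u0' n)).
have mF0 : measurable_fun (`]0, +oo[ : set R) (EFin \o F 0) by case/integrableP : (iF _ (lexx 0)).
have cE : {ae mu, forall t, `]0, +oo[%classic t ->
    (EFin \o F (u n)) t @[n --> \oo] --> (EFin \o F 0) t}.
  apply: aeW => t /=; rewrite in_itv/= andbT => t0.
  by apply: cvg_EFin; [near=> n|exact: cF].
have dE : {ae mu, forall t n, `]0, +oo[%classic t ->
    (`|(EFin \o F (u n)) t| <= (EFin \o dominator) t)%E}.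
  apply: aeW => t n /=; rewrite in_itv/= andbT => t0.
  by rewrite lee_fin dominated.
have [|_ _ c] := @dominated_convergence _ _ _ mu _ _ (fun n => EFin \o F (u n))
  _ _ mF mF0 cE integrable_dominator dE; first exact: measurable_itv.
apply: fine_cvg; rewrite /= /taylor_integral /Rintegral.
rewrite [X in _ --> X]fineK; first exact: c.
by apply: integrable_fin_num => //; exact: iF.
Unshelve. all: by end_near. Qed.

End Remainder.

(** * From the Marchaud derivative to the Taylor integral *)

Section MarchaudTaylor.
Context {R : realType}.
Notation mu := (@lebesgue_measure R).

Lemma alternating_binomial_sum n : (0 < n)%N ->
  \sum_(m < n.+1) (-1) ^+ m * 'C(n, m)%:R = 0 :> R.
Proof.
move=> n0; have := exprBn (1 : R) 1 n; rewrite subrr expr0n gtn_eqF//= => e; rewrite [RHS]e.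
by apply: eq_bigr => i _; rewrite !expr1n !mulr1 mulr_natr.
Qed.

Lemma alternating_binomial_moment n : (1 < n)%N ->
  \sum_(m < n.+1) (-1) ^+ m * 'C(n, m)%:R * m%:R = 0 :> R.
Proof.
case: n => [|n]// n0; rewrite big_ord_recl mulr0 add0r.
rewrite (eq_bigr (fun j : 'I_n.+1 => - n.+1%:R * ((-1) ^+ j * 'C(n, j)%:R))).
  by rewrite -mulr_sumr alternating_binomial_sum// mulr0.
move=> j _; rewrite /= /bump/= add1n -mulrA -natrM mulnC -mul_bin_diag natrM exprS/=.
by ring.
Qed.

(* The coefficients of the difference annihilate polynomials of degree one, so that
   each of its terms may be replaced by a Taylor remainder and then rescaled. *)
Lemma marchaud_taylor (s : \bar R) (k : R) (f : R -> R) (n : nat) (a b x : R) :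
  (1 < s)%E -> 1 < k -> k < 2 - inv_exp s -> L2_infty s f -> in_M a b ->
  k < n%:R -> 0 <= x ->
  marchaud n k f x = (varkappa k n)^-1 *
    (\sum_(m < n.+1) (-1) ^+ m * 'C(n, m)%:R * m%:R `^ k) * taylor_integral k f x.
Proof.
move=> s1 k1 k2 Lf abM kn x0; rewrite /marchaud -mulrA; congr (_ * _).
have n1 : (1 < n)%N by rewrite -(ltr_nat R) (lt_trans k1).
pose r (m : nat) t := (f (x + m%:R * t) - f x - t * (m%:R * dRp f x)) / t `^ (1 + k).
have ir m : mu.-integrable `]0, +oo[ (EFin \o r m) /\
    \int[mu]_(t in `]0, +oo[) r m t = m%:R `^ k * taylor_integral k f x.
  (* The rescaling requires a positive factor. For m = 0 the remainder vanishes identically, in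
     accordance with 0^k = 0. *)
  case: m => [|m].
    have E : r 0 = cst 0.
      by apply/funext => t; rewrite /r !mul0r addr0 mulr0 subrr subr0 mul0r.
    rewrite powR0 ?mul0r ?gt_eqF ?(lt_trans ltr01)// E.
    by split; [exact: integrable0|rewrite Rintegral_cst//= mul0r].
  have m0 : 0 < m.+1%:R :> R by rewrite ltr0n.
  split; last exact: (taylor_integral_dilated s1 k1 k2 Lf abM).
  have [i _] := remainder_integral_dilated s1 k1 k2 Lf x0 m0 abM.
  by apply: eq_integrable i => // t _; rewrite /= /remainder mulr0 addr0.
have E t : fdiff n t f x / t `^ (1 + k) =
    \sum_(m < n.+1) (-1) ^+ m * 'C(n, m)%:R * r m t.
  under [RHS]eq_bigr do rewrite /r [_ * (_ / _)]mulrA.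
  rewrite -mulr_suml; congr (_ / _).
  rewrite [RHS](eq_bigr (fun m : 'I_n.+1 => (-1) ^+ m * 'C(n, m)%:R * f (x + m%:R * t) -
      ((-1) ^+ m * 'C(n, m)%:R * f x + (-1) ^+ m * 'C(n, m)%:R * m%:R * (t * dRp f x)))); last first.
    by move=> m _; ring.
  rewrite big_split/= sumrN big_split/= -!mulr_suml.
  by rewrite alternating_binomial_sum ?(ltn_trans _ n1)// alternating_binomial_moment// !mul0r addr0 subr0.
under eq_Rintegral do rewrite E.
have ic (m : nat) (c : R) : mu.-integrable `]0, +oo[ (EFin \o (fun t => c * r m t)).
  by apply: integrable_EFinZl => //; exact: (ir m).1.
rewrite /Rintegral; under eq_integral do rewrite -sumEFin.
rewrite integral_sum//; last by move=> m; exact: ic.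
rewrite (eq_bigr (fun m : 'I_n.+1 => ((-1) ^+ m * 'C(n, m)%:R *
    (m%:R `^ k * taylor_integral k f x))%:E)).
  by rewrite sumEFin/= mulr_suml; apply: eq_bigr => m _; rewrite mulrA.
move=> m _; have [i e] := ir m; rewrite -e -RintegralZl// /Rintegral fineK//.
by apply: integrable_fin_num => //; exact: ic.
Qed.

End MarchaudTaylor.

(** * The extremal function *)

Section MeasurableOffFinite.
Context {R : realType}.

(** Every subset of a finite set is measurable. This serves for the second derivative of [phi],
    which is identified only off 0, [a], [b] and 1. *)
Lemma measurable_off_finite (D : set R) (F : seq R) (f g : R -> R) : measurable D ->
  measurable_fun D g -> (forall x, D x -> x \notin F -> f x = g x) ->
  measurable_fun D f.
Proof.
move=> mD mg fg.
have cF (A : set R) : A `<=` [set` F] -> measurable A.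
  move=> AF; apply: countable_measurable => [t|]; first exact: measurable_set1.
  by apply: finite_set_countable; apply: sub_finite_set AF _; exact: finite_seq.
have -> : D = (D `\` [set` F]) `|` (D `&` [set` F]) by rewrite setUC setUIDK.
have mF := cF _ (@subset_refl _ _).
apply/measurable_funU; [exact: measurableD|exact: measurableI|split].
  apply: (eq_measurable_fun g); last by apply: measurable_funS mg => // x [].
  by move=> x /set_mem[Dx /negP xF]; rewrite fg.
by move=> _ Y mY; apply: cF => x [[]].
Qed.

End MeasurableOffFinite.

Section SecondPrimitive.
Context {R : realType}.
Notation mu := (@lebesgue_measure R).
Variables (w f : R -> R) (p0 p1 : R).
Hypothesis iw : forall c, 0 <= c -> mu.-integrable `[0, c] (EFin \o w).
Hypothesis fE : forall x, f x = p0 + x * p1 + prim2 w x.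

Let f_fun : f = (fun x => p0 + x * p1 + prim2 w x).
Proof. exact/funext. Qed.

Lemma is_derive_second_prim (x : R) : 0 < x -> is_derive x 1 f (p1 + prim1 w x).
Proof.
move=> x0; have [d D] := derivable_prim2 iw x0; rewrite derive1E in D.
have i : is_derive x 1 (prim2 w) (prim1 w x) by apply: DeriveDef.
rewrite f_fun; apply: is_derive_eq.
by rewrite scaler0 !add0r mul1r -[_ *: _]/(_ * _) mulr1.
Qed.

Lemma right_quot_second_prim : right_quot f 0 @ 0^'+ --> p1.
Proof.
have c0 := right_quot_prim2 iw (lexx 0).
have -> : p1 = p1 + prim1 w 0 by rewrite /prim1 set_itv1 Rintegral_set1 addr0.
have c1 : p1 + right_quot (prim2 w) 0 h @[h --> 0^'+] --> p1 + prim1 w 0.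
  by apply: cvgD => //; exact: cvg_cst.
apply: cvg_trans c1; apply: near_eq_cvg; near=> h.
have h0 : 0 < h by near: h; exact: nbhs_right_gt.
by rewrite /right_quot !fE; field; rewrite gt_eqF.
Unshelve. all: by end_near. Qed.

Lemma derivable_second_prim : derivable_Rp f.
Proof.
split; last by apply/cvg_ex; exists p1; exact: right_quot_second_prim.
by move=> x x0; have [] := is_derive_second_prim x0.
Qed.

Lemma dRp_second_prim (x : R) : 0 <= x -> dRp f x = p1 + prim1 w x.
Proof.
rewrite le_eqVlt /dRp => /predU1P[<-|x0].
  rewrite ltxx /prim1 set_itv1 Rintegral_set1 addr0.
  by apply/cvg_lim => //; exact: right_quot_second_prim.
by rewrite x0 derive1E; have [_ ->] := is_derive_second_prim x0.
Qed.

Lemma dRp2_second_prim (x : R) : 0 < x -> {for x, continuous w} -> dRp (dRp f) x = w x.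
Proof.
move=> x0 cw; rewrite {1}/dRp x0.
have x1 : x < x + 1 by rewrite ltrDl.
have x10 : 0 <= x + 1 by rewrite addr_ge0// ltW.
have [d D] := continuous_FTC1_closed x1 (iw x10) x0 cw.
rewrite -D !derive1E; transitivity ('D_1 (fun y => p1 + prim1 w y) x).
  apply: near_eq_derive => //; near=> y.
  by apply: dRp_second_prim; apply: ltW; near: y; exact: lt_nbhsr.
by rewrite deriveD//= derive_cst add0r.
Unshelve. all: by end_near. Qed.

Lemma loc_abs_cont_second_prim : loc_abs_cont_Rp (dRp f).
Proof. by apply: (@loc_abs_cont_prim1 _ w iw _ p1) => x; exact: dRp_second_prim. Qed.

Lemma measurable_second_prim : measurable_fun (Rplus R) f.
Proof.
have m0 : measurable_fun (`]0, +oo[ : set R) f.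
  apply: subspace_continuous_measurable_fun => //.
  apply: continuous_at_within => x /=; rewrite in_itv/= andbT.
  by move=> /is_derive_second_prim/is_derive_continuous.
have m1 : measurable_fun setT (f \_ `]0, +oo[) by apply/(measurable_restrictT _ _).1.
apply: (measurable_off_finite (F := [:: 0]) _ (measurable_funTS m1)) => //.
move=> x /=; rewrite in_itv/= andbT inE => x0 xn0.
by rewrite patchE mem_set//= in_itv/= andbT lt_neqAle eq_sym xn0.
Qed.

End SecondPrimitive.

Section Extremal.
Context {R : realType}.
Notation mu := (@lebesgue_measure R).
Variables (s : \bar R) (k a b : R).
Hypotheses (s1 : (1 < s)%E) (k1 : 1 < k) (k2 : k < 2 - inv_exp s) (Hab : is_ab s k a b).

Let abM : in_M a b. Proof. by case: Hab. Qed.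
Let a0 : 0 < a. Proof. by case: abM => /andP[]. Qed.
Let a1 : a < 1. Proof. by case: abM => /andP[]. Qed.
Let ab : a <= b. Proof. by case: abM. Qed.

Notation w := (tau_s s k a b).

Let mw : measurable_fun (Rplus R) w. Proof. exact: measurable_tau_s. Qed.

Let iw c : 0 <= c -> mu.-integrable `[0, c] (EFin \o w).
Proof.
move=> c0; apply: integrableS (integrable_tau_s s1 k1 k2 abM) => // t /=.
by rewrite !in_itv/= andbT => /andP[].
Qed.

Let itw c : 0 <= c -> mu.-integrable `[0, c] (EFin \o (fun t => t * w t)).
Proof.
move=> c0; apply: (@integrable_mul_itv _ _ _ 0 c id) => //; first exact: iw.
by move=> x; exact: cvg_id.
Qed.

(** Half the drop of [phi] from 0 to [a], so that its values at these two points are opposite. *)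
Definition phi_max : R := 2^-1 * \int[mu]_(t in `[0, a]) (t * w t).

Lemma phiE x : phi s k a b x = phi_max + x * - prim1 w a + prim2 w x.
Proof.
rewrite /phi; congr (_ + _).
have E t : (- x + t / 2) * w t = 2^-1 * (t * w t) + - x * w t by field.
under eq_Rintegral do rewrite E.
rewrite RintegralD//; [|exact/integrable_EFinZl/itw/ltW|exact/integrable_EFinZl/iw/ltW].
rewrite !RintegralZl//; [|exact/iw/ltW|exact/itw/ltW].
by rewrite -/phi_max /prim1; ring.
Qed.

Lemma phi_max_gt0 : 0 < phi_max.
Proof.
rewrite /phi_max pmulr_rgt0 ?invr_gt0//; apply: (@Rintegral_gt0 _ _ _ 0 a) => //.
- exact/itw/ltW.
- move=> t /=; rewrite in_itv/= => /andP[t0 ta]; rewrite mulr_ge0// sgn_pow_ge0//.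
  by rewrite (tau_ge0 k1 abM)// t0 (le_trans ta).
- exact: subset_itv_oo_cc.
- move=> t /andP[t0 ta]; rewrite mulr_gt0// sgn_pow_gt0// (tau_gt0 k1 abM)//.
    by rewrite t0 (lt_le_trans ta).
  by rewrite lt_eqF.
Qed.

(** The first equation of [is_ab]. As the derivative of [phi] is [prim1 w] minus its value at [a],
    it vanishes at 1 as well as at [a]. *)
Let prim1_balance : prim1 w 1 = prim1 w a.
Proof.
apply/eqP; rewrite -subr_eq0 prim1B//; last by rewrite !ltW.
rewrite Rintegral_itv_obnd_cbnd//; first by case: Hab => _ -> _.
by apply: integrable_itvoc => //; exact: ltW.
Qed.

Lemma phi0 : phi s k a b 0 = phi_max.
Proof. by rewrite phiE mul0r addr0 /prim2 set_itv1 Rintegral_set1 addr0. Qed.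

Lemma phi_a : phi s k a b a = - phi_max.
Proof.
have E t : (a - t) * w t = a * w t - t * w t by rewrite mulrBl.
rewrite phiE /prim2; under eq_Rintegral do rewrite E.
rewrite RintegralB//; [|exact/integrable_EFinZl/iw/ltW|exact/itw/ltW].
rewrite RintegralZl//; last exact/iw/ltW.
by rewrite /phi_max /prim1; set I := \int[mu]_(t in _) (t * _); field.
Qed.

(** The second equation of [is_ab] turns [prim2 w 1] into [prim1 w 1], so the values at 0 and 1
    agree; past 1 the derivative stays zero because [w] vanishes there. *)
Lemma phi_ge1 x : 1 <= x -> phi s k a b x = phi_max.
Proof.
move=> x1; have x01 : 0 <= (1 : R) <= x by rewrite ler01 x1.
have p1 : prim2 w 1 = prim1 w 1.
  have E t : (1 - t) * w t = w t - t * w t by rewrite mulrBl mul1r.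
  rewrite /prim2; under eq_Rintegral do rewrite E.
  rewrite RintegralB//; [|exact: iw|exact: itw].
  by case: Hab => _ _ ->; rewrite subr0.
have := prim2_right iw x01.
rewrite (@eq_Rintegral _ _ _ mu _ (cst 0)); last first.
  by move=> t /set_mem/=; rewrite in_itv/= => /andP[/ltW/(tau_s_ge1 s k1 abM)-> _]; rewrite mulr0.
by rewrite Rintegral_cst//= mul0r p1 phiE prim1_balance => h; lra.
Qed.

Let w_ge0 t : 0 <= t <= b -> 0 <= w t.
Proof. by move=> tb; rewrite sgn_pow_ge0// (tau_ge0 k1 abM). Qed.

Let w_le0 t : b <= t -> w t <= 0.
Proof. by move=> tb; rewrite sgn_pow_le0// (tau_le0 k1 abM). Qed.

Let dphi_le0 x : 0 <= x <= a -> - prim1 w a + prim1 w x <= 0.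
Proof.
move=> /andP[x0 xa]; rewrite addrC -oppr_ge0 opprB prim1B// ?x0//.
apply: Rintegral_ge0 => t /=; rewrite in_itv/= => /andP[xt ta].
by rewrite w_ge0// (le_trans x0 (ltW xt)) (le_trans ta).
Qed.

(** Up to [b] one integrates [w >= 0] from [a]; beyond [b] one integrates [w <= 0] backwards from 1.
    The derivative of [phi] is zero at both starting points. *)
Let dphi_ge0 x : a <= x <= 1 -> 0 <= - prim1 w a + prim1 w x.
Proof.
move=> /andP[ax x1]; have x0 := le_trans (ltW a0) ax; rewrite addrC.
have [xb|bx] := leP x b.
  rewrite prim1B//; last by rewrite ax ltW.
  apply: Rintegral_ge0 => t /=.
  rewrite in_itv/= => /andP[xt ta].
  by rewrite w_ge0// (le_trans (ltW a0) (ltW xt)) (le_trans ta).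
rewrite -prim1_balance -oppr_le0 opprB prim1B//; last by rewrite x0.
rewrite -oppr_ge0 -mulN1r -RintegralZl//; last exact: integrable_itvoc.
apply: Rintegral_ge0 => t /=; rewrite in_itv/= => /andP[xt ta].
by rewrite mulN1r oppr_ge0 w_le0// ltW// (lt_trans bx).
Qed.

Lemma norm_phi_le x : 0 <= x -> `|phi s k a b x| <= phi_max.
Proof.
move=> x0; have P0 := phi_max_gt0.
have dphi (t : R) : 0 < t -> is_derive t 1 (phi s k a b) (- prim1 w a + prim1 w t).
  by move=> t0; apply: (is_derive_second_prim (w := w) iw phiE t0).
have dphi1 (t : R) : 0 < t -> derive1 (phi s k a b) t = - prim1 w a + prim1 w t.
  by move=> t0; rewrite derive1E; have [_ ->] := dphi _ t0.
have cphi (t : R) : 0 < t -> {for t, continuous (phi s k a b)}.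
  by move=> t0; exact: is_derive_continuous (dphi _ t0).
have [x1|x1] := leP 1 x; first by rewrite phi_ge1// gtr0_norm.
have [ax|xa] := leP a x.
  have c : {within `[a, 1], continuous (phi s k a b)}.
    apply: continuous_at_within => t /=; rewrite in_itv/= => /andP[ta _].
    exact/cphi/(lt_le_trans a0).
  have mono := ger0_derive1_le_cc (f := phi s k a b) _ _ c.
  have mono' y z : a <= y -> y <= z -> z <= 1 -> phi s k a b y <= phi s k a b z.
    move=> ay yz z1; apply: mono => //.
    - by move=> t; rewrite in_itv/= => /andP[/(lt_trans a0)/dphi[]].
    - move=> t; rewrite in_itv/= => /andP[at' t1]; rewrite dphi1 ?(lt_trans a0)//.
      by rewrite dphi_ge0// !ltW.
    - by rewrite in_itv/= ay (le_trans yz).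
    - by rewrite in_itv/= z1 (le_trans ay).
  rewrite ler_norml -phi_a; apply/andP; split; first by apply: mono' => //; exact: ltW.
  by rewrite -(phi_ge1 (lexx 1)); apply: mono' => //; exact: ltW.
have c : {within `[0, a], continuous (phi s k a b)}.
  apply/continuous_within_itvP => //; split.
  - by move=> t; rewrite in_itv/= => /andP[/cphi].
  - by apply: derivable_Rp_right_continuous; case: (derivable_second_prim iw phiE).
  - by apply: cvg_at_left_filter; exact: cphi.
have mono := ler0_derive1_le_cc (f := phi s k a b) _ _ c.
have mono' y z : 0 <= y -> y <= z -> z <= a -> phi s k a b z <= phi s k a b y.
  move=> ay yz z1; apply: mono => //.
  - by move=> t; rewrite in_itv/= => /andP[/dphi[]].
  - by move=> t; rewrite in_itv/= => /andP[t0 ta]; rewrite dphi1// dphi_le0// !ltW.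
  - by rewrite in_itv/= z1 (le_trans ay).
  - by rewrite in_itv/= ay (le_trans yz).
rewrite ler_norml -phi_a; apply/andP; split; first by apply: mono' => //; exact: ltW.
by rewrite -phi0; apply: mono' => //; exact: ltW.
Qed.

Let T := tau_pow_int s k a b.

(** The missing lower bound comes from Holder's inequality for [w * tau], whose integral is T: it
    gives T <= norm(w) T^(1 - 1/s), for infinite [s] too. *)
Lemma normRp_tau_sE : normRp s w = (T `^ inv_exp s)%:E.
Proof.
apply/eqP; rewrite eq_le normRp_tau_s//=.
have Nw : (normRp s w < +oo)%E by apply: le_lt_trans (ltry _); exact: normRp_tau_s.
have T0 : 0 < T by exact: tau_pow_int_gt0.
have := hoelder_le s1 mw Nw _ _ _ (integrable_tau_pow s1 k1 k2 abM).
under eq_Rintegral do rewrite mul_tau_s//.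
rewrite -/(tau_pow_int s k a b) -/T (gtr0_norm T0) => h.
rewrite (fine_normRp Nw) lee_fin -(ler_pM2r (powR_gt0 (1 - inv_exp s) T0)).
rewrite -powRD; last by apply/implyP => _; rewrite gt_eqF.
rewrite addrCA subrr addr0 (powRr1 (ltW T0)); apply: h => //.
- by move=> t /=; rewrite !in_itv/= andbT => /andP[/ltW].
- apply: measurable_funS (measurable_tau k1 abM) => // t /=.
  by rewrite !in_itv/= andbT => /andP[/ltW].
Qed.

Section scaled.
Variable c : R.
Hypothesis c0 : 0 <= c.
(** The scale 1 gives [phi], whose second derivative normalises [Phi]; the inverse of that norm
    gives [Phi] itself. *)
Let f x := c * phi s k a b x.
Let v t := c * w t.

Let iv d : 0 <= d -> mu.-integrable `[0, d] (EFin \o v).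
Proof. by move=> d0; apply: integrable_EFinZl => //; exact: iw. Qed.

Let mv : measurable_fun (Rplus R) v.
Proof. exact: measurable_funM. Qed.

Let fE x : f x = c * phi_max + x * (- c * prim1 w a) + prim2 v x.
Proof.
rewrite /f phiE /prim2.
have E t : (x - t) * v t = c * ((x - t) * w t) by rewrite /v mulrCA.
under [in RHS]eq_Rintegral do rewrite E.
have [x0|x0] := leP 0 x; last first.
  have -> : `[0, x]%classic = set0 :> set R by rewrite set_itv_ge// bnd_simp -ltNge.
  by rewrite !Rintegral_set0; ring.
rewrite RintegralZl//; first by ring.
apply: (@integrable_mul_itv _ _ _ 0 x (fun t => x - t)) => //; first exact: iw.
by move=> t; apply: cvgB; [exact: cvg_cst|exact: cvg_id].
Qed.

Let dRp2_off x : 0 < x -> x \notin [:: a; b; 1] -> dRp (dRp f) x = v x.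
Proof.
move=> x0; rewrite !inE !negb_or => /and3P[xa xb x1].
apply: (dRp2_second_prim iv fE x0); apply: cvgM; first exact: cvg_cst.
exact: tau_s_continuous.
Qed.

Let measurable_dRp2 : measurable_fun (Rplus R) (dRp (dRp f)).
Proof.
apply: (@measurable_off_finite _ _ [:: 0; a; b; 1] _ v) => // x /=.
rewrite in_itv/= andbT [x \in _]inE negb_or => x0 /andP[xn0].
by apply: dRp2_off; rewrite lt_neqAle eq_sym xn0.
Qed.

Lemma normRp_dRp2_scaled : normRp s (dRp (dRp f)) = (c * T `^ inv_exp s)%:E.
Proof.
have s0 : (0 < s)%E by apply: lt_trans s1; rewrite lte_fin ltr01.
rewrite EFinM -normRp_tau_sE -normRpZ//; apply: ae_eq_normRp => //.
exists [set` [:: 0; a; b; 1]]; split.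
- apply: countable_measurable => [t|]; first exact: measurable_set1.
  by apply: finite_set_countable; exact: finite_seq.
- by apply: countable_lebesgue_measure0; apply: finite_set_countable; exact: finite_seq.
- move=> x /= /not_implyP[x0 /eqP nE]; apply: contraNT nE.
  rewrite [x \in _]inE negb_or => /andP[xn0 xF].
  by rewrite dRp2_off// lt_neqAle eq_sym xn0.
Qed.

Lemma normRpoo_scaled : normRp +oo f = (c * phi_max)%:E.
Proof.
have P0 := phi_max_gt0; apply/eqP; rewrite eq_le; apply/andP; split.
  apply: normRpoo_le; first by rewrite mulr_ge0// ltW.
  by apply: aeW => x x0; rewrite /f normrM (ger0_norm c0) ler_wpM2l// norm_phi_le.
have f0 : f 0 = c * phi_max by rewrite /f phi0.
have := right_continuous_normRpoo (lexx 0) (derivable_Rp_right_continuous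
  (derivable_second_prim iv fE).2).
by rewrite f0 ger0_norm// mulr_ge0// ltW.
Qed.

Lemma L2_infty_scaled : L2_infty s f.
Proof.
split.
- split; first exact: measurable_second_prim iv fE.
  by rewrite normRpoo_scaled ltry.
- exact: derivable_second_prim iv fE.
- exact: loc_abs_cont_second_prim iv fE.
- split; first exact: measurable_dRp2.
  by rewrite normRp_dRp2_scaled ltry.
Qed.

(* The extremal function turns every inequality of [remainder_integral_dilated] into
   an equality. *)
Lemma taylor_integral_scaled :
  k * (k - 1) * taylor_integral k f 0 =
  c * (T + 2 * (slope1 k a b - slope2 k b) * phi_max).
Proof.
have k0 : 0 < k by exact: lt_trans k1.
have fM t : 0 <= t -> `|f t| <= c * phi_max.
  by move=> t0; rewrite /f normrM (ger0_norm c0) ler_wpM2l// norm_phi_le.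
have f0 : f 0 = c * phi_max by rewrite /f phi0.
have fT t : 0 <= t -> f t = f 0 + t * (- c * prim1 w a) + prim2 v t.
  by move=> _; rewrite f0 fE.
have a01 : 0 < a < 1 by rewrite a0.
have tE u : 0 < u <= 1 -> tau k a b u = u `^ (1 - k) -
    (if u <= a then slope1 k a b * u else 1 - slope2 k b * (1 - u)).
  by move=> /andP[u0 u1]; rewrite (tauE k1 abM (ltW u0)) u1; case: ifP.
have vtE u : v u * tau k a b u = c * `|tau k a b u| `^ conj_exp s.
  by rewrite /v -mulrA mul_tau_s.
have ivt : mu.-integrable `]0, 1] (EFin \o (fun u => v u * tau k a b u)).
  have i : mu.-integrable `]0, 1] (EFin \o (fun u => c * `|tau k a b u| `^ conj_exp s)).
    by apply: integrable_EFinZl => //; exact: integrable_tau_pow.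
  by apply: eq_integrable i => // t _ /=; rewrite vtE.
have [_] := remainder_integral_tau k1 (measurable_second_prim iv fE) fM mv iv fT a01
  (slope_balance k abM) tE ivt.
have -> : \int[mu]_(t in `]0, +oo[) remainder k f (- c * prim1 w a) t =
    taylor_integral k f 0.
  have d0 : dRp f 0 = - c * prim1 w a.
    by rewrite (dRp_second_prim iv fE (lexx 0)) {2}/prim1 set_itv1 Rintegral_set1 addr0.
  by rewrite /taylor_integral d0; apply: eq_Rintegral => t _; rewrite /remainder add0r.
move=> ->.
under eq_Rintegral do rewrite vtE.
rewrite RintegralZl//; last exact: integrable_tau_pow.
have [it et] := tail_weight k1.
have -> : \int[mu]_(t in `[1, +oo[) (f t / t `^ (1 + k)) = c * phi_max * k^-1.
  rewrite -et -RintegralZl//; apply: eq_Rintegral => t /set_mem/=.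
  by rewrite in_itv/= andbT => t1; rewrite /f phi_ge1.
rewrite /f phi0 phi_a phi_ge1// -/(tau_pow_int s k a b) -/T.
by field; rewrite gt_eqF.
Qed.

End scaled.

End Extremal.

(** * The inequality *)

Section Optimisation.
Context {R : realType}.

(** [F0] and [F2] stand for the norms of a function and of its second derivative, [P] and [N] for
    those of the extremal function, which has equality at [h = 1] with [y = I0]. The extremal
    numbers thus supply the best [h] without differentiation. *)
Lemma optimise_dilation (D A B P N I0 k n F0 F2 y : R) :
  0 < D -> 0 <= A -> 0 <= B -> 0 < P -> 0 < N -> 0 < k < n -> 0 <= F0 -> 0 <= F2 ->
  0 <= y -> D * I0 = N * A + B * P ->
  (forall h, 0 < h -> D * (h `^ k * y) <= h `^ n * (F2 * A) + B * F0) ->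
  y <= I0 * ((F0 / P) `^ (1 - k / n) * (F2 / N) `^ (k / n)).
Proof.
move=> D0 A0 B0 P0 N0 /andP[k0 kn] F00 F20 y0 DI H.
have n0 := lt_trans k0 kn.
have nk0 : 0 < n - k by rewrite subr_gt0.
have l1 : 0 < 1 - k / n by rewrite subr_gt0 ltr_pdivrMr// mul1r.
have ln0 : 0 < k / n by rewrite divr_gt0.
move: F00; rewrite le_eqVlt => /predU1P[F0E|F00].
  rewrite -F0E mul0r powR0 ?gt_eqF// mul0r mulr0 leNgt; apply/negP => yp.
  have Dy : 0 < D * y by rewrite mulr_gt0.
  have FA : 0 < F2 * A.
    by have := H 1 ltr01; rewrite !powR1 !mul1r -F0E mulr0 addr0; exact: lt_le_trans.
  (* If [F0 = 0], a small [h] is contradictory: with h^(n - k) = z the right side is only half the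
     left one. *)
  pose z := D * y / (2 * (F2 * A)); have z0 : 0 < z by rewrite divr_gt0// mulr_gt0.
  pose h := z `^ (n - k)^-1; have h0 : 0 < h by exact: powR_gt0.
  have hz : h `^ (n - k) = z by rewrite -powRrM mulVf ?gt_eqF// powRr1// ltW.
  have hn : h `^ n = h `^ k * z.
    by rewrite -hz -powRD ?subrKC//; apply/implyP => _; rewrite gt_eqF.
  have := H h h0; rewrite -F0E mulr0 addr0 hn -mulrA mulrCA ler_pM2l ?powR_gt0//.
  have -> : z * (F2 * A) = D * y / 2 by move: FA; rewrite /z; set X := F2 * A => FA; field; rewrite gt_eqF.
  lra.
move: F20; rewrite le_eqVlt => /predU1P[F2E|F20].
  rewrite -F2E mul0r [0 `^ _]powR0 ?gt_eqF// !mulr0 leNgt; apply/negP => yp.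
  have Dy : 0 < D * y by rewrite mulr_gt0.
  (* If [F2 = 0], a large [h] is contradictory: with h^k = z the left side is [B * F0 + 1], the
     right side [B * F0]. *)
  pose z := (B * F0 + 1) / (D * y).
  have z0 : 0 < z by rewrite divr_gt0// ltr_wpDl// mulr_ge0// ltW.
  have h0 : 0 < z `^ k^-1 by exact: powR_gt0.
  have := H _ h0; rewrite -powRrM mulVf ?gt_eqF// powRr1 ?(ltW z0)// -F2E mul0r mulr0 add0r.
  rewrite mulrCA /z divfK ?gt_eqF//; lra.
pose al := F0 / P; pose be := F2 / N.
have al0 : 0 < al by rewrite divr_gt0.
have be0 : 0 < be by rewrite divr_gt0.
(* With this [h] both terms on the right become [al] times those of the extremal identity [DI]. *)
pose h := (al / be) `^ n^-1.
have ab0 : 0 < al / be by rewrite divr_gt0.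
have h0 : 0 < h by exact: powR_gt0.
have hn : h `^ n = al / be by rewrite -powRrM mulVf ?gt_eqF// powRr1// ltW.
have hk : h `^ k = (al / be) `^ (k / n) by rewrite -powRrM [n^-1 * k]mulrC.
have := H h h0; rewrite hn hk.
have -> : al / be * (F2 * A) + B * F0 = D * (al * I0).
  rewrite [RHS]mulrCA DI /be /al; field; rewrite !gt_eqF//.
rewrite ler_pM2l// -/al -/be.
have ak : 0 < al `^ (k / n) by exact: powR_gt0.
have bk : 0 < be `^ (k / n) by exact: powR_gt0.
have abE : (al / be) `^ (k / n) = al `^ (k / n) / be `^ (k / n).
  apply: (mulIf (lt0r_neq0 bk)); rewrite divfK ?gt_eqF// -powRM ?(ltW ab0) ?(ltW be0)//.
  by rewrite divfK// gt_eqF.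
rewrite abE => h1.
have -> : al `^ (1 - k / n) = al / al `^ (k / n).
  by rewrite powRB ?(powRr1 (ltW al0))//; apply/implyP => _; rewrite gt_eqF.
rewrite (_ : I0 * _ = al * I0 * (be `^ (k / n) / al `^ (k / n))); last by ring.
rewrite -ler_pdivrMr ?divr_gt0//; apply: le_trans h1.
by rewrite invf_div mulrC.
Qed.

End Optimisation.

Theorem corollary9 (R : realType) (s : \bar R) (hs : (1 < s)%E)
  (k : R) (hk1 : 1 < k) (hk2 : k < 2 - inv_exp s)
  (n : nat) (hn : k < n%:R)
  (a b : R) (hab : is_ab s k a b) :
  let lam : R := k / (2 - inv_exp s) in
  let C : \bar R := (normRp +oo (marchaud n k (Phi s k a b)) /
                     normRp +oo (Phi s k a b) `^ (1 - lam))%E in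
  let bound (c : \bar R) (f : R -> R) : Prop :=
    (normRp +oo (marchaud n k f) <=
       c * (normRp +oo f `^ (1 - lam) * normRp s (dRp (dRp f)) `^ lam))%E in
  (forall f : R -> R, L2_infty s f -> bound C f) /\
  (forall c : R, (c%:E < C)%E ->
     exists2 f : R -> R, L2_infty s f & ~ bound c%:E f).
Proof.
move=> lam C bound; have abM : in_M a b by case: hab.
have k0 : 0 < k by exact: lt_trans hk1.
pose T := tau_pow_int s k a b; pose P := phi_max s k a b.
have T0 : 0 < T by exact: tau_pow_int_gt0.
have P0 : 0 < P by exact: phi_max_gt0 hab.
pose N := T `^ inv_exp s; have N0 : 0 < N by exact: powR_gt0.
have kk : 0 < k * (k - 1) by rewrite mulr_gt0// subr_gt0.
pose B := 2 * (slope1 k a b - slope2 k b).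
have B0 : 0 <= B.
  rewrite mulr_ge0// subr_ge0 (le_trans (ltW (slope2_lt0 hk1 abM)))//.
  by rewrite ltW// slope1_gt0.
(* The Taylor integral of [phi] at 0, by the equality case. *)
pose I0 := (T + B * P) / (k * (k - 1)).
have DI : k * (k - 1) * I0 = N * T `^ (1 - inv_exp s) + B * P.
  rewrite /I0 mulrC divfK ?gt_eqF// /N -powRD.
    by rewrite addrCA subrr addr0 powRr1// ltW.
  by apply/implyP => _; rewrite gt_eqF.
have taylor_le f x : L2_infty s f -> 0 <= x -> `|taylor_integral k f x| <=
    I0 * ((fine (normRp +oo f) / P) `^ (1 - lam) * (fine (normRp s (dRp (dRp f))) / N) `^ lam).
  move=> Lf x0.
  apply: (optimise_dilation kk (powR_ge0 T (1 - inv_exp s)) B0 P0 N0 _ _ _ _ DI) => //.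
  - by rewrite k0.
  - by rewrite fine_ge0// normRp_ge0.
  - by rewrite fine_ge0// normRp_ge0.
  - by move=> h h0; exact: (taylor_integral_le hs hk1 hk2 Lf abM x0 h0).
pose K := (varkappa k n)^-1 *
  (\sum_(m < n.+1) (-1) ^+ m * 'C(n, m)%:R * m%:R `^ k).
have mE f x : L2_infty s f -> 0 <= x -> marchaud n k f x = K * taylor_integral k f x.
  by move=> Lf x0; exact: (marchaud_taylor hs hk1 hk2 Lf abM hn x0).
have N0' : 0 <= N^-1 by rewrite invr_ge0 ltW.
have PhiE : Phi s k a b = (fun x => N^-1 * phi s k a b x).
  apply/funext => x; rewrite /Phi (_ : normRp s (dRp (dRp (phi s k a b))) = N%:E)//.
  have := normRp_dRp2_scaled hs hk1 hk2 hab ler01.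
  by rewrite mul1r => <-; congr (normRp _ (dRp (dRp _))); apply/funext => y; rewrite mul1r.
have LPhi : L2_infty s (Phi s k a b) by rewrite PhiE; exact: L2_infty_scaled.
have normPhi : normRp +oo (Phi s k a b) = (P / N)%:E.
  by rewrite PhiE (normRpoo_scaled hs hk1 hk2 hab N0') mulrC.
have normPhi2 : normRp s (dRp (dRp (Phi s k a b))) = 1%E.
  by rewrite PhiE (normRp_dRp2_scaled hs hk1 hk2 hab N0') -/T -/N mulVf ?gt_eqF.
have taylorPhi : taylor_integral k (Phi s k a b) 0 = I0 / N.
  have := taylor_integral_scaled hs hk1 hk2 hab N0'; rewrite -PhiE -/T -/P -/B => e.
  by rewrite /I0 mulrAC -[_ * N^-1]mulrC -e mulrC mulKf ?gt_eqF.
have I00 : 0 <= I0 by rewrite divr_ge0// ?ltW// ltr_wpDr// mulr_ge0// ltW.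
have lam1 : lam < 1.
  by rewrite /lam ltr_pdivrMr ?mul1r// (lt_trans k0).
have lam0 : 0 < lam by rewrite divr_gt0// (lt_trans k0).
have PN0 : 0 < P / N by rewrite divr_gt0.
(* For [Phi] both ratios of norms equal [1 / N], so the two powers in [taylor_le] combine to
   [1 / N]; right-continuity at 0 gives the reverse inequality. *)
have marchaudPhi : normRp +oo (marchaud n k (Phi s k a b)) = (`|K| * (I0 / N))%:E.
  apply/eqP; rewrite eq_le; apply/andP; split.
    apply: normRpoo_le; first by rewrite mulr_ge0// divr_ge0// ltW.
    apply: aeW => x x0; rewrite mE// normrM ler_wpM2l//.
    apply: le_trans (taylor_le _ _ LPhi x0) _.
    have PNP : P / N / P = 1 / N by field; rewrite !gt_eqF.
    rewrite normPhi normPhi2 /= PNP.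
    rewrite -powRD; last by rewrite subrK oner_eq0.
    by rewrite subrK mul1r powRr1.
  have m0 : marchaud n k (Phi s k a b) 0 = K * (I0 / N) by rewrite mE// taylorPhi.
  have c : K * taylor_integral k (Phi s k a b) x @[x --> 0^'+] --> K * (I0 / N).
    rewrite -taylorPhi; apply: cvgM; first exact: cvg_cst.
    exact: (taylor_integral_right_continuous0 hs hk1 hk2 LPhi abM).
  have mc : marchaud n k (Phi s k a b) x @[x --> 0^'+] --> marchaud n k (Phi s k a b) 0.
    rewrite m0; apply: cvg_trans c; apply: near_eq_cvg; near=> x.
    by rewrite mE//; near: x; exact: nbhs_right_ge.
  have := right_continuous_normRpoo (lexx 0) mc.
  by rewrite m0 normrM [`|I0 / N|]ger0_norm// divr_ge0// ltW.
have CE : C = (`|K| * (I0 / N) / (P / N) `^ (1 - lam))%:E.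
  by rewrite /C marchaudPhi normPhi poweR_EFin inver gt_eqF ?powR_gt0.
split.
  move=> f Lf; rewrite /bound CE.
  have [[_ Nf] _ _ [_ NW]] := Lf.
  pose F0 := fine (normRp +oo f); pose F2 := fine (normRp s (dRp (dRp f))).
  have F00 : 0 <= F0 by rewrite fine_ge0// normRp_ge0.
  have F20 : 0 <= F2 by rewrite fine_ge0// normRp_ge0.
  rewrite (fine_normRp Nf) (fine_normRp NW) -/F0 -/F2.
  rewrite !poweR_EFin -!EFinM.
  have -> : `|K| * (I0 / N) / (P / N) `^ (1 - lam) * (F0 `^ (1 - lam) * F2 `^ lam) =
      `|K| * (I0 * ((F0 / P) `^ (1 - lam) * (F2 / N) `^ lam)).
    have eP : F0 `^ (1 - lam) = (F0 / P) `^ (1 - lam) * P `^ (1 - lam).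
      by rewrite -powRM ?divr_ge0 ?(ltW P0)// divfK ?gt_eqF.
    have eN : F2 `^ lam = (F2 / N) `^ lam * N `^ lam.
      by rewrite -powRM ?divr_ge0 ?(ltW N0)// divfK ?gt_eqF.
    have ePN : P `^ (1 - lam) = (P / N) `^ (1 - lam) * N `^ (1 - lam).
      by rewrite -powRM ?divr_ge0 ?(ltW P0) ?(ltW N0)// divfK ?gt_eqF.
    have NN : N `^ (1 - lam) * N `^ lam = N.
      by rewrite -powRD ?subrK ?oner_eq0// powRr1// ltW.
    rewrite eP eN ePN -{1}NN; field.
    by rewrite !gt_eqF ?powR_gt0.
  apply: normRpoo_le.
    by do 2!apply: mulr_ge0 => //; apply: mulr_ge0; exact: powR_ge0.
  apply: aeW => x x0; rewrite mE// normrM ler_wpM2l//.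
  exact: taylor_le.
(* [Phi] attains equality with the constant [C], its second derivative having norm 1, so it refutes
   every smaller constant. *)
move=> c; rewrite CE lte_fin => cC; exists (Phi s k a b) => //.
rewrite /bound marchaudPhi normPhi normPhi2 poweR_EFin poweR1r mule1 -EFinM lee_fin.
by apply/negP; rewrite -ltNge -ltr_pdivlMr ?powR_gt0.
Unshelve. all: by end_near. Qed.
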